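(* Let $f(x)=\int_0^\infty (1-e^{-xs})\,\overline{\nu}(ds)$, $x>0$, be a Bernstein function whose Lévy measure $\overline{\nu}$ on $(0,\infty)$ satisfies $\int_0^\infty (s\wedge 1)\,\overline{\nu}(ds)<\infty$. Assume that $\overline{\nu}(0,\infty)=\infty$ and that the tail $\nu(s)=\overline{\nu}(s,\infty)$, $s>0$, is absolutely continuous. Let $Y^f$ be the inverse of a subordinator $H^f$ with Laplace exponent $f$, let $\tilde l^f(t,\eta)=\mathsf{E}e^{-\eta Y^f(t)}$ for $\eta\in\mathbb{R}$, and let $N$ be a homogeneous Poisson process with intensity $\lambda>0$, independent of $Y^f$. Then for every $\theta\in\mathbb{R}$ the moment generating function $M(\theta,t)=\mathsf{E}e^{\theta N(Y^f(t))}$ of the process $N(Y^f(t))$ is given by $$M(\theta,t)=\tilde l^f\left(t,\lambda(1-e^{\theta})\right)$$ and satisfies, for $t>0$, the differential equation $${}^f\mathcal{D}_t\,M(\theta,t)=\lambda\left(e^{\theta}-1\right)M(\theta,t)$$ with initial condition $M(\theta,0)=1$.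
   Context: Subordinator and inverse: $H^f(t)$, $t\ge0$, is the subordinator with $\mathsf{E}e^{-xH^f(t)}=e^{-tf(x)}$ for $x>0$, and $Y^f(t)=\inf\{s\ge 0: H^f(s)>t\}$. Under the stated conditions on $\overline{\nu}$, for $t>0$ the random variable $Y^f(t)$ has a density $u\mapsto l^f(t,u)$ on $(0,\infty)$, and $\int_0^\infty e^{-rt}l^f(t,u)\,dt=\frac{f(r)}{r}e^{-uf(r)}$, $r>0$ (known fact); thus $\tilde l^f(t,\eta)=\int_0^\infty e^{-\eta u}l^f(t,u)\,du$. Absolute continuity of the tail is understood on $(0,\infty)$, i.e. on compact subintervals. Convolution-type derivative: the generalized Caputo-Djrbashian derivative with respect to $f$ is defined on absolutely continuous functions $w$ by $${}^f\mathcal{D}_t w(t)=\int_0^t \frac{\partial}{\partial t}w(t-s)\,\nu(s)\,ds,\qquad \nu(s)=\overline{\nu}(s,\infty),$$ and here it acts in the variable $t$. *)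

(* Defs.v *)
From HB Require Import structures.
From mathcomp Require Import all_boot all_order all_algebra.
From mathcomp Require Import all_classical all_reals all_analysis.

Set Implicit Arguments.
Unset Strict Implicit.
Unset Printing Implicit Defensive.

Import Order.TTheory GRing.Theory Num.Theory.
Import numFieldNormedType.Exports.

Local Open Scope classical_set_scope.
Local Open Scope ring_scope.

Section Calculus.
Context {R : realType}.

Definition abs_continuous_itv (a b : R) (w : R -> R) : Prop :=
  forall e : R, 0 < e -> exists2 del : R, 0 < del &
    forall (n : nat) (u v : nat -> R),
      (forall i, (i < n)%N -> [/\ a <= u i, u i <= v i & v i <= b]) ->
      trivIset `I_n (fun i => `]u i, v i[%classic) ->
      \sum_(i < n) (v i - u i) < del ->
      \sum_(i < n) `|w (v i) - w (u i)| < e.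

(* Absolute continuity on every compact subinterval of D. *)
Definition abs_continuous_on (D : set R) (w : R -> R) : Prop :=
  forall a b : R, a <= b -> `[a, b]%classic `<=` D -> abs_continuous_itv a b w.

(* Generalized Caputo-Djrbashian derivative with kernel nu. It is meant for
   locally absolutely continuous w: at the Lebesgue-null set of points where
   the inner derivative does not exist, derive1 returns the default value 0. *)
Definition caputo_djrbashian (nu w : R -> R) (t : R) : \bar R :=
  (\int[lebesgue_measure]_(s in `]0%R, t[)
     (derive1 (fun tau : R => w (tau - s)) t * nu s)%R%:E)%E.

(* Only the restriction of nubar to ]0, +oo[ matters, here and below. *)
Definition levy_tail (nubar : {measure set R -> \bar R}) (s : R) : R :=
  fine (nubar `]s, +oo[%classic).

End Calculus.

Section Processes.
Context {R : realType} {d : measure_display} {T : measurableType d}.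
Context (P : probability T R).

(* Choosing B i = setT recovers the product rule for all subfamilies. *)
Definition mutually_independent (n : nat) (X : 'I_n -> T -> R) : Prop :=
  forall B : 'I_n -> set R, (forall i, measurable (B i)) ->
    P (\bigcap_(i in [set: 'I_n]) (X i @^-1` B i)) =
    (\prod_(i < n) P (X i @^-1` B i))%E.

Definition independent_increments (X : R -> T -> R) : Prop :=
  forall (n : nat) (t : nat -> R),
    0 <= t 0%N -> {homo t : i j / (i <= j)%N >-> i <= j} ->
    mutually_independent (fun (i : 'I_n) w => X (t i.+1) w - X (t i) w).

Definition stationary_increments (X : R -> T -> R) : Prop :=
  forall (s h : R) (B : set R), 0 <= s -> 0 <= h -> measurable B ->
    P [set w | B (X (s + h) w - X s w)] = P [set w | B (X h w - X 0 w)].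

(* The process indexed by R is only looked at for nonnegative times. *)
Record is_subordinator (H : R -> T -> R) : Prop := IsSubordinator {
  subordinator0 : forall w, H 0 w = 0 ;
  subordinator_nondecreasing : forall w (s t : R),
    0 <= s -> s <= t -> H s w <= H t w ;
  subordinator_right_continuous : forall w (t : R),
    0 <= t -> H^~ w @ t^'+ --> H t w ;
  subordinator_independent : independent_increments H ;
  subordinator_stationary : stationary_increments H }.

Definition has_laplace_exponent (H : R -> T -> R) (f : R -> R) : Prop :=
  forall t x : R, 0 <= t -> 0 < x ->
    ('E_P[fun w => expR (- (x * H t w))] = (expR (- (t * f x)))%:E)%E.

(* The real inf of the empty set is 0; for the subordinators of interest the
   set below is nonempty with probability one. *)
Definition inverse_subordinator (H : R -> T -> R) (t : R) (w : T) : R :=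
  inf [set s | 0 <= s /\ t < H s w].

(* poisson_pmf is the Poisson law only at positive rates, so lambda > 0 is
   assumed wherever this is used. *)
Record is_poisson_process (lambda : R) (N : R -> T -> nat) : Prop :=
  IsPoissonProcess {
  poisson_process0 : forall w, N 0 w = 0%N ;
  poisson_process_nondecreasing : forall w (s t : R),
    0 <= s -> s <= t -> (N s w <= N t w)%N ;
  poisson_process_right_continuous : forall w (t : R),
    0 <= t -> \forall s \near t^'+, N s w = N t w ;
  poisson_process_independent :
    independent_increments (fun t w => (N t w)%:R) ;
  poisson_process_increment : forall (s t : R) (k : nat),
    0 <= s -> s < t ->
    P [set w | (N t w - N s w)%N = k] =
    (poisson_pmf (lambda * (t - s)) k)%:E }.

Definition sigma_process d' (T' : measurableType d') (X : R -> T -> T') :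
    set (set T) :=
  <<s \bigcup_(t in `[0, +oo[) preimage_set_system setT (X t) measurable >>.

Definition independent_processes d1 (T1 : measurableType d1)
    d2 (T2 : measurableType d2) (X1 : R -> T -> T1) (X2 : R -> T -> T2) :
    Prop :=
  forall A B : set T, sigma_process X1 A -> sigma_process X2 B ->
    P (A `&` B) = (P A * P B)%E.

End Processes.

(* Main.v *)
(** Put [eta = lambda * (1 - exp theta)].  Since [Y t] is independent of the
    Poisson process, [M theta t = E exp (- eta * Y t)], and this equals
    [1 - eta * G t] where [G t = \int_(u >= 0) exp (- eta u) P(H u < t) du] is the
    [eta]-weighted potential of [H], with Laplace transform
    [1 / (x (eta + f x))].

    Analytically, [G] is the decreasing limit of the potentials [F j] of the
    compound Poisson processes obtained by keeping only the jumps larger than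
    [a j], where [a j] tends to [0].  Each truncation has finite mass [c j], and
    [F j] is a Neumann series in the jump density divided by [eta + c j].  Because
    [c j] tends to infinity, only a vanishing part of [F j] comes from the jumps in
    [a j, a i], and smoothing by the density of the remaining large jumps makes
    the limit absolutely continuous.  Passing to the limit in the identity
    satisfied by [F j] gives [G' * nu = 1 - eta * G], that is the Caputo equation
    for [1 - eta * G].  Uniqueness of Laplace transforms identifies the two
    descriptions of [G]. *)

Require Import Defs.
From HB Require Import structures.
From mathcomp Require Import all_boot all_order all_algebra.
From mathcomp Require Import all_classical all_reals all_analysis.
From mathcomp Require Import measurable_realfun ring lra.

Set Implicit Arguments.
Unset Strict Implicit.
Unset Printing Implicit Defensive.

Import Order.TTheory GRing.Theory Num.Theory.
Import numFieldNormedType.Exports.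

Local Open Scope classical_set_scope.
Local Open Scope ring_scope.

(** * Convolution and potentials on the half line *)

(** When [theta > 0] the number [eta] is negative, and even the finiteness of [E exp (- eta * Y t)]
    has to be proved. Every estimate rests on one point [X] at which the truncated Laplace exponents
    [f_j] satisfy [eta + f_j X >= kap > 0] for all [j] at once: since [exp (X * t)] is an
    eigenfunction of each convolution operator, it is a barrier that bounds all potentials uniformly
    in [j]. Monotone convergence of [F j] is too weak in two ways. Each [F j] has an atom [1 / q j]
    at the origin, with [q j = eta + c j], so absolute continuity must come from bounds whose
    constants do not depend on [j]; and the kernel [nu] is unbounded near [0], so mass could escape
    there when the truncated identity is passed to the limit. Both difficulties are met by the same
    device: fix a level [i], and separate the potential made of jumps in []a j, a i]] alone from the
    part that contains a larger jump. Potentials take values in the extended reals, hence identities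
    are written additively and every cancellation asks for a finite term. *)

HB.lock Definition convol {R : realType} (w g : R -> \bar R) (t : R) : \bar R :=
  (\int[lebesgue_measure]_s (w s * g (t - s)%R))%E.

Section Convolution.
Context {R : realType}.
Local Open Scope ereal_scope.
Local Notation mu := (@lebesgue_measure R).
Implicit Types (w g h : R -> \bar R) (t x : R).

Definition nnm g := measurable_fun [set: R] g /\ forall x, 0 <= g x.

Lemma nnmM w g : nnm w -> nnm g -> nnm (fun x => w x * g x).
Proof.
move=> [mw w0] [mg g0]; split; first exact: emeasurable_funM.
by move=> x; exact: mule_ge0.
Qed.

Lemma nnmD w g : nnm w -> nnm g -> nnm (fun x => w x + g x).
Proof.
move=> [mw w0] [mg g0]; split; first exact: emeasurable_funD.
by move=> x; exact: adde_ge0.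
Qed.

Lemma nnm_cst (c : \bar R) : 0 <= c -> nnm (cst c).
Proof. by move=> c0; split. Qed.

Lemma nnmZ (c : \bar R) g : 0 <= c -> nnm g -> nnm (fun x => c * g x).
Proof. by move=> c0 hg; exact: (nnmM (nnm_cst c0)). Qed.

Lemma nnm_indic (A : set R) : measurable A -> nnm (fun x => (\1_A x)%:E).
Proof.
move=> mA; split; last by move=> x; rewrite lee_fin.
by apply/measurable_EFinP; exact: measurable_indic.
Qed.

Lemma nnm_shift a g : nnm g -> nnm (fun x => g (x - a)%R).
Proof.
move=> [mg g0]; split=> //; apply: (measurableT_comp mg).
exact: measurable_funB.
Qed.

Lemma nnm_refl a g : nnm g -> nnm (fun x => g (a - x)%R).
Proof.
move=> [mg g0]; split=> //; apply: (measurableT_comp mg).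
exact: measurable_funB.
Qed.

Lemma nnm_series (g : (R -> \bar R)^nat) : (forall k, nnm (g k)) ->
  nnm (fun x => \sum_(k <oo) g k x).
Proof.
move=> hg; split; last by move=> x; apply: nneseries_ge0 => k _ _; apply: (hg k).2.
apply: (ge0_emeasurable_sum (P := xpredT)) => [k x _ _|k _].
  exact: (hg k).2.
exact: (hg k).1.
Qed.

Let measurable_convf w g : nnm w -> nnm g ->
  measurable_fun [set: R * R] (fun z : R * R => w z.2 * g (z.1 - z.2)%R).
Proof.
move=> [mw w0] [mg g0]; apply: emeasurable_funM.
  exact: (measurableT_comp mw measurable_snd).
by apply: (measurableT_comp mg); apply: measurable_funB;
  [exact: measurable_fst|exact: measurable_snd].
Qed.

Lemma nnm_convol w g : nnm w -> nnm g -> nnm (convol w g).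
Proof.
rewrite convol.unlock => hw hg; split; last first.
  by move=> t; apply: integral_ge0 => s _; rewrite mule_ge0// ?hw.2 ?hg.2.
apply: (measurable_fun_fubini_tonelli_F (m2 := mu)
  (fun z : R * R => w z.2 * g (z.1 - z.2)%R)).
- exact: measurable_convf.
- by move=> z; rewrite mule_ge0// ?hw.2 ?hg.2.
Qed.

Lemma convol_nnm w g t : nnm w -> nnm g -> nnm (fun s => w s * g (t - s)%R).
Proof. by move=> hw hg; apply: nnmM => //; exact: nnm_refl. Qed.

(** Tonelli and a swap of two subtractions. It stands in for associativity: potentials only need
    that two convolution operators commute. *)
Lemma convolCA w w' g t : nnm w -> nnm w' -> nnm g ->
  convol w (convol w' g) t = convol w' (convol w g) t.
Proof.
move=> hw hw' hg; rewrite !convol.unlock.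
pose F (z : R * R) := w z.1 * (w' z.2 * g (t - z.1 - z.2)%R).
have mF : measurable_fun setT F.
  apply: emeasurable_funM; first exact: (measurableT_comp hw.1 measurable_fst).
  apply: emeasurable_funM; first exact: (measurableT_comp hw'.1 measurable_snd).
  apply: (measurableT_comp hg.1); apply: measurable_funB.
    by apply: measurable_funB => //; exact: measurable_fst.
  exact: measurable_snd.
have F0 z : 0 <= F z by rewrite !mule_ge0// ?hw.2 ?hw'.2 ?hg.2.
transitivity (\int[mu]_x \int[mu]_y F (x, y)).
  apply: eq_integral => x _; rewrite -ge0_integralZl//.
  - by apply (convol_nnm _ hw' hg).
  - by move=> y _; rewrite mule_ge0// ?hw'.2 ?hg.2.
  - exact: hw.2.
rewrite (fubini_tonelli (m1 := mu) (m2 := mu) F)//; apply: eq_integral => y _.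
rewrite -ge0_integralZl//.
- by apply: eq_integral => x _; rewrite /F/= muleCA addrAC.
- by apply (convol_nnm _ hw hg).
- by move=> x _; rewrite mule_ge0// ?hw.2 ?hg.2.
- exact: hw'.2.
Qed.

Lemma convolDr w g h t : nnm w -> nnm g -> nnm h ->
  convol w (fun x => g x + h x) t = convol w g t + convol w h t.
Proof.
move=> hw hg hh; rewrite !convol.unlock -ge0_integralD//.
- by apply: eq_integral => s _; rewrite ge0_muleDr ?hg.2 ?hh.2.
- by move=> s _; rewrite mule_ge0// ?hw.2 ?hg.2.
- by apply (convol_nnm _ hw hg).
- by move=> s _; rewrite mule_ge0// ?hw.2 ?hh.2.
- by apply (convol_nnm _ hw hh).
Qed.

Lemma convolDl w w' g t : nnm w -> nnm w' -> nnm g ->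
  convol (fun x => w x + w' x) g t = convol w g t + convol w' g t.
Proof.
move=> hw hw' hg; rewrite !convol.unlock -ge0_integralD//.
- by apply: eq_integral => s _; rewrite ge0_muleDl ?hw.2 ?hw'.2.
- by move=> s _; rewrite mule_ge0// ?hw.2 ?hg.2.
- by apply (convol_nnm _ hw hg).
- by move=> s _; rewrite mule_ge0// ?hw'.2 ?hg.2.
- by apply (convol_nnm _ hw' hg).
Qed.

Lemma convolZr c w g t : 0 <= c -> nnm w -> nnm g ->
  convol w (fun x => c * g x) t = c * convol w g t.
Proof.
move=> c0 hw hg; rewrite !convol.unlock -ge0_integralZl//.
- by apply: eq_integral => s _; rewrite muleCA.
- by apply (convol_nnm _ hw hg).
- by move=> s _; rewrite mule_ge0// ?hw.2 ?hg.2.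
Qed.

Lemma convol_shift w g a t : convol w (fun x => g (x - a)%R) t = convol w g (t - a).
Proof. by rewrite convol.unlock; apply: eq_integral => s _; rewrite addrAC. Qed.

(* [w] vanishes on the negative axis, so only the past of [g] matters. *)
Lemma le_convol w g h t : nnm w -> (forall s, (s < 0)%R -> w s = 0) ->
  nnm g -> nnm h -> (forall y, (y <= t)%R -> g y <= h y) ->
  convol w g t <= convol w h t.
Proof.
rewrite convol.unlock => hw w_lt0 hg hh gh; apply: ge0_le_integral => //.
- by move=> s _; rewrite mule_ge0// ?hw.2 ?hg.2.
- by apply (convol_nnm _ hw hg).
- by apply (convol_nnm _ hw hh).
move=> s _; have [s0|s0] := ltP s 0%R; first by rewrite w_lt0// !mul0e.
by rewrite lee_wpmul2l ?hw.2// gh// gerBl.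
Qed.

Lemma le_convoll w w' g t : nnm w -> nnm w' -> nnm g ->
  (forall y, w y <= w' y) -> convol w g t <= convol w' g t.
Proof.
rewrite convol.unlock => hw hw' hg ww'; apply: ge0_le_integral => //.
- by move=> s _; rewrite mule_ge0// ?hw.2 ?hg.2.
- by apply (convol_nnm _ hw hg).
- by apply (convol_nnm _ hw' hg).
by move=> s _; rewrite lee_wpmul2r ?hg.2.
Qed.

Lemma convol_series w (g : (R -> \bar R)^nat) t :
  nnm w -> (forall s, w s \is a fin_num) -> (forall k, nnm (g k)) ->
  convol w (fun x => \sum_(k <oo) g k x) t = \sum_(k <oo) convol w (g k) t.
Proof.
move=> hw fw hg; rewrite !convol.unlock -integral_nneseries//.
- apply: eq_integral => s _; rewrite -(fineK (fw s)) nneseriesZl//.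
  by move=> k _; exact: (hg k).2.
- by move=> k; apply (convol_nnm _ hw (hg k)).
- by move=> k x _; rewrite mule_ge0// ?hw.2 ?(hg k).2.
Qed.

(** The reflection turns a half-open interval into one of the other kind with the same length, so
    the pushforward of Lebesgue measure is Lebesgue measure by uniqueness. *)
Lemma integral_refl t g : nnm g -> \int[mu]_s g (t - s)%R = \int[mu]_s g s.
Proof.
move=> [mg g0].
have mphi : measurable_fun [set: measurableTypeR R]
    (fun s : measurableTypeR R => (t - s)%R : measurableTypeR R).
  exact: measurable_funB.
pose phi : {mfun measurableTypeR R >-> measurableTypeR R} :=
  HB.pack (fun s : R => (t - s)%R : measurableTypeR R)
    (isMeasurableFun.Build _ _ _ _ _ mphi).
transitivity (\int[pushforward mu phi]_y g y).
  by rewrite (ge0_integral_pushforward mphi)// preimage_setT.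
apply: eq_measure_integral => //= A mA _; apply/esym.
apply: (lebesgue_measure_unique (mu := pushforward mu phi)) => //= _ [[a b]] _ <-.
rewrite /pushforward/= [X in _ = mu X](_ : _ = `[(t - b)%R, (t - a)%R[%classic).
  rewrite !lebesgue_measure_itv/= !lte_fin ltrD2l ltrN2; case: ifP => // _.
  by rewrite -!EFinB; congr EFin; ring.
by apply/seteqP; split=> s /=; rewrite !in_itv/= => /andP[? ?]; apply/andP; split; lra.
Qed.

Lemma convolC w g t : nnm w -> nnm g -> convol w g t = convol g w t.
Proof.
move=> hw hg; rewrite !convol.unlock -(integral_refl t)//; last exact: convol_nnm.
by apply: eq_integral => s _; rewrite subKr muleC.
Qed.

End Convolution.

(* The resolvent [(q - (w * _))^-1 g] as a Neumann series. *)
HB.lock Definition pot {R : realType} (w : R -> \bar R) (q : R) (g : R -> \bar R)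
    (t : R) : \bar R :=
  (\sum_(k <oo) ((q^-1 ^+ k.+1)%:E * iter k (convol w) g t))%E.

Section Potential.
Context {R : realType}.
Local Open Scope ereal_scope.
Local Notation mu := (@lebesgue_measure R).
Implicit Types (w v g h : R -> \bar R) (t x : R).

(** Finite values let the factor [w s] move through a series. Vanishing on the negative axis makes
    convolution causal, which [le_convol] exploits. *)
Definition weight w := [/\ nnm w, forall s, w s \is a fin_num &
  forall s, (s < 0)%R -> w s = 0].

Lemma nnm_iter w g k : weight w -> nnm g -> nnm (iter k (convol w) g).
Proof. by move=> [hw _ _] hg; elim: k => //= k ih; exact: nnm_convol. Qed.

Lemma nnm_pot_term w q g k : (0 < q)%R -> weight w -> nnm g ->
  nnm (fun t => (q^-1 ^+ k.+1)%:E * iter k (convol w) g t).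
Proof.
move=> q0 hw hg; apply: nnmZ; last exact: nnm_iter.
by rewrite lee_fin exprn_ge0// invr_ge0 ltW.
Qed.

Lemma nnm_pot w q g : (0 < q)%R -> weight w -> nnm g -> nnm (pot w q g).
Proof.
by rewrite pot.unlock => q0 hw hg; apply: nnm_series => k; exact: nnm_pot_term.
Qed.

(** The resolvent equation [(q - (w * _)) U = g], obtained by splitting off the term of index 0; [U]
    may be infinite, whence the form without subtraction. *)
Lemma potE w q g t : (0 < q)%R -> weight w -> nnm g ->
  q%:E * pot w q g t = g t + convol w (pot w q g) t.
Proof.
move=> q0 hw hg; have [nw fw _] := hw.
have c0 k : 0 <= (q^-1 ^+ k.+1)%:E by rewrite lee_fin exprn_ge0// invr_ge0 ltW.
have term0 k : 0 <= (q^-1 ^+ k.+1)%:E * iter k (convol w) g t.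
  by rewrite mule_ge0//; apply (nnm_iter k hw hg).2.
rewrite pot.unlock.
have qterm0 k : 0 <= q%:E * ((q^-1 ^+ k.+1)%:E * iter k (convol w) g t).
  by rewrite mule_ge0// lee_fin ltW.
rewrite convol_series//; last by move=> k; exact: nnm_pot_term.
rewrite -nneseriesZl; last by move=> *; exact: term0.
rewrite [LHS]nneseries_recl//.
congr (_ + _).
  by rewrite /= expr1 muleA -EFinM divff ?gt_eqF// mul1e.
rewrite -(nneseries_addn 1); last by move=> *; exact: qterm0.
apply: eq_eseriesr => k _; rewrite addn1 /= convolZr//; last exact: nnm_iter.
by rewrite muleA -EFinM exprS mulrA divff ?gt_eqF// mul1r.
Qed.

Lemma iter_convolCA w v g k t : weight w -> nnm v -> nnm g ->
  convol v (iter k (convol w) g) t = iter k (convol w) (convol v g) t.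
Proof.
move=> hw hv hg; elim: k t => //= k ih t.
rewrite convolCA//; [|by case: hw|exact: nnm_iter].
by congr (convol w _ t); apply/funext => y; exact: ih.
Qed.

Lemma convol_pot w v q g t : (0 < q)%R -> weight w -> nnm v ->
  (forall s, v s \is a fin_num) -> nnm g ->
  convol v (pot w q g) t = pot w q (convol v g) t.
Proof.
rewrite pot.unlock => q0 hw hv fv hg; rewrite convol_series//; last first.
  by move=> k; exact: nnm_pot_term.
apply: eq_eseriesr => k _; rewrite convolZr//; last 2 first.
- by rewrite lee_fin exprn_ge0// invr_ge0 ltW.
- exact: nnm_iter.
by rewrite iter_convolCA.
Qed.

Lemma iter_convolD w g h k t : weight w -> nnm g -> nnm h ->
  iter k (convol w) (fun y => g y + h y) t =
  iter k (convol w) g t + iter k (convol w) h t.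
Proof.
move=> hw hg hh; elim: k t => //= k ih t.
rewrite -convolDr//; [|by case: hw|exact: nnm_iter|exact: nnm_iter].
by congr (convol w _ t); apply/funext => y; exact: ih.
Qed.

Lemma potD w q g h t : (0 < q)%R -> weight w -> nnm g -> nnm h ->
  pot w q (fun y => g y + h y) t = pot w q g t + pot w q h t.
Proof.
move=> q0 hw hg hh; rewrite pot.unlock -nneseriesD; last 2 first.
- by move=> k _ _; apply (nnm_pot_term k q0 hw hg).2.
- by move=> k _ _; apply (nnm_pot_term k q0 hw hh).2.
apply: eq_eseriesr => k _; rewrite iter_convolD// ge0_muleDr//.
- by apply (nnm_iter k hw hg).2.
- by apply (nnm_iter k hw hh).2.
Qed.

Lemma iter_convolZ w c g k t : 0 <= c -> weight w -> nnm g ->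
  iter k (convol w) (fun y => c * g y) t = c * iter k (convol w) g t.
Proof.
move=> c0 hw hg; elim: k t => //= k ih t.
rewrite -convolZr//; [|by case: hw|exact: nnm_iter].
by congr (convol w _ t); apply/funext => y; exact: ih.
Qed.

Lemma potZ w q (c : R) g t : (0 < q)%R -> (0 <= c)%R -> weight w -> nnm g ->
  pot w q (fun y => c%:E * g y) t = c%:E * pot w q g t.
Proof.
move=> q0 c0 hw hg; rewrite pot.unlock -nneseriesZl; last first.
  by move=> k _; apply (nnm_pot_term k q0 hw hg).2.
by apply: eq_eseriesr => k _; rewrite iter_convolZ// muleCA.
Qed.

Lemma iter_convol_shift w g a k t : iter k (convol w) (fun y => g (y - a)%R) t =
  iter k (convol w) g (t - a)%R.
Proof.
elim: k t => //= k ih t; rewrite -convol_shift.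
by congr (convol w _ t); apply/funext => y; exact: ih.
Qed.

Lemma pot_shift w q g a t : pot w q (fun y => g (y - a)%R) t = pot w q g (t - a)%R.
Proof. by rewrite pot.unlock; apply: eq_eseriesr => k _; rewrite iter_convol_shift. Qed.

Lemma le_iter_convol w g h k t : weight w -> nnm g -> nnm h ->
  (forall y, (y <= t)%R -> g y <= h y) ->
  forall y, (y <= t)%R -> iter k (convol w) g y <= iter k (convol w) h y.
Proof.
move=> hw hg hh gh; elim: k => //= k ih y yt.
have [nw _ w0] := hw.
apply: le_convol => //; [exact: nnm_iter|exact: nnm_iter|].
by move=> z zy; apply: ih; exact: le_trans zy yt.
Qed.

Lemma le_pot w q g h t : (0 < q)%R -> weight w -> nnm g -> nnm h ->
  (forall y, (y <= t)%R -> g y <= h y) -> pot w q g t <= pot w q h t.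
Proof.
rewrite pot.unlock => q0 hw hg hh gh; apply: lee_nneseries => k _.
  by move=> _; apply (nnm_pot_term k q0 hw hg).2.
apply: lee_wpmul2l; first by rewrite lee_fin exprn_ge0// invr_ge0 ltW.
exact: (le_iter_convol k hw hg hh gh (lexx t)).
Qed.

Definition expf (x : R) : R -> \bar R := fun t => (expR (x * t))%:E.

Lemma nnm_expf x : nnm (expf x).
Proof.
split; last by move=> t; rewrite lee_fin expR_ge0.
rewrite (_ : expf x = EFin \o (expR \o ( *%R x)))//; apply/measurable_EFinP.
by apply: measurableT_comp => //; exact: mulrl_measurable.
Qed.

Lemma convol_expf w x t : weight w ->
  convol w (expf x) t = (\int[mu]_s (w s * expf (- x) s)) * expf x t.
Proof.
rewrite convol.unlock => -[[mw w0] fw _]; rewrite -ge0_integralZr//.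
- apply: eq_integral => s _; rewrite -muleA; congr (_ * _).
  by rewrite -EFinM -expRD; congr (expR _)%:E; ring.
- by apply: emeasurable_funM => //; apply (nnm_expf _).1.
- by move=> s _; rewrite mule_ge0// lee_fin expR_ge0.
- by rewrite lee_fin expR_ge0.
Qed.

(** Exponentials are eigenfunctions of convolution by [w] with eigenvalue [a], so the Neumann series
    is geometric with ratio [a / q]. *)
Lemma pot_expf w q x (a : R) t : weight w ->
  \int[mu]_s (w s * expf (- x) s) = a%:E -> (0 <= a)%R -> (a < q)%R ->
  pot w q (expf x) t = ((q - a)^-1 * expR (x * t))%:E.
Proof.
move=> hw wa a0 aq; have q0 : (0 < q)%R by exact: le_lt_trans aq.
have it k y : iter k (convol w) (expf x) y = (a ^+ k)%:E * expf x y.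
  elim: k y => [|k ih] y; first by rewrite /= mul1e.
  rewrite iterS (_ : iter k _ _ = fun z => (a ^+ k)%:E * expf x z); last first.
    exact/funext.
  rewrite convolZr//; [|by rewrite lee_fin exprn_ge0|by case: hw|exact: nnm_expf].
  by rewrite convol_expf// wa muleA -EFinM exprSr.
have aq1 : (`|a / q| < 1)%R.
  by rewrite ger0_norm ?divr_ge0 ?(ltW q0)// ltr_pdivrMr// mul1r.
rewrite pot.unlock (_ : (fun _ => _) = EFin \o
    series (geometric (q^-1 * expR (x * t)) (a / q))); last first.
  apply/funext => n; rewrite /series/= -sumEFin; apply: eq_bigr => k _.
  rewrite it /expf -!EFinM; congr EFin.
  rewrite exprSr /geometric/= exprMn; ring.
apply/cvg_lim => //; apply: cvg_EFin; first exact: nearW.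
have -> : ((q - a)^-1 * expR (x * t) =
    (q^-1 * expR (x * t)) * (1 - a / q)^-1)%R.
  by field; rewrite ?subr_eq0 ?gt_eqF.
exact: cvg_geometric_series.
Qed.

End Potential.

(** * Resolvent identities and comparison of potentials *)

Section PotentialIdentities.
Context {R : realType}.
Local Open Scope ereal_scope.
Local Notation mu := (@lebesgue_measure R).
Implicit Types (w g h : R -> \bar R) (t x q : R).

Lemma weightD w1 w0 : weight w1 -> weight w0 -> weight (fun s => w1 s + w0 s).
Proof.
move=> [nw1 fw1 w1z] [nw0 fw0 w0z]; split; first exact: nnmD.
  by move=> s; rewrite fin_numD fw1 fw0.
by move=> s s0; rewrite w1z// w0z// adde0.
Qed.

Lemma pot_ge0 w q g t : (0 < q)%R -> weight w -> nnm g -> 0 <= pot w q g t.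
Proof. by move=> q0 hw hg; apply (nnm_pot q0 hw hg).2. Qed.

Lemma le_convol_expf w x (a C : R) g t : weight w -> nnm g -> (0 <= C)%R ->
  \int[mu]_s (w s * expf (- x) s) = a%:E ->
  (forall y, g y <= (C * expR (x * y))%:E) ->
  convol w g t <= (a * C * expR (x * t))%:E.
Proof.
move=> hw hg C0 wa gC; have [nw _ wz] := hw.
rewrite (@le_trans _ _ (convol w (fun y => C%:E * expf x y) t))//.
  by apply: le_convol => //; apply: nnmZ => //; exact: nnm_expf.
rewrite convolZr//; last exact: nnm_expf.
by rewrite convol_expf// wa -!EFinM mulrA (mulrC C).
Qed.

(** The barrier principle behind all later bounds. By causality [g] needs to lie below the
    exponential only up to time [t]. *)
Lemma le_pot_expf w q x (a C : R) g t : weight w -> nnm g -> (0 <= C)%R ->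
  \int[mu]_s (w s * expf (- x) s) = a%:E -> (0 <= a)%R -> (a < q)%R ->
  (forall y, (y <= t)%R -> g y <= (C * expR (x * y))%:E) ->
  pot w q g t <= (C / (q - a) * expR (x * t))%:E.
Proof.
move=> hw hg C0 wa a0 aq gC; have q0 : (0 < q)%R by exact: le_lt_trans aq.
rewrite (@le_trans _ _ (pot w q (fun y => C%:E * expf x y) t))//.
  by apply: le_pot => //; apply: nnmZ => //; exact: nnm_expf.
rewrite potZ//; last exact: nnm_expf.
by rewrite (pot_expf t hw wa)// -EFinM mulrA.
Qed.

(** Second resolvent identity. With [U] the potential of the full weight, [q * pot w1 q U] is
    computed twice: by the resolvent equation for [w1], and by applying [pot w1 q] to the resolvent
    equation for [U]. The common term [convol w1 (pot w1 q U)] is then cancelled, which is why it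
    must be finite. *)
Lemma pot_split w1 w0 q g t : (0 < q)%R -> weight w1 -> weight w0 -> nnm g ->
  convol w1 (pot w1 q (pot (fun s => w1 s + w0 s) q g)) t \is a fin_num ->
  pot (fun s => w1 s + w0 s) q g t =
  pot w1 q g t + convol w0 (pot w1 q (pot (fun s => w1 s + w0 s) q g)) t.
Proof.
move=> q0 hw1 hw0 hg; set w := fun s => w1 s + w0 s; set U := pot w q g.
have hw : weight w by exact: weightD.
have hU : nnm U by exact: nnm_pot.
have [nw1 fw1 _] := hw1; have [nw0 fw0 _] := hw0.
move=> fA.
have h1 := @potE R w1 q U t q0 hw1 hU.
have : q%:E * pot w1 q U t =
    pot w1 q g t + (convol w1 (pot w1 q U) t + convol w0 (pot w1 q U) t).
  rewrite -potZ// ?(ltW q0)//.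
  rewrite (_ : (fun y => q%:E * U y) = fun y => g y + (convol w1 U y + convol w0 U y)).
    rewrite potD//; last by apply: nnmD; exact: nnm_convol.
    rewrite potD//; [|exact: nnm_convol|exact: nnm_convol].
    by rewrite !convol_pot.
  by apply/funext => y; rewrite [LHS](potE y q0 hw hg) convolDl.
rewrite h1 => h2.
rewrite -[LHS](addeK _ fA) h2 [convol w1 _ t + _]addeC addeA.
exact: addeK.
Qed.

(** Adding the jumps [w1] while raising the rate by [c] cannot increase the potential if [w1] acts
    on [g] by at most [c]. The argument is that of [pot_split], with
    [pot w q (convol w1 U') <= c * pot w q U'] in place of an equality. *)
Lemma le_pot_weight w w1 q (c : R) g t : (0 < q)%R -> (0 <= c)%R ->
  weight w -> weight w1 -> nnm g ->
  (forall y, convol w1 g y <= c%:E * g y) ->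
  convol w (pot w q (pot (fun s => w s + w1 s) (q + c) g)) t \is a fin_num ->
  pot w q (pot (fun s => w s + w1 s) (q + c) g) t \is a fin_num ->
  pot (fun s => w s + w1 s) (q + c) g t <= pot w q g t.
Proof.
move=> q0 c0 hw hw1 hg w1g; set w' := fun s => w s + w1 s.
set U' := pot w' (q + c) g => fA fB.
have qc0 : (0 < q + c)%R by exact: ltr_wpDr.
have hw' : weight w' by exact: weightD.
have hU' : nnm U' by exact: nnm_pot.
have [nw fw _] := hw; have [nw1 fw1 _] := hw1.
have h1 := @potE R w q U' t q0 hw hU'.
have h2 : q%:E * pot w q U' t + c%:E * pot w q U' t =
    pot w q g t + (convol w (pot w q U') t + pot w q (convol w1 U') t).
  rewrite -ge0_muleDl ?lee_fin ?(ltW q0)// -EFinD -potZ// ?(ltW qc0)//.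
  rewrite (_ : (fun y => (q + c)%:E * U' y) =
      fun y => g y + (convol w U' y + convol w1 U' y)).
    rewrite potD//; last by apply: nnmD; exact: nnm_convol.
    rewrite potD//; [|exact: nnm_convol|exact: nnm_convol].
    by rewrite convol_pot.
  by apply/funext => y; rewrite [LHS](potE y qc0 hw' hg) convolDl.
have h3 : pot w q (convol w1 U') t <= c%:E * pot w q U' t.
  rewrite -potZ//; apply: le_pot => //; [exact: nnm_convol|exact: nnmZ|].
  move=> y _; rewrite convol_pot// -potZ//.
  by apply: le_pot => //; [exact: nnm_convol|exact: nnmZ].
have fAC : convol w (pot w q U') t + c%:E * pot w q U' t \is a fin_num.
  by rewrite fin_numD fA fin_numM.
rewrite -(leeD2rE _ _ fAC) addeA -[X in X + _ <= _]h1 h2.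
by do 2 apply: leeD2l.
Qed.

(** Reads [pot k = g - (q - c) * pot g] once subtraction is allowed. For [g = chi], [k] the
    truncated tail and [q - c = eta] it becomes the equation for the truncated process. *)
Lemma pot_tail w q (c : R) k g t : (0 < q)%R -> (0 <= c)%R -> weight w ->
  nnm g -> nnm k -> (forall y, k y + convol w g y = c%:E * g y) ->
  pot w q k t + q%:E * pot w q g t = g t + c%:E * pot w q g t.
Proof.
move=> q0 c0 hw hg hk kE; have [nw fw _] := hw.
rewrite potE// convol_pot// -potZ// addeCA; congr (_ + _).
rewrite -potD//; last exact: nnm_convol.
by congr pot; apply/funext.
Qed.

(** The variant of [pot_tail] in which only the part [w1] of the jumps enters the potential; the
    effect of [w0] is expressed through its own tail [k0]. *)
Lemma pot_tail_split w1 w0 q (c c0 : R) k k0 g t : (0 < q)%R ->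
  (0 <= c)%R -> (0 <= c0)%R -> weight w1 -> weight w0 ->
  nnm g -> nnm k -> nnm k0 ->
  (forall y, k y + convol (fun s => w1 s + w0 s) g y = c%:E * g y) ->
  (forall y, k0 y + convol w0 g y = c0%:E * g y) ->
  pot w1 q k t + q%:E * pot w1 q g t + c0%:E * pot w1 q g t =
  g t + c%:E * pot w1 q g t + pot w1 q k0 t.
Proof.
move=> q0 c_ge0 c0_ge0 hw1 hw0 hg hk hk0 kE k0E.
have [nw1 fw1 _] := hw1; have [nw0 fw0 _] := hw0.
rewrite potE// convol_pot// -!potZ//.
rewrite (_ : (fun y => c0%:E * g y) = fun y => k0 y + convol w0 g y); last first.
  by apply/funext => y; rewrite k0E.
rewrite (_ : (fun y => c%:E * g y) =
    fun y => k y + (convol w1 g y + convol w0 g y)); last first.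
  by apply/funext => y; rewrite -kE convolDl.
have n1 := nnm_convol nw1 hg; have n0 := nnm_convol nw0 hg.
rewrite !potD//; last exact: nnmD.
rewrite -!addeA addeCA; congr (_ + (_ + (_ + _))).
by rewrite addeC.
Qed.

End PotentialIdentities.

(** * Densities of Levy measures and their truncations *)

Section LevyDensity.
Context {R : realType}.
Local Open Scope ereal_scope.
Local Notation mu := (@lebesgue_measure R).
Implicit Types (g h : R -> \bar R) (t x q s : R) (A B : set R).

Definition chi : R -> \bar R := fun t => (\1_(`[0%R, +oo[%classic : set R) t)%:E.

Lemma chiE t : chi t = ((0 <= t)%R%:R)%:E.
Proof. by rewrite /chi indicE mem_setE in_itv/= andbT. Qed.

Lemma nnm_chi : nnm chi.
Proof. exact: nnm_indic. Qed.

Lemma chi_le_expf x t : (0 <= x)%R -> chi t <= (1 * expR (x * t))%:E.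
Proof.
move=> x0; rewrite chiE lee_fin mul1r; have [t0|_] := leP 0%R t.
  by rewrite -expR0 ler_expR mulr_ge0.
exact: expR_ge0.
Qed.

Definition restr_density (n : R -> R) A : R -> \bar R := fun s => (n s * \1_A s)%:E.

Definition density_tail (n : R -> R) t : \bar R :=
  \int[mu]_s restr_density n `]t, +oo[%classic s.

(** As [n] vanishes off the positive axis, all integrals can run over the whole line. *)
Definition levy_density (n : R -> R) := [/\ measurable_fun setT n,
  forall s, (0 <= n s)%R, forall s, (s <= 0)%R -> n s = 0%R &
  \int[mu]_s (n s * Num.min s 1)%:E < +oo].

Section Basics.
Variable n : R -> R.
Hypothesis hn : levy_density n.
Local Notation W := (restr_density n).
Local Notation Tn := (density_tail n).

Lemma nnm_restr_density A : measurable A -> nnm (W A).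
Proof.
move=> mA; have [mn n0 _ _] := hn; split.
  by apply/measurable_EFinP; apply: measurable_funM => //; exact: measurable_indic.
by move=> s; rewrite lee_fin mulr_ge0.
Qed.

Lemma weight_restr_density A : measurable A -> weight (W A).
Proof.
move=> mA; split; [exact: nnm_restr_density|by []|].
have [_ _ nz _] := hn.
by move=> s s0; rewrite /restr_density nz ?mul0r// ltW.
Qed.

Lemma restr_density_split a b : (a <= b)%R ->
  W `]a, +oo[%classic = fun s => W `]a, b]%classic s + W `]b, +oo[%classic s.
Proof.
move=> ab; apply/funext => s; rewrite /restr_density -EFinD -mulrDr.
congr (_ * _)%:E; rewrite !indicE !mem_setE !in_itv/= !andbT.
case: (ltP a s) => as_; case: (ltP b s) => bs_ //=; rewrite ?add0r ?addr0//.
by move: (lt_le_trans bs_ as_); rewrite ltNge ab.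
Qed.

Lemma density_tail_ge0 t : 0 <= Tn t.
Proof.
apply: integral_ge0 => s _; have [_ n0 _ _] := hn.
by rewrite lee_fin mulr_ge0.
Qed.

Lemma min_ge0 s : (0 <= n s * Num.min s 1)%R.
Proof.
have [_ n0 nz _] := hn; have [s0|s0] := leP s 0%R; first by rewrite nz// mul0r.
by rewrite mulr_ge0// le_min ler01 ltW.
Qed.

Lemma measurable_nmin : measurable_fun setT (fun s => (n s * Num.min s 1)%:E).
Proof.
have [mn _ _ _] := hn; apply/measurable_EFinP; apply: measurable_funM => //.
exact: measurable_minr.
Qed.

(** Chebyshev: on []t, +oo[] the integrable weight [min s 1] is at least [min t 1 > 0]. *)
Lemma density_tail_fin t : (0 < t)%R -> Tn t \is a fin_num.
Proof.
move=> t0; have [mn n0 nz nl] := hn.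
rewrite ge0_fin_numE ?density_tail_ge0//.
have m0 : (0 < Num.min t 1)%R by rewrite lt_min t0 ltr01.
apply: (@le_lt_trans _ _ ((Num.min t 1)^-1%:E * \int[mu]_s (n s * Num.min s 1)%:E)).
  rewrite -ge0_integralZl//; last 3 first.
  - exact: measurable_nmin.
  - by move=> s _; rewrite lee_fin min_ge0.
  - by rewrite lee_fin invr_ge0 ltW.
  apply: ge0_le_integral => //.
  - by move=> s _; rewrite lee_fin mulr_ge0.
  - by apply (nnm_restr_density (measurable_itv _)).1.
  - by apply: measurable_funeM; exact: measurable_nmin.
  move=> s _; rewrite -EFinM lee_fin indicE mem_setE in_itv/= andbT.
  case: ltP => ts; last by rewrite mulr0 mulr_ge0 ?min_ge0// invr_ge0 ltW.
  rewrite mulr1 mulrCA ler_peMr// mulrC ler_pdivlMr// mul1r.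
  by rewrite le_min !ge_min lexx (ltW ts) /= orbT.
by rewrite lte_mul_pinfty// lee_fin invr_ge0 ltW.
Qed.

Lemma density_tail_split a b : (a <= b)%R ->
  Tn a = \int[mu]_s W `]a, b]%classic s + Tn b.
Proof.
move=> ab; rewrite /density_tail (restr_density_split ab) ge0_integralD//.
- by move=> s _; apply (nnm_restr_density (measurable_itv _)).2.
- by apply (nnm_restr_density (measurable_itv _)).1.
- by move=> s _; apply (nnm_restr_density (measurable_itv _)).2.
- by apply (nnm_restr_density (measurable_itv _)).1.
Qed.

Lemma density_tail_ni a b : (a <= b)%R -> Tn b <= Tn a.
Proof.
move=> ab; rewrite (density_tail_split ab) leeDr//.
by apply: integral_ge0 => s _; apply (nnm_restr_density (measurable_itv _)).2.
Qed.

Lemma nnm_density_tail : nnm Tn.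
Proof.
split; last exact: density_tail_ge0.
have [mn n0 _ _] := hn.
pose F (z : R * R) : \bar R := (n z.2 * (z.1 < z.2)%R%:R)%:E.
rewrite (_ : Tn = fun t => \int[mu]_s F (t, s)).
  apply: (measurable_fun_fubini_tonelli_F (m2 := mu)).
    apply/measurable_EFinP; apply: measurable_funM.
      exact: (measurableT_comp mn measurable_snd).
    rewrite (_ : (fun _ => _) = (fun b : bool => b%:R : R) \o
      (fun z : R * R => (z.1 < z.2)%R))//.
    apply: measurableT_comp => //.
    by apply: measurable_fun_ltr; [exact: measurable_fst|exact: measurable_snd].
  by move=> z; rewrite lee_fin mulr_ge0.
apply/funext => t; apply: eq_integral => s _.
by rewrite /F /restr_density indicE mem_setE in_itv/= andbT.
Qed.

Lemma convol_tail_chi a t : (0 <= a)%R ->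
  convol (W `]a, +oo[%classic) chi t =
  \int[mu]_s W `]a, t]%classic s.
Proof.
move=> a0; rewrite convol.unlock; apply: eq_integral => s _.
rewrite chiE subr_ge0 /restr_density -EFinM -mulrA; congr (_ * _)%:E.
rewrite !indicE !mem_setE !in_itv/= andbT -natrM mulnb.
by [].
Qed.

(* The part of the tail seen by the compound Poisson truncation at [a]. *)
Definition trunc_tail a : R -> \bar R := fun t => chi t * Tn (Num.max t a).

(** From time [a] on, truncating at a level below [a] does not change the tail. So the tail
    truncated at [a j] splits at [a l] into a far part that does not involve [j] and a near part
    carried by [[0, a l[]; the near part is the one to be shown negligible. *)
Definition far_tail a : R -> \bar R := fun t => chi (t - a)%R * Tn t.

Definition near_tail a b : R -> \bar R :=
  fun t => (\1_(`[0%R, b[%classic : set R) t)%:E * Tn (Num.max t a).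

Lemma nnm_tail_max a : nnm (fun t => Tn (Num.max t a)).
Proof.
split; last by move=> ?; exact: density_tail_ge0.
apply: (measurableT_comp (nnm_density_tail).1).
exact: measurable_maxr.
Qed.

Lemma nnm_trunc_tail a : nnm (trunc_tail a).
Proof. by apply: nnmM; [exact: nnm_chi|exact: nnm_tail_max]. Qed.

Lemma nnm_far_tail a : nnm (far_tail a).
Proof. by apply: nnmM; [exact: nnm_shift nnm_chi|exact: nnm_density_tail]. Qed.

Lemma nnm_near_tail a b : nnm (near_tail a b).
Proof. by apply: nnmM; [exact: nnm_indic|exact: nnm_tail_max]. Qed.

Lemma trunc_tail_split a b t : (a <= b)%R -> (0 < b)%R ->
  trunc_tail a t = near_tail a b t + far_tail b t.
Proof.
move=> ab b0; rewrite /trunc_tail /near_tail /far_tail !chiE subr_ge0.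
rewrite indicE mem_setE in_itv/=.
have [bt|tb] := leP b t.
  by rewrite andbF mul0e add0e max_l ?(le_trans ab)// (le_trans (ltW b0) bt).
by rewrite andbT mul0e adde0.
Qed.

(** Total mass of the jumps longer than [a], separated into those longer than [t] and those, counted
    by the convolution with [chi], of length at most [t]. *)
Lemma trunc_tailE a t : (0 < a)%R ->
  trunc_tail a t + convol (W `]a, +oo[%classic) chi t = (fine (Tn a))%:E * chi t.
Proof.
move=> a0; rewrite convol_tail_chi ?ltW// /trunc_tail chiE.
have empty : (t <= a)%R -> \int[mu]_s W `]a, t]%classic s = 0.
  move=> ta; apply: integral0_eq => s _; rewrite /restr_density indicE mem_setE.
  rewrite in_itv/= (_ : (_ && _) = false) ?mulr0//.
  by apply/negbTE/negP => /andP[as_ st]; move: (lt_le_trans as_ st); rewrite ltNge ta.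
have [t0|t0] := leP 0%R t; last first.
  by rewrite mul0e mule0 empty ?addr0 ?adde0// (le_trans (ltW t0))// ltW.
rewrite mul1e mule1 fineK ?density_tail_fin//.
have [ta|at_] := leP t a; first by rewrite empty// adde0.
by rewrite addeC -density_tail_split// ltW.
Qed.

Lemma far_tailE a t : (0 < a)%R ->
  far_tail a t + convol (W `]a, +oo[%classic) chi t =
  (fine (Tn a))%:E * chi (t - a)%R.
Proof.
move=> a0; rewrite convol_tail_chi ?ltW// /far_tail chiE subr_ge0.
have [ta|at_] := leP a t.
  by rewrite mul1e mule1 fineK ?density_tail_fin// addeC -density_tail_split.
rewrite mul0e mule0 add0e; apply: integral0_eq => s _.
rewrite /restr_density indicE mem_setE.
rewrite in_itv/= (_ : (_ && _) = false) ?mulr0//.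
by apply/negbTE/negP => /andP[as_ st]; move: (lt_le_trans as_ st); rewrite ltNge ltW.
Qed.

End Basics.
End LevyDensity.

(** * Laplace exponents of truncated Levy densities *)

Section Truncations.
Context {R : realType}.
Local Open Scope ereal_scope.
Local Notation mu := (@lebesgue_measure R).
Implicit Types (g h : R -> \bar R) (t x s : R) (A B : set R).

Definition density_exponent (n : R -> R) (x : R) : R :=
  fine (\int[mu]_s (n s * (1 - expR (- (x * s))))%:E).

Definition laplace_restr (n : R -> R) A (x : R) : R :=
  fine (\int[mu]_s (restr_density n A s * expf (- x) s)).

Lemma one_sub_expRN_le (u : R) : (0 <= u)%R -> (1 - expR (- u) <= Num.min u 1)%R.
Proof.
move=> u0; rewrite le_min; apply/andP; split.
  by have := expR_ge1Dx (- u); lra.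
by have := expR_ge0 (- u); lra.
Qed.

Lemma one_sub_expRN_ge0 (u : R) : (0 <= u)%R -> (0 <= 1 - expR (- u))%R.
Proof. by move=> u0; rewrite subr_ge0 -expR0 ler_expR oppr_le0. Qed.

Lemma measurable_1sub x : measurable_fun setT (fun s : R => (1 - expR (- (x * s)))%R).
Proof.
apply: measurable_funB => //; apply: measurableT_comp => //.
by apply: measurableT_comp => //; exact: mulrl_measurable.
Qed.

Section Exponent.
Variable n : R -> R.
Hypothesis hn : levy_density n.
Local Notation W := (restr_density n).
Local Notation Tn := (density_tail n).

Let n_exp_ge0 x s : (0 <= x)%R -> (0 <= n s * (1 - expR (- (x * s))))%R.
Proof.
have [_ n0 nz _] := hn; move=> x0; have [s0|s0] := leP s 0%R.
  by rewrite nz// mul0r.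
by rewrite mulr_ge0// one_sub_expRN_ge0// mulr_ge0// ltW.
Qed.

Let nnm_n_exp x : (0 <= x)%R ->
  nnm (fun s => (n s * (1 - expR (- (x * s))))%:E).
Proof.
move=> x0; split; last by move=> s; rewrite lee_fin n_exp_ge0.
have [mn _ _ _] := hn; apply/measurable_EFinP.
exact: (measurable_funM mn (measurable_1sub x)).
Qed.

Lemma density_exponentE x : (0 <= x)%R ->
  \int[mu]_s (n s * (1 - expR (- (x * s))))%:E = (density_exponent n x)%:E.
Proof.
move=> x0; rewrite /density_exponent fineK//.
have [mn n0 nz nl] := hn.
have I0 : 0 <= \int[mu]_s (n s * (1 - expR (- (x * s))))%:E.
  by apply: integral_ge0 => s _; rewrite lee_fin n_exp_ge0.
rewrite ge0_fin_numE//.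
have m0 : (0 <= Num.max x 1)%R by rewrite le_max ler01 orbT.
(* [1 - exp (- x s) <= min (x s) 1 <= max x 1 * min s 1] for positive [s]. *)
apply: (@le_lt_trans _ _ ((Num.max x 1)%:E * \int[mu]_s (n s * Num.min s 1)%:E)).
  rewrite -ge0_integralZl//; last 2 first.
  - exact: (measurable_nmin hn).
  - by move=> s _; rewrite lee_fin (min_ge0 hn).
  apply: ge0_le_integral => //.
  - by move=> s _; rewrite lee_fin n_exp_ge0.
  - by apply (nnm_n_exp x0).1.
  - by apply: measurable_funeM; exact: (measurable_nmin hn).
  move=> s _; rewrite -EFinM lee_fin mulrCA.
  have [s0|s0] := leP s 0%R; first by rewrite nz// !mul0r.
  rewrite ler_wpM2l// (le_trans (one_sub_expRN_le _)) ?mulr_ge0 ?(ltW s0)//.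
  have [s1|s1] := leP s 1%R.
    by rewrite ge_min ler_wpM2r ?(ltW s0)// le_max lexx ?orbT.
  by rewrite mulr1 ge_min [(1 <= _)%R]le_max lexx !orbT.
by rewrite lte_mul_pinfty// lee_fin.
Qed.

Section OnSet.
Variable A : set R.
Hypotheses (mA : measurable A) (finA : \int[mu]_s W A s \is a fin_num).

Lemma laplace_restrE x : (0 <= x)%R ->
  \int[mu]_s (W A s * expf (- x) s) = (laplace_restr n A x)%:E.
Proof.
move=> x0; rewrite /laplace_restr fineK//.
have nW := nnm_restr_density hn mA.
have nWe : nnm (fun s => W A s * expf (- x) s) by apply: nnmM => //; exact: nnm_expf.
have I0 : 0 <= \int[mu]_s (W A s * expf (- x) s).
  by apply: integral_ge0 => s _; exact: nWe.2.
rewrite ge0_fin_numE// (@le_lt_trans _ _ (\int[mu]_s W A s))//; last first.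
  by rewrite ltey_eq finA.
apply: ge0_le_integral => //; [by move=> s _; exact: nWe.2|exact: nWe.1|exact: nW.1|].
move=> s _; have [_ n0 nz _] := hn; have [s0|s0] := leP s 0%R.
  by rewrite /restr_density nz// mul0r mul0e.
rewrite -EFinM lee_fin ler_piMr ?mulr_ge0//.
by rewrite -expR0 ler_expR mulNr oppr_le0 mulr_ge0// ltW.
Qed.

Lemma laplace_restr_ge0 x : (0 <= laplace_restr n A x)%R.
Proof.
apply: fine_ge0; apply: integral_ge0 => s _; rewrite mule_ge0//.
  exact: (nnm_restr_density hn mA).2.
by rewrite lee_fin expR_ge0.
Qed.

Lemma laplace_restr0 : laplace_restr n A 0 = fine (\int[mu]_s W A s).
Proof.
congr fine; apply: eq_integral => s _.
by rewrite /expf oppr0 mul0r expR0 mule1.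
Qed.

(** Mass minus Laplace transform is the Laplace exponent of the jumps in [A]. It stays bounded as
    [A] grows although both terms may diverge. *)
Lemma laplace_restr_diff x : (0 <= x)%R ->
  \int[mu]_s (n s * (1 - expR (- (x * s))) * \1_A s)%:E =
  (fine (\int[mu]_s W A s) - laplace_restr n A x)%:E.
Proof.
move=> x0; have [mn n0 nz _] := hn.
have nW := nnm_restr_density hn mA.
have nWe : nnm (fun s => W A s * expf (- x) s) by apply: nnmM => //; exact: nnm_expf.
have h : \int[mu]_s W A s =
    \int[mu]_s (n s * (1 - expR (- (x * s))) * \1_A s)%:E +
    \int[mu]_s (W A s * expf (- x) s).
  rewrite -ge0_integralD//.
  - apply: eq_integral => s _; rewrite /restr_density /expf -EFinM -EFinD mulNr.
    by congr EFin; ring.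
  - by move=> s _; rewrite lee_fin mulr_ge0// n_exp_ge0.
  - apply/measurable_EFinP; apply: measurable_funM; last exact: measurable_indic.
    exact: (measurable_funM mn (measurable_1sub x)).
  - by move=> s _; exact: nWe.2.
  - exact: nWe.1.
rewrite laplace_restrE// in h.
by rewrite EFinB fineK// h addeK.
Qed.

Lemma laplace_restr_le x : (0 <= x)%R ->
  (laplace_restr n A x <= fine (\int[mu]_s W A s))%R.
Proof.
move=> x0; rewrite -subr_ge0 -lee_fin -laplace_restr_diff//.
apply: integral_ge0 => s _; rewrite lee_fin mulr_ge0//; exact: n_exp_ge0.
Qed.

Lemma laplace_restr_diff_le x : (0 <= x)%R ->
  (fine (\int[mu]_s W A s) - laplace_restr n A x <= density_exponent n x)%R.
Proof.
move=> x0; rewrite -lee_fin -laplace_restr_diff// -density_exponentE//.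
apply: ge0_le_integral => //.
- by move=> s _; rewrite lee_fin mulr_ge0// n_exp_ge0.
- apply/measurable_EFinP; apply: measurable_funM; last exact: measurable_indic.
  by have [mn _ _ _] := hn; exact: (measurable_funM mn (measurable_1sub x)).
- by apply (nnm_n_exp x0).1.
by move=> s _; rewrite lee_fin ler_piMr ?n_exp_ge0.
Qed.

End OnSet.
End Exponent.

End Truncations.

Section TruncationSequence.
Context {R : realType}.
Local Open Scope ereal_scope.
Local Notation mu := (@lebesgue_measure R).
Implicit Types (g h : R -> \bar R) (t x s : R) (A B : set R).
Variables (n : R -> R) (a : nat -> R).
Hypotheses (hn : levy_density n) (n_infty : \int[mu]_s (n s)%:E = +oo).
Hypotheses (a_gt0 : forall j, (0 < a j)%R) (a_ni : nonincreasing_seq a)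
  (a_0 : a @ \oo --> (0%R : R)).
Local Notation W := (restr_density n).
Local Notation Tn := (density_tail n).
Local Notation c := (fun j => fine (Tn (a j))).

Let a_near s : (0 < s)%R -> \forall j \near \oo, (a j < s)%R.
Proof. by move=> s0; apply: (cvgr_lt _ a_0). Qed.

Lemma cvg_restr_indic s : (0 < s)%R ->
  (\1_(`]a j, +oo[%classic : set R) s : R) @[j --> \oo] --> (1 : R)%R.
Proof.
move=> s0; apply: cvg_near_cst; near=> j.
rewrite indicE mem_setE in_itv/= andbT.
by rewrite (_ : (a j < s)%R)//; near: j; exact: a_near.
Unshelve. all: by end_near. Qed.

Lemma restr_indic_nd s :
  {homo (fun j => \1_(`]a j, +oo[%classic : set R) s : R) : i j / (i <= j)%N >-> (i <= j)%R}.
Proof.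
move=> i j ij; rewrite !indicE !mem_setE !in_itv/= !andbT ler_nat.
have := a_ni ij; case: (ltP (a i) s) => // ais aij.
by rewrite (le_lt_trans aij).
Qed.

(** Monotone convergence, kept general in [k] because it serves twice: for [n] itself, where the
    limit is infinite, and for the integrand of the Laplace exponent, where it is finite. *)
Lemma cvg_restr_integral (k : R -> R) : measurable_fun setT k ->
  (forall s, (0 < s)%R -> (0 <= k s)%R) -> (forall s, (s <= 0)%R -> k s = 0%R) ->
  \int[mu]_s (k s * \1_(`]a j, +oo[%classic : set R) s)%:E @[j --> \oo] -->
  \int[mu]_s (k s)%:E.
Proof.
move=> mk k0 kz.
have kge0 s : (0 <= k s)%R by have [/kz->|/k0] := leP s 0%R.
pose g j s := (k s * \1_(`]a j, +oo[%classic : set R) s)%:E.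
rewrite (_ : \int[mu]_s (k s)%:E = \int[mu]_s (limn (g^~ s))).
  apply: (@cvg_monotone_convergence _ _ _ mu setT measurableT g) => //.
  - by move=> j; apply/measurable_EFinP; apply: measurable_funM.
  - by move=> j s _; rewrite lee_fin mulr_ge0.
  - by move=> s _ i j ij; rewrite lee_fin ler_wpM2l// restr_indic_nd.
apply: eq_integral => s _; apply/esym/cvg_lim => //.
have [s0|s0] := leP s 0%R.
  apply: cvg_near_cst; apply: nearW => j; rewrite /g kz// mul0r//.
rewrite -[X in _ --> X%:E]mulr1; apply: cvg_EFin; first exact: nearW.
by apply: cvgM; [exact: cvg_cst|exact: cvg_restr_indic].
Qed.

Lemma cvg_tail_infty : c j @[j --> \oo] --> +oo%R.
Proof.
have [mn n0 nz _] := hn.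
have := @cvg_restr_integral n mn (fun s _ => n0 s) nz; rewrite n_infty => h.
apply/cvgeryP; apply: cvg_trans h; apply: near_eq_cvg; apply: nearW => j /=.
by rewrite fineK// density_tail_fin.
Qed.

Lemma cvg_laplace_restr x : (0 <= x)%R ->
  (c j - laplace_restr n `]a j, +oo[%classic x)%R @[j --> \oo] -->
  density_exponent n x.
Proof.
move=> x0; have [mn n0 nz _] := hn.
have := @cvg_restr_integral (fun s => n s * (1 - expR (- (x * s))))%R.
rewrite density_exponentE// => h.
have h1 s : (0 < s)%R -> (0 <= n s * (1 - expR (- (x * s))))%R.
  by move=> s0; rewrite mulr_ge0// one_sub_expRN_ge0// mulr_ge0// ltW.
have h2 s : (s <= 0)%R -> (n s * (1 - expR (- (x * s))))%R = 0%R.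
  by move=> s0; rewrite nz// mul0r.
have {h}/fine_cvg := h (measurable_funM mn (measurable_1sub x)) h1 h2.
apply: cvg_trans; apply: near_eq_cvg; apply: nearW => j /=.
by rewrite laplace_restr_diff// (density_tail_fin hn).
Qed.
End TruncationSequence.

(** * Absolutely continuous distribution functions and densities *)

Section AbsolutelyContinuousMeasure.
Context {R : realType}.
Local Open Scope ereal_scope.
Local Notation mu := (@lebesgue_measure R).

(** Supplies endpoints for a component of an open set. Disjointness and length are read on []u, v[],
    which lies inside [J], while the measure is known on half-open intervals, so [J] is covered by
    []u, v]]. An empty [J] receives [u = v = a]. *)
Lemma open_interval_hull (J : set R) (a b : R) : (a <= b)%R ->
  open J -> is_interval J -> J `<=` `]a, b[%classic ->
  exists uv : R * R, [/\ [/\ a <= uv.1, uv.1 <= uv.2 & uv.2 <= b]%R,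
    `]uv.1, uv.2[%classic `<=` J & J `<=` `]uv.1, uv.2]%classic].
Proof.
move=> ab oJ iJ Jab; have [J0|/set0P[x0 Jx0]] := eqVneq J set0.
  exists (a, a); split => //= x; last by rewrite J0.
  by rewrite /= in_itv/= => /andP[ax xa]; have := lt_trans ax xa; rewrite ltxx.
have lJ : has_lbound J by exists a => y /Jab/=; rewrite in_itv/= => /andP[/ltW].
have uJ : has_ubound J by exists b => y /Jab/=; rewrite in_itv/= => /andP[_ /ltW].
have JE : J = [set r | inf J < r < sup J]%R.
  by rewrite -interval_bounded_interior// (interior_id J).1.
have infx : (inf J < x0 < sup J)%R by move: Jx0; rewrite {1}JE.
exists (inf J, sup J) => /=; split.
- split.
  + apply: lb_le_inf; first by exists x0.
    by move=> y /Jab/=; rewrite in_itv/= => /andP[/ltW].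
  + by case/andP: infx => h1 h2; exact/ltW/(lt_trans h1).
  + apply: ge_sup; first by exists x0.
    by move=> y /Jab/=; rewrite in_itv/= => /andP[_ /ltW].
- by move=> z /=; rewrite in_itv/= => h; rewrite JE.
- move=> z; rewrite {1}JE => /andP[h1 h2] /=.
  by rewrite in_itv/= h1 ltW.
Qed.

Variable m : {measure set (measurableTypeR R) -> \bar R}.

(** A null set lies in an open set of length below [del], by outer regularity. The components of
    that set, cut by []a, b[], are disjoint intervals of total length below [del], and the
    increments of [G] over them bound the measure. *)
Lemma abs_continuous_null (G : R -> R) (a b : R) : (a < b)%R ->
  (forall x y, a <= x -> x <= y -> y <= b ->
     m `]x, y]%classic = `|G y - G x|%:E)%R ->
  abs_continuous_itv a b G ->
  forall A : set (measurableTypeR R), measurable A -> A `<=` `]a, b[%classic ->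
  mu A = 0 -> m A = 0.
Proof.
move=> ab mG acG A mA Aab A0; apply/eqP; rewrite eq_le measure_ge0 andbT.
apply/lee_addgt0Pr => e e0; rewrite add0e.
have [del del0 H] := acG e e0.
have [U [oU AU UA]] := lebesgue_regularity_outer mA (eq_ind_r (fun z => z < +oo) (ltry 0) A0) del0.
have mU : measurable U by exact: open_measurable.
have Udel : mu U < del%:E.
  rewrite (_ : U = (U `\` A) `|` A); last first.
    by rewrite setUC setDUK.
  have h : mu (U `\` A `|` A) <= mu (U `\` A) + mu A.
    by apply: measureU2 => //; exact: measurableD.
  apply: (le_lt_trans h).
  by rewrite [X in _ + X](_ : _ = 0) ?adde0//; exact: A0.
pose I k := open_disjoint_itv oU k `&` `]a, b[%classic.
have oI k : open (I k) by apply: openI => //; exact: open_disjoint_itv_open.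
have mI k : measurable (I k : set (measurableTypeR R)) by exact: open_measurable.
have iI k : is_interval (I k).
  move=> x y [Ix ix] [Iy iy] z xyz; split.
    exact: (open_disjoint_itv_is_interval Ix Iy).
  exact: (interval_is_interval ix iy).
have tI : trivIset setT I.
  by apply: trivIset_setIr; exact: open_disjoint_itv_trivIset.
have /choice[uv huv] k := open_interval_hull (ltW ab) (oI k) (iI k) (@subIsetr _ _ _).
have muv k : measurable (`](uv k).1, (uv k).2[%classic : set (measurableTypeR R)).
  exact: measurable_itv.
have AI : A `<=` \bigcup_k I k.
  move=> x Ax; have := AU _ Ax; rewrite {1}(open_disjoint_itv_bigcup oU) => -[k _ Ik].
  by exists k => //; split => //; exact: Aab.
rewrite (@le_trans _ _ (m (\bigcup_k I k)))//.
  by rewrite le_measure ?inE//; exact: bigcup_measurable.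
rewrite measure_bigcup//.
(* Absolute continuity speaks of finite families, so the countable sum is bounded through its
   partial sums. *)
apply: lime_le; first by apply: is_cvg_nneseries => k _ _; exact: measure_ge0.
apply: nearW => N; rewrite big_mkord.
have tuv : trivIset setT (fun k => `](uv k).1, (uv k).2[%classic).
  move=> i j _ _ [z [zi zj]]; apply: (tI i j) => //; exists z.
  by split; [have [_ + _] := huv i|have [_ + _] := huv j]; exact.
have len : (\sum_(k < N) ((uv k).2 - (uv k).1) < del)%R.
  rewrite -lte_fin (le_lt_trans _ Udel)// -sumEFin.
  rewrite (eq_bigr (fun k : 'I_N => mu (`](uv k).1, (uv k).2[%classic))); last first.
    move=> k _; rewrite lebesgue_measure_itv/= lte_fin.
    have [[_ + _] _ _] := huv k; rewrite le_eqVlt => /predU1P[->|->].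
      by rewrite ltxx subrr.
    by rewrite -EFinB.
  rewrite -(@measure_semi_additive_ord_I _ _ _ mu
    (fun k => `](uv k).1, (uv k).2[%classic) N)//; last 2 first.
  - exact: sub_trivIset tuv.
  - by apply: bigsetU_measurable.
  rewrite le_measure ?inE//; first by apply: bigsetU_measurable.
  rewrite [X in X `<=` _](esym (bigcup_mkord N
    (fun k => `](uv k).1, (uv k).2[%classic))) => x [k _] xuv; have [_ + _] := huv k => /(_ _ xuv)[Ix _].
  by rewrite (open_disjoint_itv_bigcup oU); exists k.
apply: (@le_trans _ _ (\sum_(k < N) `|G (uv k).2 - G (uv k).1|)%:E); last first.
  rewrite lee_fin ltW//; apply: (H N (fun k => (uv k).1) (fun k => (uv k).2)) => //.
    by move=> k _; have [] := huv k.
  by apply: (sub_trivIset _ tuv).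
rewrite -sumEFin [X in X <= _](eq_bigl xpredT); last by move=> k; exact: mem_set.
apply: lee_sum => k _; have [[h1 h2 h3] _ h4] := huv k.
by rewrite -mG// le_measure ?inE//; exact: measurable_itv.
Qed.

(** Radon-Nikodym for the restriction of [m] to [D]. Multiplying by the indicator of [D] makes the
    density vanish everywhere off [D], not merely almost everywhere. *)
Lemma density_on (D : set (measurableTypeR R)) : measurable D -> m D < +oo ->
  (forall A : set (measurableTypeR R), measurable A -> A `<=` D -> mu A = 0 -> m A = 0) ->
  exists u : R -> R, [/\ measurable_fun [set: R] u, forall x, (0 <= u x)%R,
    forall x, ~ D x -> u x = 0%R, mu.-integrable setT (EFin \o u) &
    forall g : R -> \bar R, nnm g -> \int[m]_(x in D) g x = \int[mu]_x ((u x)%:E * g x)].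
Proof.
move=> mD finD nullD.
pose nu := mrestr m mD.
have finnu : fin_num_fun nu.
  move=> A mA; rewrite ge0_fin_numE ?measure_ge0//.
  apply: le_lt_trans finD; rewrite /nu /mrestr.
  by apply: le_measure; rewrite ?inE//; exact: measurableI.
pose nuf : {finite_measure set (measurableTypeR R) -> \bar R} :=
  HB.pack nu (Measure_isFinite.Build _ _ _ nu finnu).
have numu : nuf `<< mu.
  move=> A nA B mB BA; rewrite /nuf/= /nu/= /mrestr.
  apply: nullD; [exact: measurableI|by move=> x []|].
  apply/eqP; rewrite eq_le measure_ge0 andbT -(nA _ mB BA).
  by rewrite le_measure ?inE//; exact: measurableI.
pose r := Radon_Nikodym_SigmaFinite.f nuf mu.
have rfin x : r x \is a fin_num by exact: Radon_Nikodym_SigmaFinite.f_fin_num.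
have r0 x : 0 <= r x by exact: Radon_Nikodym_SigmaFinite.f_ge0.
have ir : mu.-integrable setT r by exact: Radon_Nikodym_SigmaFinite.f_integrable.
have mr : measurable_fun setT r by exact: measurable_int ir.
pose u x := (fine (r x) * \1_D x)%R.
have u0 x : (0 <= u x)%R by rewrite mulr_ge0// fine_ge0.
have mu_ : measurable_fun [set: measurableTypeR R] u.
  apply: measurable_funM; last exact: measurable_indic.
  by apply: measurableT_comp => //; exact: fine_measurable.
exists u; split => //.
- by move=> x nD; rewrite /u indicE memNset// mulr0.
- apply: (le_integrable measurableT _ _ ir).
    by apply/measurable_EFinP.
  move=> x _; rewrite (gee0_abs (r0 x)) /= ger0_norm//.
  rewrite -[leRHS](fineK (rfin x)) lee_fin /u indicE ler_piMr ?fine_ge0//.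
  by rewrite lern1 leq_b1.
move=> g [mg g0].
transitivity (\int[nuf]_(x in D) g x).
  apply: eq_measure_integral => A mA AD.
  by transitivity (m (A `&` D)); first by rewrite setIidl.
rewrite -(Radon_Nikodym_SigmaFinite.change_of_variables numu)//; last first.
  exact: measurable_funTS.
rewrite integral_mkcond; apply: eq_integral => x _.
rewrite patchE /u indicE; case: (x \in D); last by rewrite mulr0 mul0e.
by rewrite mulr1 fineK// muleC.
Qed.

End AbsolutelyContinuousMeasure.

(** * Changing a possibly non-measurable integrand on a null set *)

Section NonMeasurableIntegral.
Local Open Scope ereal_scope.
Context d (T : measurableType d) (R : realType) (m : {measure set T -> \bar R}).

Import HBNNSimple.

(** The integral is a supremum over simple functions. A simple function below [f], set to zero on
    [N], keeps its integral and falls below [g]: on [N] because [g] is nonnegative, elsewhere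
    because [f = g]. *)
Let nnint_le_off_null (f g : T -> \bar R) (N : set T) :
  measurable N -> m N = 0 -> (forall x, 0 <= g x) ->
  (forall x, ~ N x -> f x = g x) ->
  ereal_sup [set sintegral m h | h in
    [set h : {nnsfun T >-> R} | forall x, (h x)%:E <= f x]] <=
  ereal_sup [set sintegral m h | h in
    [set h : {nnsfun T >-> R} | forall x, (h x)%:E <= g x]].
Proof.
move=> mN N0 g0 fg; apply: ge_ereal_sup => _ [h hf <-].
pose h' := proj_nnsfun h (measurableC mN).
have h'E x : h' x = (h x * \1_(~` N) x)%R by rewrite /h' /= mindicE indicE.
have int_sint (k : {nnsfun T >-> R}) : sintegral m k = \int[m]_x (k x)%:E.
  by rewrite integral_nnsfun// patch_setT.
have -> : sintegral m h = sintegral m h'.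
  rewrite !int_sint.
  rewrite (@ge0_negligible_integral _ _ _ m setT N)//; last 2 first.
  - by apply/measurable_EFinP; exact: measurable_funP.
  - by move=> x _; rewrite lee_fin.
  rewrite [RHS](@ge0_negligible_integral _ _ _ m setT N)//; last 2 first.
  - by apply/measurable_EFinP; exact: measurable_funP.
  - by move=> x _; rewrite lee_fin.
  apply: eq_integral => x; rewrite inE => -[_ nNx].
  by rewrite h'E indicE mem_set// mulr1.
apply: ereal_sup_ubound; exists h' => // x.
have [Nx|nNx] := pselect (N x).
  by rewrite -[X in X%:E]/(h' x) h'E indicE memNset ?mulr0//; exact.
by rewrite -[X in X%:E]/(h' x) h'E indicE mem_set// mulr1 -fg.
Qed.

(* No measurability is needed: [f] may be the derivative [derive1], with junk
   values at the points where the derivative does not exist. *)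
Lemma eq_integral_off_null (D N : set T) (f g : T -> \bar R) :
  measurable N -> m N = 0 -> (forall x, D x -> ~ N x -> f x = g x) ->
  \int[m]_(x in D) f x = \int[m]_(x in D) g x.
Proof.
move=> mN N0 fg.
have E x : ~ N x -> (f \_ D) x = (g \_ D) x.
  by move=> nNx; rewrite !patchE; case: ifPn => // /set_mem Dx; exact: fg.
rewrite /integral; congr (_ - _); apply/eqP; rewrite eq_le; apply/andP; split;
  apply: (nnint_le_off_null mN N0); do ?[by move=> x; exact: funepos_ge0|
    by move=> x; exact: funeneg_ge0];
  by move=> x nNx; rewrite ?funeposE ?funenegE E.
Qed.

End NonMeasurableIntegral.

Lemma derive1_shift_sub {R : realType} (f : R -> R) (s t : R) :
  derive1 (fun y => f (y - s)) t = derive1 f (t - s).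
Proof.
have E : (fun h => h^-1 *: (f (h + t - s) - f (t - s))) =
    (fun h => h^-1 *: (f (h + (t - s)) - f (t - s))).
  by apply/funext => h; rewrite addrA.
by rewrite /derive1/= E.
Qed.

Lemma lebesgue_stieltjes_measure_itvoc {R : realType} (F : cumulative R R) (x y : R) :
  x <= y -> lebesgue_stieltjes_measure F `]x, y]%classic = (F y - F x)%:E.
Proof.
move=> xy; rewrite /lebesgue_stieltjes_measure /measure_extension/=.
by rewrite measurable_mu_extE/= ?wlength_itv_bnd//; exact: is_ocitv.
Qed.

Lemma abs_continuous_continuous {R : realType} (w : R -> R) :
  (forall b, abs_continuous_itv 0 b w) -> (forall t, t <= 0 -> w t = 0) ->
  continuous w.
Proof.
move=> acw w0 t; apply/cvgrPdist_lt => e e0.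
have [del del0 H] := acw (`|t| + 1) e e0.
(* Absolute continuity is available on [[0, b]] only; replacing [x] by [max 0 x] brings points left
   of the origin into range without changing [w]. *)
have wr x : w (Num.max 0 x) = w x.
  by case: (leP 0 x) => // /ltW x0; rewrite !w0.
have lip x y : x <= y -> y <= `|t| + 1 -> y - x < del -> `|w y - w x| < e.
  move=> xy yt yx; rewrite -(wr x) -(wr y).
  have := H 1%N (fun=> Num.max 0 x) (fun=> Num.max 0 y).
  rewrite !big_ord1; apply.
  - move=> _ _; split; first by rewrite le_max lexx.
      by rewrite ge_max !le_max lexx xy orbT.
    by rewrite ge_max yt addr_ge0.
  - by move=> [|i] [|j].
  - by apply: le_lt_trans yx; case: (leP 0 x); case: (leP 0 y); lra.
near=> z.
have [tz|/ltW zt] := leP t z.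
  rewrite distrC; apply: lip => //.
    rewrite (@le_trans _ _ (t + 1))//; last by rewrite lerD2r ler_norm.
    by rewrite ltW//; near: z; apply: lt_nbhsl; rewrite ltrDl.
  by rewrite ltrBlDl; near: z; apply: lt_nbhsl; rewrite ltrDl.
apply: lip => //; first by rewrite ler_wpDr// ler_norm.
rewrite ltrBlDr -ltrBlDl; near: z; apply: lt_nbhsr.
by rewrite ltrBlDr ltrDl.
Unshelve. all: by end_near. Qed.

(** * Potentials of the truncated processes and their limit *)

Section ApproximatePotential.
Context {R : realType}.
Local Open Scope ereal_scope.
Local Notation mu := (@lebesgue_measure R).
Implicit Types (g h : R -> \bar R) (t x s : R).
Variables (n : R -> R) (a : nat -> R) (eta X kap : R).
Hypotheses (hn : levy_density n) (n_infty : \int[mu]_s (n s)%:E = +oo).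
Hypotheses (a_gt0 : forall j, (0 < a j)%R) (a_ni : nonincreasing_seq a)
  (a_0 : a @ \oo --> (0%R : R)).
Local Notation W := (restr_density n).
Local Notation Tn := (density_tail n).
Local Notation c := (fun j => fine (Tn (a j))).
Local Notation q := (fun j => eta + c j)%R.
Local Notation w j := (W `]a j, +oo[%classic).
Local Notation w_ i j := (W `]a j, a i]%classic).
Local Notation phi j := (laplace_restr n `]a j, +oo[%classic).
Local Notation phi_ i j := (laplace_restr n `]a j, a i]%classic).
Hypotheses (X_gt0 : (0 < X)%R) (kap_gt0 : (0 < kap)%R).
Hypothesis hkap : forall j, (kap <= q j - phi j X)%R.

(** The truncated process has generator [(w j * _) - c j], hence the resolvent parameter
    [q j = eta + c j]. *)
Definition approx_pot j := pot (w j) (q j) chi.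
Local Notation F := approx_pot.

Lemma mass_tail j : \int[mu]_s w j s = (c j)%:E.
Proof. by rewrite fineK// (density_tail_fin hn). Qed.

Lemma mass_tail_fin j : \int[mu]_s w j s \is a fin_num.
Proof. by rewrite mass_tail. Qed.

Lemma mass_band i j : (i <= j)%N -> \int[mu]_s w_ i j s = (c j - c i)%:E.
Proof.
move=> ij; have := density_tail_split hn (a_ni ij).
rewrite EFinB !fineK ?(density_tail_fin hn)// => ->.
by rewrite addeK// (density_tail_fin hn).
Qed.

Lemma mass_band_fin i j : (i <= j)%N -> \int[mu]_s w_ i j s \is a fin_num.
Proof. by move=> ij; rewrite mass_band. Qed.

Lemma c_nd i j : (i <= j)%N -> (c i <= c j)%R.
Proof.
move=> ij; rewrite -subr_ge0 -lee_fin -mass_band//.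
by apply: integral_ge0 => s _; apply (nnm_restr_density hn (measurable_itv _)).2.
Qed.

Lemma c_ge0 j : (0 <= c j)%R.
Proof. by rewrite fine_ge0// (density_tail_ge0 hn). Qed.

Let ww j : weight (w j).
Proof. exact: weight_restr_density. Qed.

Let ww_ i j : weight (w_ i j).
Proof. exact: weight_restr_density. Qed.

Lemma q_gt0 j : (0 < q j)%R.
Proof.
have := hkap j; have := laplace_restr_ge0 hn (measurable_itv `]a j, +oo[) X.
by move: kap_gt0 => /=; lra.
Qed.

(** The Laplace transform of the band is at most its mass [c j - c i]. For band potentials the lower
    bound [kap] thus improves to [q i], which is large and does not involve [j]. *)
Lemma le_q_band i j : (i <= j)%N -> (q i <= q j - phi_ i j X)%R.
Proof.
move=> ij; have := laplace_restr_le hn (measurable_itv _) (mass_band_fin ij) (ltW X_gt0).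
by rewrite mass_band//=; lra.
Qed.

Lemma laplace_tailE j x : (0 <= x)%R ->
  \int[mu]_s (w j s * expf (- x) s) = (phi j x)%:E.
Proof. by move=> x0; rewrite laplace_restrE// mass_tail. Qed.

Lemma laplace_bandE i j x : (i <= j)%N -> (0 <= x)%R ->
  \int[mu]_s (w_ i j s * expf (- x) s) = (phi_ i j x)%:E.
Proof. by move=> ij x0; rewrite laplace_restrE// mass_band. Qed.

Lemma le_pot_tail j g (C : R) t : nnm g -> (0 <= C)%R ->
  (forall y, (y <= t)%R -> g y <= (C * expR (X * y))%:E) ->
  pot (w j) (q j) g t <= (C / kap * expR (X * t))%:E.
Proof.
move=> hg C0 gC; have phi0 := laplace_restr_ge0 hn (measurable_itv `]a j, +oo[) X.
have kq := hkap j.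
apply: (@le_trans _ _ (C / (q j - phi j X) * expR (X * t))%:E).
  apply: le_pot_expf => //; first exact: laplace_tailE (ltW X_gt0).
  by move: kap_gt0 kq => /=; lra.
rewrite lee_fin ler_wpM2r ?expR_ge0// ler_wpM2l// lef_pV2 ?posrE//.
exact: lt_le_trans kq.
Qed.

Lemma le_pot_band i j g (C : R) t : (i <= j)%N -> nnm g -> (0 <= C)%R ->
  (forall y, (y <= t)%R -> g y <= (C * expR (X * y))%:E) ->
  pot (w_ i j) (q j) g t <= (C / q i * expR (X * t))%:E.
Proof.
move=> ij hg C0 gC; have phi0 := laplace_restr_ge0 hn (measurable_itv `]a j, a i]) X.
have kq := le_q_band ij; have qi := q_gt0 i.
apply: (@le_trans _ _ (C / (q j - phi_ i j X) * expR (X * t))%:E).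
  apply: le_pot_expf => //; first exact: laplace_bandE (ltW X_gt0).
  by move: qi kq => /=; lra.
rewrite lee_fin ler_wpM2r ?expR_ge0// ler_wpM2l// lef_pV2 ?posrE//.
exact: lt_le_trans kq.
Qed.

Lemma nnm_approx_pot j : nnm (F j).
Proof. by apply: nnm_pot => //; [exact: q_gt0|exact: nnm_chi]. Qed.

Lemma approx_pot_le j t : F j t <= (kap^-1 * expR (X * t))%:E.
Proof.
rewrite -[X in (X * _)%:E]mul1r; apply: le_pot_tail => //; first exact: nnm_chi.
by move=> y _; apply: chi_le_expf; exact: ltW.
Qed.

Lemma approx_pot_fin j t : F j t \is a fin_num.
Proof.
rewrite ge0_fin_numE; last exact: (nnm_approx_pot j).2.
exact: le_lt_trans (approx_pot_le j t) (ltry _).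
Qed.

Lemma approx_pot_nd j s t : (s <= t)%R -> F j s <= F j t.
Proof.
move=> st; rewrite (_ : s = t - (t - s))%R; last by rewrite subKr.
rewrite /approx_pot -pot_shift; apply: le_pot => //; [exact: q_gt0|
  by apply: nnm_shift; exact: nnm_chi|exact: nnm_chi|].
move=> y _; rewrite !chiE lee_fin ler_nat; case: (leP 0%R y) => [|y0].
  by rewrite leq_b1.
by rewrite leNgt (_ : (y - (t - s) < 0)%R)//; lra.
Qed.

Lemma approx_pot_lt0 j t : (t < 0)%R -> F j t = 0.
Proof.
move=> t0; apply/eqP; rewrite eq_le (nnm_approx_pot j).2 andbT.
rewrite (@le_trans _ _ (0 / kap * expR (X * t))%:E)//; last by rewrite !mul0r.
apply: le_pot_tail => //; first exact: nnm_chi.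
by move=> y yt; rewrite mul0r chiE [(0 <= y)%R]leNgt (le_lt_trans yt t0).
Qed.

(** At the origin only the time before the first jump counts: the convolution term vanishes because
    [F j] does so on the negative axis. *)
Lemma approx_pot0 j : F j 0 = (q j)^-1%:E.
Proof.
have := potE 0%R (q_gt0 j) (ww j) nnm_chi.
rewrite chiE lexx convol.unlock integral0_eq; last first.
  move=> s _; have [s0|s0] := leP s 0%R.
    by have [_ _ nz _] := hn; rewrite /restr_density nz// mul0r mul0e.
  rewrite -[pot _ _ _ _]/(F j (0 - s)%R).
  by rewrite approx_pot_lt0 ?mule0// sub0r oppr_lt0.
rewrite adde0 -[pot _ _ _ _]/(F j 0%R) -(fineK (approx_pot_fin j 0%R)) -EFinM.
move=> [] h; congr EFin; apply: (mulfI (lt0r_neq0 (q_gt0 j))).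
by rewrite h mulfV// (lt0r_neq0 (q_gt0 j)).
Qed.

Lemma pot_band_fin i j g (C : R) t : (i <= j)%N -> nnm g -> (0 <= C)%R ->
  (forall y, (y <= t)%R -> g y <= (C * expR (X * y))%:E) ->
  pot (w_ i j) (q j) g t \is a fin_num.
Proof.
move=> ij hg C0 gC; rewrite ge0_fin_numE.
  exact: le_lt_trans (le_pot_band ij hg C0 gC) (ltry _).
by apply (nnm_pot (q_gt0 j) (ww_ i j) hg).2.
Qed.

Lemma convol_pot_band_fin i j g (C : R) t : (i <= j)%N -> nnm g -> (0 <= C)%R ->
  (forall y, g y <= (C * expR (X * y))%:E) ->
  convol (w_ i j) (pot (w_ i j) (q j) g) t \is a fin_num.
Proof.
move=> ij hg C0 gC.
have hp := nnm_pot (q_gt0 j) (ww_ i j) hg; have [nw _ _] := ww_ i j.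
rewrite ge0_fin_numE; last exact: (nnm_convol nw hp).2.
apply: (le_lt_trans (le_convol_expf (C := C / q i) t (ww_ i j) hp _ (laplace_bandE ij (ltW X_gt0)) _)).
- by rewrite divr_ge0// ltW// q_gt0.
- by move=> y; exact: le_pot_band.
- exact: ltry.
Qed.

(** Either all jumps lie in the band []a j, a i]], or one exceeds [a i] and is singled out by the
    convolution with [w i]. The exponential bound on [g] provides the finiteness that [pot_split]
    needs. *)
Lemma pot_decomp i j g (C : R) t : (i <= j)%N -> nnm g -> (0 <= C)%R ->
  (forall y, g y <= (C * expR (X * y))%:E) ->
  pot (w j) (q j) g t = pot (w_ i j) (q j) g t +
    convol (w i) (pot (w_ i j) (q j) (pot (w j) (q j) g)) t.
Proof.
move=> ij hg C0 gC; rewrite [w j](restr_density_split n (a_ni ij)).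
rewrite (pot_split (w1 := w_ i j) (w0 := w i))//; first exact: q_gt0.
rewrite -(restr_density_split n (a_ni ij)).
apply: (convol_pot_band_fin (C := C / kap)) => //.
- by apply: nnm_pot => //; exact: q_gt0.
- by rewrite divr_ge0// ltW.
- by move=> y; apply: le_pot_tail.
Qed.

(** Since [chi] is nondecreasing, convolution with the band multiplies it by at most the mass
    [c j - c i], exactly the amount by which [q] grows; so [le_pot_weight] applies. *)
Lemma approx_pot_ni i j t : (i <= j)%N -> F j t <= F i t.
Proof.
move=> ij; rewrite /approx_pot [w j](restr_density_split n (a_ni ij)).
have -> : w_ i j \+ w i = w i \+ w_ i j by apply/funext => s /=; rewrite addeC.
have qE : q j = (q i + (c j - c i))%R by rewrite /=; ring.
rewrite qE; have hF := nnm_approx_pot j.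
have wE : (fun s => w i s + w_ i j s) = w j.
  by rewrite (restr_density_split n (a_ni ij)); apply/funext => s /=; rewrite addeC.
have hq := le_pot_tail i hF _ (fun y _ => approx_pot_le j y).
apply: le_pot_weight => //.
- exact: q_gt0.
- by rewrite subr_ge0 c_nd.
- exact: nnm_chi.
- move=> y; rewrite -mass_band//; rewrite convol.unlock -ge0_integralZr//.
  + apply: ge0_le_integral => //.
    * by move=> s _; rewrite mule_ge0// ?(nnm_chi).2//; case: (ww_ i j) => -[].
    * by apply (convol_nnm y (nnm_restr_density hn (measurable_itv _)) nnm_chi).1.
    * apply: emeasurable_funM => //.
      by apply (nnm_restr_density hn (measurable_itv _)).1.
    * move=> s _; have [s0|s0] := ltP s 0%R.
        by case: (ww_ i j) => _ _ ->//; rewrite !mul0e.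
      rewrite lee_wpmul2l//; first by case: (ww_ i j) => -[].
      rewrite !chiE lee_fin ler_nat; case: (leP 0%R y) => [|y0].
        by rewrite leq_b1.
      by rewrite leNgt (_ : (y - s < 0)%R)//; lra.
  + by apply (nnm_restr_density hn (measurable_itv _)).1.
  + by move=> s _; case: (ww_ i j) => -[].
  + exact: (nnm_chi).2.
- rewrite -qE wE -/(F j) ge0_fin_numE; last first.
    by apply (nnm_convol (nnm_restr_density hn (measurable_itv _)) (nnm_pot (q_gt0 i) (ww i) hF)).2.
  apply: (le_lt_trans (le_convol_expf (C := kap^-1 / kap) t (ww i) (nnm_pot (q_gt0 i) (ww i) hF) _ (laplace_tailE i (ltW X_gt0)) _)).
  + by rewrite divr_ge0// ?invr_ge0 ltW.
  + by move=> y; apply: hq; rewrite invr_ge0 ltW.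
  + exact: ltry.
- rewrite -qE wE -/(F j) ge0_fin_numE; last by apply (nnm_pot (q_gt0 i) (ww i) hF).2.
  by apply: le_lt_trans (hq _ _) (ltry _); rewrite invr_ge0 ltW.
Qed.

(** * The limit potential and its Laplace transform *)

Lemma convol_expf_chi x t : (0 < x)%R ->
  convol (expf x) chi t = (x^-1)%:E * expf x t.
Proof.
move=> x0; rewrite convolC; [|exact: nnm_expf|exact: nnm_chi].
have hchi : nnm (chi : R -> \bar R) by exact: nnm_chi.
rewrite convol.unlock.
(* Up to a constant the integrand is the density of an exponential law. *)
have -> : \int[mu]_s (chi s * expf x (t - s)) =
    \int[mu]_s ((x^-1 * expR (x * t))%:E * (exponential_pdf x s)%:E).
  apply: eq_integral => s _; rewrite chiE.
  have [s0|s0] := leP 0%R s; last by rewrite lt0_exponential_pdf// mul0e mule0.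
  rewrite exponential_pdfE// mul1e /expf -EFinM; congr EFin.
  rewrite mulrBr expRD mulNr mulrACA mulVf ?gt_eqF// mul1r //.
rewrite ge0_integralZl//.
- by rewrite integral_exponential_pdf// mule1.
- apply/measurable_EFinP; exact: measurable_exponential_pdf.
- by move=> s _; rewrite lee_fin exponential_pdf_ge0// ltW.
- by rewrite lee_fin mulr_ge0 ?expR_ge0// invr_ge0 ltW.
Qed.

Lemma laplace_restr_ni j x : (X <= x)%R -> (phi j x <= phi j X)%R.
Proof.
move=> Xx; have x0 : (0 <= x)%R by rewrite (le_trans (ltW X_gt0)).
rewrite -lee_fin -(laplace_tailE j x0) -(laplace_tailE j (ltW X_gt0)).
have nW := nnm_restr_density hn (measurable_itv `]a j, +oo[).
apply: ge0_le_integral => //.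
- by move=> s _; rewrite mule_ge0 ?nW.2// lee_fin expR_ge0.
- by apply (nnmM nW (nnm_expf _)).1.
- by apply (nnmM nW (nnm_expf _)).1.
move=> s _; have [s0|s0] := leP s 0%R.
  by have [_ _ nz _] := hn; rewrite /restr_density nz// mul0r !mul0e.
rewrite lee_wpmul2l ?nW.2// lee_fin ler_expR !mulNr lerN2.
by rewrite ler_wpM2r// ltW.
Qed.

(** Evaluated at [0], convolution with [expf x] is the Laplace transform at [x] after a reflection.
    It passes through [pot] onto [chi], where it produces an exponential again. *)
Lemma laplace_approx_pot j x : (X <= x)%R ->
  convol (expf x) (F j) 0 = (x^-1 * (q j - phi j x)^-1)%:E.
Proof.
move=> Xx; have x0 : (0 < x)%R by rewrite (lt_le_trans X_gt0).
have hw : weight (w j) by exact: weight_restr_density.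
have q0 := q_gt0 j.
rewrite convol_pot//; [|exact: nnm_expf|exact: nnm_chi].
rewrite (_ : convol _ _ = fun y => (x^-1)%:E * expf x y); last first.
  by apply/funext => y; rewrite convol_expf_chi.
rewrite potZ//; [|by rewrite invr_ge0 ltW|exact: nnm_expf].
rewrite (pot_expf 0%R hw (laplace_tailE j (ltW x0))).
- by rewrite mulr0 expR0 mulr1 -EFinM.
- exact: (laplace_restr_ge0 hn (measurable_itv _)).
- have := laplace_restr_ni j Xx; have := hkap j.
  by move: kap_gt0 => /=; lra.
Qed.

Definition lim_pot t : R := limn (fun j => fine (F j t)).

Lemma lim_pot_cvg_fine t : (fun j => fine (F j t)) @ \oo --> lim_pot t.
Proof.
apply: nonincreasing_is_cvgn.
  move=> i j ij; apply: fine_le; try exact: (approx_pot_fin).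
  exact: (approx_pot_ni).
exists 0%R => _ [j _ <-]; apply: fine_ge0.
exact: (nnm_approx_pot j).2.
Qed.

Lemma lim_pot_cvg t : F j t @[j --> \oo] --> (lim_pot t)%:E.
Proof.
apply/fine_cvgP; split; last exact: lim_pot_cvg_fine.
by apply: nearW => j; exact: (approx_pot_fin).
Qed.

Lemma lim_pot_ge0 t : (0 <= lim_pot t)%R.
Proof.
apply: limr_ge; first exact: lim_pot_cvg_fine.
apply: nearW => j; apply: fine_ge0.
exact: (nnm_approx_pot j).2.
Qed.

Lemma lim_pot_le_approx j t : (lim_pot t)%:E <= F j t.
Proof.
have Ffin := approx_pot_fin.
rewrite -(fineK (Ffin j t)) lee_fin.
apply: limr_le; first exact: lim_pot_cvg_fine.
exists j => // k /= jk; apply: fine_le; try exact: Ffin.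
exact: (approx_pot_ni).
Qed.

Lemma lim_pot_nd s t : (s <= t)%R -> (lim_pot s <= lim_pot t)%R.
Proof.
move=> st; apply: ler_lim; [exact: lim_pot_cvg_fine|exact: lim_pot_cvg_fine|].
apply: nearW => j; apply: fine_le; try exact: (approx_pot_fin).
exact: (approx_pot_nd).
Qed.

Lemma cvg_q : q j @[j --> \oo] --> +oo%R.
Proof. exact: (cvg_comp _ _ (cvg_tail_infty hn n_infty a_gt0 a_ni a_0) (cvg_addrl eta)). Qed.

(** The atom [1 / q j] of [F j] at the origin disappears in the limit, because infinite Levy mass
    forces [q j] to infinity. *)
Lemma lim_pot_le0 t : (t <= 0)%R -> lim_pot t = 0%R.
Proof.
move=> t0; apply/eqP; rewrite eq_le lim_pot_ge0 andbT.
apply: (le_trans (lim_pot_nd t0)).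
rewrite (_ : lim_pot 0 = 0%R)//.
apply: cvg_lim => //.
rewrite (_ : (fun j => fine (F j 0%R)) = fun j => (q j)^-1%R); last first.
  by apply/funext => j; rewrite approx_pot0.
by apply/gtr0_cvgV0; [apply: nearW => j; exact: q_gt0|exact: cvg_q].
Qed.

Lemma cvg_q_laplace x : (0 <= x)%R ->
  (q j - phi j x)%R @[j --> \oo] --> (eta + density_exponent n x)%R.
Proof.
move=> x0; rewrite (_ : (fun _ => _) = fun j => (eta + (c j - phi j x))%R); last first.
  by apply/funext => j; rewrite addrA.
by apply: cvgD; [exact: cvg_cst|exact: cvg_laplace_restr].
Qed.

Lemma exponent_gt0 x : (X <= x)%R -> (kap <= eta + density_exponent n x)%R.
Proof.
move=> Xx; have x0 : (0 <= x)%R by rewrite (le_trans (ltW X_gt0)).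
rewrite -(cvg_lim (@Rhausdorff R) (cvg_q_laplace x0)).
apply: limr_ge; first by apply: cvgP; exact: (cvg_q_laplace x0).
apply: nearW => j; apply: le_trans (hkap j) _.
by rewrite lerD2l lerN2 laplace_restr_ni.
Qed.

Lemma nnm_lim_pot : nnm (fun t => (lim_pot t)%:E).
Proof.
split; last by move=> t; rewrite lee_fin lim_pot_ge0.
by apply/measurable_EFinP; apply: nondecreasing_measurable => // s t; exact: lim_pot_nd.
Qed.

Lemma laplace_lim_pot x : (X <= x)%R ->
  \int[mu]_s (expf x s * (lim_pot (- s))%:E) =
  (x^-1 * (eta + density_exponent n x)^-1)%:E.
Proof.
move=> Xx; have x0 : (0 < x)%R by rewrite (lt_le_trans X_gt0).
have hF j : nnm (fun s => expf x s * F j (- s)%R).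
  apply: nnmM; first exact: nnm_expf.
  rewrite (_ : (fun s => _) = fun s => F j (0 - s)%R); last first.
    by apply/funext => s; rewrite sub0r.
  by apply: nnm_refl; exact: nnm_approx_pot.
have IF j : \int[mu]_s (expf x s * F j (- s)%R) = (x^-1 * (q j - phi j x)^-1)%:E.
  rewrite -laplace_approx_pot// convol.unlock.
  by apply: eq_integral => s _; rewrite sub0r.
have hL : nnm (fun s => expf x s * (lim_pot (- s))%:E).
  apply: nnmM; first exact: nnm_expf.
  rewrite (_ : (fun s => _) = fun s => (lim_pot (0 - s))%:E); last first.
    by apply/funext => s; rewrite sub0r.
  exact: (nnm_refl 0%R nnm_lim_pot).
(* The sequence is nonincreasing, so its first term dominates. *)
have h := @dominated_convergence _ _ _ mu setT measurableT
  (fun j s => expf x s * F j (- s)%R) (fun s => expf x s * (lim_pot (- s))%:E)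
  (fun s => expf x s * F 0%N (- s)%R) (fun j => (hF j).1) hL.1.
have h1 : {ae mu, forall s, [set: R] s ->
    expf x s * F j (- s)%R @[j --> \oo] --> expf x s * (lim_pot (- s))%:E}.
  by apply: aeW => s _; apply: cvgeZl => //; exact: lim_pot_cvg.
have h2 : mu.-integrable [set: R] (fun s => expf x s * F 0%N (- s)%R).
  apply/integrableP; split; first exact: (hF 0%N).1.
  under eq_integral do rewrite gee0_abs ?(hF 0%N).2//.
  by rewrite IF ltry.
have h3 : {ae mu, forall s j, [set: R] s ->
    `|expf x s * F j (- s)%R| <= expf x s * F 0%N (- s)%R}.
  apply: aeW => s j _; rewrite gee0_abs ?(hF j).2// lee_wpmul2l//.
    by rewrite lee_fin expR_ge0.
  exact: approx_pot_ni.
have [_ _ h4] := h h1 h2 h3.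
apply: (cvg_unique _ h4) => //=.
rewrite (_ : (fun j => _) = fun j => (x^-1 * (q j - phi j x)^-1)%:E); last first.
  by apply/funext => j; rewrite IF.
apply: cvg_EFin; first exact: nearW.
apply: cvgM; first exact: cvg_cst.
apply: cvgV; last exact: (cvg_q_laplace (ltW x0)).
by rewrite gt_eqF// (lt_le_trans kap_gt0)// exponent_gt0.
Qed.

(** * Absolute continuity of the limit potential *)

Lemma cvge0_lt (u : nat -> \bar R) (e : R) : u @ \oo --> (0 : \bar R) -> (0 < e)%R ->
  \forall k \near \oo, u k < e%:E.
Proof.
move=> h e0; apply: (h [set z | z < e%:E]); apply: open_nbhs_nbhs.
by split; [exact: open_ereal_lt_ereal|rewrite /= lte_fin].
Qed.

(** [n] is integrable beyond [a i], so the region where it exceeds a large integer [k] carries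
    little mass; elsewhere [k] bounds it. This replaces a bounded density, which need not exist. *)
Lemma density_split_large i (e : R) : (0 < e)%R -> exists K : R, exists r : R -> \bar R,
  [/\ (0 <= K)%R, weight r, \int[mu]_s r s <= e%:E &
      forall s, w i s <= K%:E * chi s + r s].
Proof.
move=> e0; have [mn n0 nz _] := hn.
pose A (k : nat) := `]a i, +oo[%classic `&` [set s | (k%:R < n s)%R].
have mA k : measurable (A k).
  apply: measurableI => //; rewrite -[X in measurable X]setTI.
  rewrite (_ : [set s | _] = n @^-1` `]k%:R, +oo[%classic); last first.
    by apply/seteqP; split=> s /=; rewrite in_itv/= andbT.
  exact: mn.
have hW k : nnm (W (A k)) by exact: nnm_restr_density.
have WAw k s : W (A k) s <= w i s.
  rewrite /restr_density lee_fin ler_wpM2l// !indicE ler_nat in_setI.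
  by case: (s \in `]a i, +oo[%classic) => //=; rewrite leq_b1.
have : \int[mu]_s W (A k) s @[k --> \oo] --> \int[mu]_s (cst 0 s : \bar R).
  have h := @dominated_convergence _ _ _ mu setT measurableT
    (fun k => W (A k)) (cst 0) (w i) (fun k => (hW k).1) (measurable_cst _).
  have h1 : {ae mu, forall s, [set: R] s -> W (A k) s @[k --> \oo] --> (0 : \bar R)}.
    apply: aeW => s _; apply: cvg_near_cst; near=> k.
    rewrite /restr_density indicE memNset ?mulr0// => -[_ /=].
    apply/negP; rewrite -leNgt; near: k; exact: nbhs_infty_ger.
  have h2 : mu.-integrable setT (w i).
    apply/integrableP; split; first by apply (nnm_restr_density hn (measurable_itv _)).1.
    under eq_integral do rewrite gee0_abs ?(nnm_restr_density hn (measurable_itv _)).2//.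
    by rewrite mass_tail ltry.
  have h3 : {ae mu, forall s k, [set: R] s -> `|W (A k) s| <= w i s}.
    by apply: aeW => s k _; rewrite gee0_abs ?(hW k).2.
  by have [_ _] := h h1 h2 h3.
rewrite integral0 => h.
have [k _ /(_ k (leqnn k)) hk] : \forall k \near \oo, \int[mu]_s W (A k) s < e%:E.
  exact: cvge0_lt h e0.
exists k%:R, (W (A k)); split => //; [exact: weight_restr_density|exact: ltW|].
move=> s; rewrite chiE /restr_density -EFinM -EFinD lee_fin !indicE.
have [s0|s0] := leP s 0%R; first by rewrite nz// !mul0r addr0 mulr_ge0.
rewrite (ltW s0) mulr1 /A in_setI; have [nk|kn] := leP (n s) k%:R.
  have n1 (b : bool) : (n s * b%:R <= n s)%R by rewrite ler_piMr// lern1 leq_b1.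
  by rewrite (le_trans (n1 _))// (le_trans nk)// lerDl mulr_ge0.
by rewrite [X in _ && X]mem_set//= andbT lerDr.
Unshelve. all: by end_near. Qed.

Lemma pot_sum v p m (g : nat -> R -> \bar R) t : (0 < p)%R -> weight v ->
  (forall k, nnm (g k)) ->
  pot v p (fun y => \sum_(k < m) g k y) t = \sum_(k < m) pot v p (g k) t.
Proof.
move=> p0 hv hg.
elim: m => [|m ih].
  rewrite big_ord0 (_ : (fun _ => _) = fun y => 0%:E * cst 0 y); last first.
    by apply/funext => y; rewrite big_ord0 mul0e.
  by rewrite potZ ?mul0e//; exact: nnm_cst.
have nS : nnm (fun y => \sum_(k < m) g k y).
  split; last by move=> y; apply: sume_ge0 => k _; exact: (hg k).2.
  by apply: emeasurable_sum => k; exact: (hg k).1.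
rewrite big_ord_recr/= -ih -potD//.
by congr pot; apply/funext => y; rewrite big_ord_recr.
Qed.

Lemma sum_disjoint_indic_le1 m (I : nat -> set R) y :
  trivIset `I_m I -> (\sum_(k < m) \1_(I k) y <= 1 :> R)%R.
Proof.
move=> tI; have [[k Iky]|nI] := pselect (exists k : 'I_m, I k y).
  rewrite (bigD1 k)//= big1 ?addr0 ?indicE ?lern1 ?leq_b1// => l lk.
  rewrite indicE memNset// => Ily; move/eqP: lk; apply.
  by apply/val_inj/(tI l k) => //=; exists y.
rewrite big1// => k _; rewrite indicE memNset// => Iky.
by apply: nI; exists k.
Qed.

Lemma trivIset_itv_opp m (u v : nat -> R) :
  (forall k, (k < m)%N -> (u k <= v k)%R) ->
  trivIset `I_m (fun k => `]u k, v k[%classic) ->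
  trivIset `I_m (fun k => `[(- v k)%R, (- u k)%R[%classic : set R).
Proof.
move=> uv tI k l km lm [y []]; rewrite /= !in_itv/= => /andP[vk uk] /andP[vl ul].
apply: (tI k l km lm).
(* Reflection gives intervals closed on one side, so [- y] may be a common right endpoint of the two
   open intervals. A point slightly to its left lies inside both. *)
exists ((- y + Num.max (u k) (u l)) / 2)%R.
have M1 : (Num.max (u k) (u l) < - y)%R by rewrite gt_max; apply/andP; split; lra.
have M2 : (u k <= Num.max (u k) (u l))%R by rewrite le_max lexx.
have M3 : (u l <= Num.max (u k) (u l))%R by rewrite le_max lexx orbT.
by split; rewrite /= in_itv/=; apply/andP; split; lra.
Qed.

Lemma integral_band_indic (u v y : R) : (u <= v)%R ->
  \int[mu]_s (\1_(`[u, v[%classic : set R) (y - s)%R)%:E = (v - u)%:E.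
Proof.
move=> uv.
have := @integral_refl R y _ (nnm_indic (measurable_itv `[u, v[)).
by move=> /= ->; rewrite integral_indic//= setIT lebesgue_measure_itv/= lte_fin
  -EFinB; case: ltP => // vu; congr EFin; lra.
Qed.

Lemma pot_band_one i j t : (i <= j)%N -> pot (w_ i j) (q j) (cst 1) t = ((q i)^-1)%:E.
Proof.
move=> ij.
have -> : cst 1 = expf 0 :> (R -> \bar R).
  by apply/funext => y; rewrite /expf mul0r expR0.
have hw : weight (w_ i j) by exact: weight_restr_density.
have h := laplace_bandE ij (lexx 0%R).
have p0 : phi_ i j 0 = (c j - c i)%R.
  by rewrite laplace_restr0 mass_band.
have qi := q_gt0 i.
rewrite (pot_expf t hw h).
- by rewrite mul0r expR0 mulr1 p0; congr (_^-1)%:E; ring.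
- exact: (laplace_restr_ge0 hn (measurable_itv _)).
- by rewrite p0; move: qi => /=; lra.
Qed.

(** Moves the large jump next to [g], where its density acts directly; the outer potentials are then
    bounded by barriers. *)
Lemma convol_tail_pots i j g t : nnm g ->
  convol (w i) (pot (w_ i j) (q j) (pot (w j) (q j) g)) t =
  pot (w_ i j) (q j) (pot (w j) (q j) (convol (w i) g)) t.
Proof.
move=> hg; have qj := q_gt0 j.
have hwi : weight (w i) by exact: weight_restr_density.
have hwj : weight (w j) by exact: weight_restr_density.
have hw_ : weight (w_ i j) by exact: weight_restr_density.
have [ni fi _] := hwi.
rewrite convol_pot//; last exact: nnm_pot.
by congr pot; apply/funext => y; rewrite convol_pot.
Qed.

(* Near-zero jumps contribute at most [1 / q i] whatever the set; the remaining
   part is smoothed by a jump of size larger than [a i], which has a density. *)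
Lemma sum_increments_le i j (K e b : R) (r : R -> \bar R) m (u v : nat -> R) :
  (i <= j)%N -> (0 <= K)%R -> (0 <= e)%R -> weight r -> \int[mu]_s r s <= e%:E ->
  (forall s, w i s <= K%:E * chi s + r s) ->
  (forall k, (k < m)%N -> [/\ 0 <= u k, u k <= v k & v k <= b]%R) ->
  trivIset `I_m (fun k => `]u k, v k[%classic) ->
  (\sum_(k < m) (fine (F j (v k)) - fine (F j (u k))) <=
   (q i)^-1 + (K * \sum_(k < m) (v k - u k) + e) * (kap^-1 * expR (X * b) / q i))%R.
Proof.
move=> ij K0 e0 hr re wKr uvb tI.
have qj := q_gt0 j; have qi := q_gt0 i.
have hwi : weight (w i) by exact: weight_restr_density.
have hwj : weight (w j) by exact: weight_restr_density.
have hw_ : weight (w_ i j) by exact: weight_restr_density.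
pose I k := `[(- v k)%R, (- u k)%R[%classic : set R.
pose g k y := (\1_(I k) y)%:E : \bar R.
have hg k : nnm (g k) by exact: (nnm_indic (measurable_itv _)).
pose G y := \sum_(k < m) g k y.
have hG : nnm G.
  split; last by move=> y; apply: sume_ge0 => k _; exact: (hg k).2.
  by apply: emeasurable_sum => k; exact: (hg k).1.
have G1 y : G y <= 1.
  rewrite /G /g sumEFin lee_fin; apply: sum_disjoint_indic_le1.
  by apply: trivIset_itv_opp => // k /uvb[].
have Gb y : (y < - b)%R -> G y = 0.
  move=> yb; rewrite /G big1// => k _; rewrite /g indicE memNset// /I /= in_itv/=.
  by move=> /andP[vy _]; have [_ _ vb] := uvb k (ltn_ord k); lra.
(* [chi (y + v k) - chi (y + u k)] is the indicator of the reflected interval, so an increment of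
   [F j] is itself a potential, evaluated at [0]. *)
have incr k : (k < m)%N -> F j (v k) = F j (u k) + pot (w j) (q j) (g k) 0.
  move=> km; have [u0 uv _] := uvb k km.
  rewrite -[v k]add0r -[u k]add0r -[in LHS](opprK (v k)) -[in RHS](opprK (u k)).
  rewrite /approx_pot -!pot_shift -potD//; last by apply: nnm_shift; exact: nnm_chi.
  congr pot; apply/funext => y; rewrite !chiE /g indicE mem_setE in_itv/= -EFinD.
  rewrite !subr_ge0; congr EFin.
  have [vy|yv] := leP (- v k)%R y; have [uy|yu] := leP (- u k)%R y => //=;
    rewrite ?addr0 ?add0r//.
  by lra.
have PG : pot (w j) (q j) G 0 =
    (\sum_(k < m) (fine (F j (v k)) - fine (F j (u k))))%:E.
  rewrite pot_sum// -sumEFin; apply: eq_bigr => k _.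
  rewrite EFinB !fineK ?approx_pot_fin// incr// [F j (u k) + _]addeC addeK//.
  exact: approx_pot_fin.
rewrite -lee_fin -PG.
have Gexp y : G y <= (expR (X * b) * expR (X * y))%:E.
  have [yb|yb] := ltP y (- b)%R; first by rewrite Gb// lee_fin mulr_ge0 ?expR_ge0.
  apply: (le_trans (G1 y)); rewrite lee_fin -expRD -[leLHS]expR0 ler_expR.
  by rewrite -mulrDr; apply: mulr_ge0; [exact: ltW|lra].
(* First summand: [G <= 1] and the band potential of [1] is [1 / q i]. Second summand: one large
   jump applied to [G] yields at most [rho], as [K] meets the total length and [r] meets the bound
   [1]. *)
rewrite (pot_decomp _ ij hG (expR_ge0 (X * b)) Gexp) EFinD leeD//.
  rewrite -(pot_band_one 0%R ij); apply: le_pot => //; exact: nnm_cst.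
pose rho := (K * \sum_(k < m) (v k - u k) + e)%R.
have rho0 : (0 <= rho)%R.
  rewrite addr_ge0// mulr_ge0// sumr_ge0// => k _; rewrite subr_ge0.
  by have [] := uvb k (ltn_ord k).
have IG (y : R) : \int[mu]_s G (y - s)%R = (\sum_(k < m) (v k - u k))%:E.
  rewrite /G ge0_integral_sum//; last 2 first.
  - by move=> k; apply (nnm_refl y (hg k)).1.
  - by move=> k s _; exact: (hg k).2.
  rewrite -sumEFin; apply: eq_bigr => k _; rewrite integral_band_indic.
    by congr EFin; ring.
  by rewrite lerN2; have [] := uvb k (ltn_ord k).
have wG y : convol (w i) G y <= rho%:E * chi (y + b)%R.
  have [yb|yb] := ltP y (- b)%R.
    rewrite (@le_trans _ _ (convol (w i) (cst 0) y))//.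
      have [nw0 _ wz0] := hwi.
      apply: (le_convol nw0 wz0 hG (nnm_cst (lexx 0))) => z zy.
      by rewrite Gb// (le_lt_trans zy).
    rewrite convol.unlock integral0_eq ?mule_ge0 ?lee_fin//.
    by move=> s _; rewrite mule0.
  rewrite chiE (_ : (0 <= y + b)%R) ?mule1; last lra.
  have nK : nnm (fun s => K%:E * chi s) by apply: nnmZ => //; exact: nnm_chi.
  have [nr _ _] := hr; have [nwi _ _] := hwi.
  rewrite (@le_trans _ _ (convol (fun s => K%:E * chi s + r s) G y))//.
    by apply: le_convoll => //; exact: nnmD.
  rewrite convolDl// EFinD leeD//.
    rewrite EFinM -(IG y) -ge0_integralZl//; last 2 first.
    - by apply (nnm_refl y hG).1.
    - by move=> s _; exact: hG.2.
    rewrite convol.unlock; apply: ge0_le_integral => //.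
    - by move=> s _; rewrite mule_ge0 ?hG.2 ?nK.2.
    - by apply (convol_nnm y nK hG).1.
    - by apply: measurable_funeM; apply (nnm_refl y hG).1.
    move=> s _; rewrite lee_wpmul2r ?hG.2// chiE -EFinM lee_fin.
    by rewrite ler_piMr// lern1 leq_b1.
  rewrite (le_trans _ re)// convol.unlock; apply: ge0_le_integral => //.
  - by move=> s _; rewrite mule_ge0 ?hG.2 ?nr.2.
  - by apply (convol_nnm y nr hG).1.
  - exact: nr.1.
  by move=> s _; rewrite -[leRHS]mule1 lee_wpmul2l ?nr.2.
have nchi : nnm (fun y => chi (y + b)%R : \bar R).
  rewrite (_ : (fun y => _) = fun y => chi (y - - b)%R); last first.
    by apply/funext => y; rewrite opprK.
  by apply: nnm_shift; exact: nnm_chi.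
have nwG : nnm (convol (w i) G) by apply: nnm_convol => //; case: hwi.
have n1 := nnm_pot qj hwj nwG.
rewrite convol_tail_pots// mulrA.
have bnd y : (y <= 0)%R -> pot (w j) (q j) (convol (w i) G) y <=
    (rho * (kap^-1 * expR (X * b)) * expR (X * y))%:E.
  move=> _.
  rewrite (@le_trans _ _ (pot (w j) (q j) (fun y => rho%:E * chi (y + b)%R) y))//.
    by apply: le_pot => //; exact: nnmZ.
  rewrite potZ//.
  have -> : pot (w j) (q j) (fun y => chi (y + b)%R) y = F j (y + b)%R.
    rewrite /approx_pot -[in RHS](opprK b) -pot_shift; congr pot.
    by apply/funext => z; rewrite opprK.
  rewrite -mulrA EFinM; apply: lee_wpmul2l; first by rewrite lee_fin.
  rewrite (le_trans (approx_pot_le _ _))// lee_fin.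
  by rewrite -mulrA -expRD -mulrDr (addrC b).
have C0 : (0 <= rho * (kap^-1 * expR (X * b)))%R.
  by rewrite mulr_ge0// mulr_ge0 ?expR_ge0// invr_ge0 ltW.
have := le_pot_band ij n1 C0 bnd.
by rewrite mulr0 expR0 mulr1.
Qed.

(** The level [i], then [K] and [r], then [del] are chosen before [j], so the bound survives the
    limit. The term [1 / q i], the term with [K] and the term with [r] cost [e / 4] each; the last
    quarter keeps the inequality strict in the limit. *)
Lemma lim_pot_ac (b : R) : abs_continuous_itv 0 b lim_pot.
Proof.
move=> e e0.
pose Cb := (kap^-1 * expR (X * b))%R.
have Cb0 : (0 < Cb)%R by rewrite mulr_gt0 ?expR_gt0 ?invr_gt0.
have [i _ /(_ i (leqnn i)) /= qi] : \forall i \near \oo, (4 / e + 1 <= q i)%R.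
  by have /cvgryPge := cvg_q; apply.
have qi1 : (1 <= q i)%R by rewrite (le_trans _ qi)// lerDr divr_ge0// ltW.
have qi0 : (0 < q i)%R by exact: lt_le_trans qi1.
have [K [r [K0 hr re wKr]]] := density_split_large i (e := e / (4 * Cb))%R
  (divr_gt0 e0 (mulr_gt0 (ltr0n _ 4) Cb0)).
exists (e / (4 * Cb * (K + 1)))%R.
  by rewrite divr_gt0// mulr_gt0 ?ltr_wpDl// mulr_gt0.
move=> m u v uvb tI sl.
rewrite (_ : \sum_(i < m) _ = \sum_(k < m) (lim_pot (v k) - lim_pot (u k)))%R; last first.
  apply: eq_bigr => k _; rewrite ger0_norm// subr_ge0 lim_pot_nd//.
  by have [] := uvb k (ltn_ord k).
set S := (\sum_(k < m) (v k - u k))%R in sl.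
have S0 : (0 <= S)%R.
  by rewrite sumr_ge0// => k _; rewrite subr_ge0; have [] := uvb k (ltn_ord k).
have cv l : (\sum_(k < l) (fine (F j (v k)) - fine (F j (u k))))%R @[j --> \oo] -->
    (\sum_(k < l) (lim_pot (v k) - lim_pot (u k)))%R.
  elim: l => [|l ih].
    rewrite big_ord0; apply: cvg_near_cst; apply: nearW => j.
    by rewrite big_ord0.
  rewrite big_ord_recr/=; under eq_fun do rewrite big_ord_recr/=.
  by apply: cvgD => //; apply: cvgB; exact: lim_pot_cvg_fine.
rewrite -(cvg_lim (@Rhausdorff R) (cv m)).
have B : ((q i)^-1 + (K * S + e / (4 * Cb)) * (kap^-1 * expR (X * b) / q i) <= e * (3/4))%R.
  have h1 : ((q i)^-1 <= e / 4)%R.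
    rewrite -[leRHS]invrK lef_pV2 ?posrE// ?invr_gt0 ?divr_gt0// invf_div.
    by rewrite (le_trans _ qi)// lerDl.
  have h2 : ((q i)^-1 <= 1)%R by rewrite invf_le1.
  have KS : (K * S * Cb <= e / 4)%R.
    have p0 : (0 < 4 * Cb * (K + 1))%R by rewrite mulr_gt0 ?ltr_wpDl// mulr_gt0.
    have : (S * (4 * Cb * (K + 1)) <= e)%R by rewrite -ler_pdivlMr//; exact: ltW.
    move=> h; have : (0 <= S * Cb)%R by rewrite mulr_ge0// ltW.
    by move: h; lra.
  have E : (e / (4 * Cb) * Cb = e / 4)%R by field; rewrite gt_eqF.
  rewrite -/Cb mulrA mulrDl E.
  have : ((K * S * Cb + e / 4) / q i <= (K * S * Cb + e / 4))%R.
    have z0 : (0 <= K * S * Cb)%R by apply: mulr_ge0; [exact: mulr_ge0|exact: ltW].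
    by rewrite ler_piMr// addr_ge0// divr_ge0// ltW.
  by move: h1 KS => /=; lra.
apply: (@le_lt_trans _ _ (e * (3/4))%R); last by lra.
apply: limr_le; first by apply: cvgP; exact: (cv m).
exists i => // j /= ij; apply: le_trans B.
apply: (sum_increments_le ij K0 _ hr re wKr uvb tI).
by rewrite divr_ge0 ?(ltW e0)// mulr_ge0// ltW.
Qed.

(** * Convergence of the tail identity *)

Lemma trunc_tail_le_chi j y : trunc_tail n (a j) y <= (c j)%:E * chi y.
Proof.
have [nw _ _] := weight_restr_density hn (measurable_itv `]a j, +oo[).
rewrite -(trunc_tailE hn)// leeDl//.
by apply (nnm_convol nw nnm_chi).2.
Qed.

Lemma trunc_tail_le_expf j y : trunc_tail n (a j) y <= (c j * expR (X * y))%:E.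
Proof.
apply: (le_trans (trunc_tail_le_chi j y)).
rewrite EFinM; apply: lee_wpmul2l; first by rewrite lee_fin c_ge0.
by rewrite -[expR _]mul1r; apply: chi_le_expf; exact: ltW.
Qed.

(** A Chernoff bound: multiplied by [q i], the band potential has total mass 1, and the left side is
    its mass beyond [t]. For [y <= t], [exp (X * (y - t))] is at most [(1 - ep) * chi y + ep]; the
    band potential of the left side is explicit, and [f] bounds the exponent of every band. *)
Lemma pot_band_chi_lower i j t : (i <= j)%N -> (0 < t)%R ->
  (1 - q i * fine (pot (w_ i j) (q j) chi t) <=
   density_exponent n X / (1 - expR (- (X * t))) / q i)%R.
Proof.
move=> ij t0; set f := density_exponent n X; set v := fine _.
set ep := expR (- (X * t)).
have qj := q_gt0 j; have qi := q_gt0 i.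
have hw_ : weight (w_ i j) by exact: weight_restr_density.
have nchi : nnm (chi : R -> \bar R) by exact: nnm_chi.
have ep0 : (0 < ep)%R by exact: expR_gt0.
have ep1 : (ep < 1)%R by rewrite /ep -expR0 ltr_expR oppr_lt0 mulr_gt0.
have vfin : pot (w_ i j) (q j) chi t \is a fin_num.
  by apply: (pot_band_fin ij nchi ler01) => y _; apply: chi_le_expf; exact: ltW.
have fE : (c j - c i - phi_ i j X <= f)%R.
  have := laplace_restr_diff_le hn (measurable_itv _) (mass_band_fin ij) (ltW X_gt0).
  by rewrite mass_band.
have phile := le_q_band ij.
have f0 : (0 <= f)%R by apply: le_trans fE; move: phile => /=; lra.
have h1 : pot (w_ i j) (q j) (fun y => ep%:E * expf X y) t <=
    pot (w_ i j) (q j) (fun y => (1 - ep)%:E * chi y + ep%:E * cst 1 y) t.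
  apply: le_pot => //.
  - by apply: nnmZ; [rewrite lee_fin ltW|exact: nnm_expf].
  - apply: nnmD; first by apply: nnmZ => //; rewrite lee_fin subr_ge0 ltW.
    by apply: nnmZ; [rewrite lee_fin ltW|exact: nnm_cst].
  move=> y yt; rewrite chiE /expf /= mule1 -!EFinM -EFinD lee_fin.
  have [y0|y0] := leP 0%R y.
    rewrite mulr1 subrK /ep -expRD -expR0 ler_expR -mulrN -mulrDr.
    by apply: mulr_ge0_le0; [exact: ltW|lra].
  rewrite mulr0 add0r ler_piMr ?(ltW ep0)// -expR0 ler_expR.
  by apply: mulr_ge0_le0; exact: ltW.
move: h1; rewrite potZ ?(ltW ep0)//; last exact: nnm_expf.
rewrite potD//; last 2 first.
- by apply: nnmZ => //; rewrite lee_fin subr_ge0 ltW.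
- by apply: nnmZ; [rewrite lee_fin ltW|exact: nnm_cst].
have n1 : nnm (cst 1 : R -> \bar R) by exact: nnm_cst.
have ep2 : (0 <= 1 - ep)%R by rewrite subr_ge0 ltW.
rewrite (potZ t qj ep2 hw_ nchi) (potZ t qj (ltW ep0) hw_ n1).
rewrite pot_band_one// (pot_expf t hw_ (laplace_bandE ij (ltW X_gt0))); last 2 first.
- exact: (laplace_restr_ge0 hn (measurable_itv _)).
- by move: phile qi => /=; lra.
rewrite -(fineK vfin) -/v -!EFinM -EFinD lee_fin mulrCA /ep -expRD addNr expR0 mulr1 -/ep.
move=> h2.
have qf : (0 < q i + f)%R by rewrite ltr_pwDl.
have h3 : ((q i + f)^-1 <= (q j - phi_ i j X)^-1)%R.
  rewrite lef_pV2 ?posrE//; last by rewrite (lt_le_trans qi).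
  by move: fE => /=; lra.
have h4 : (q i / (q i + f) <= (1 - ep) * (q i * v) + ep)%R.
  rewrite (_ : (1 - ep) * (q i * v) + ep = q i * ((1 - ep) * v + ep / q i))%R; last first.
    by field; rewrite gt_eqF.
  by rewrite ler_wpM2l ?(ltW qi)// (le_trans h3).
have h5 : (1 - f / q i <= q i / (q i + f))%R.
  rewrite -subr_ge0 (_ : _ - _ = f ^+ 2 / (q i * (q i + f)))%R.
    by rewrite divr_ge0 ?sqr_ge0//; apply: mulr_ge0; exact: ltW.
  by field; rewrite !gt_eqF.
rewrite mulrAC ler_pdivlMr ?subr_gt0//.
by move: h4 h5 => /=; lra.
Qed.

(** [B] depends on [t] alone. By [pot_tail_split], the potential of the tail cut at [a j] is
    [1 - q i * pot chi t] plus the potential of the tail cut at [a i]. The first is small by the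
    Chernoff bound at [t], the second by the same bound at [t / 2]. *)
Lemma pot_band_tail_le t : (0 < t)%R -> exists2 B : R, (0 <= B)%R &
  forall i j, (i <= j)%N -> (1 <= q i)%R ->
  pot (w_ i j) (q j) (trunc_tail n (a j)) t <= (B / q i)%:E.
Proof.
move=> t0; set f := density_exponent n X.
pose D s := (1 - expR (- (X * s)))%R.
have D0 s : (0 < s)%R -> (0 < D s)%R.
  by move=> s0; rewrite subr_gt0 -expR0 ltr_expR oppr_lt0 mulr_gt0.
have t20 : (0 < t / 2)%R by rewrite divr_gt0.
have f0 : (0 <= f)%R.
  have := laplace_restr_diff_le hn (measurable_itv _) (mass_tail_fin 0) (ltW X_gt0).
  apply: le_trans; rewrite subr_ge0.
  exact: (laplace_restr_le hn (measurable_itv _) (mass_tail_fin 0) (ltW X_gt0)).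
pose Th := fine (Tn (t / 2)%R).
have Th0 : (0 <= Th)%R by rewrite fine_ge0// (density_tail_ge0 hn).
exists (f / D t + Th + (1 + `|eta|) * (f / D (t / 2)))%R.
  have fD z : (0 < z)%R -> (0 <= f / D z)%R by move=> z0; rewrite divr_ge0// ltW// D0.
  rewrite addr_ge0 ?addr_ge0 ?fD//; apply: mulr_ge0; last exact: fD.
  by rewrite addr_ge0.
move=> i j ij qi1; have qj := q_gt0 j; have qi := q_gt0 i.
have hw_ : weight (w_ i j) by exact: weight_restr_density.
have hwi : weight (w i) by exact: weight_restr_density.
have nchi : nnm (chi : R -> \bar R) by exact: nnm_chi.
have nk k : nnm (trunc_tail n (a k)) by exact: nnm_trunc_tail.
have Vk k : pot (w_ i j) (q j) (trunc_tail n (a k)) t \is a fin_num.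
  by apply: (pot_band_fin ij (nk k) (c_ge0 k)) => y _; exact: trunc_tail_le_expf.
have Vc s : pot (w_ i j) (q j) chi s \is a fin_num.
  by apply: (pot_band_fin ij nchi ler01) => y _; apply: chi_le_expf; exact: ltW.
have E := @pot_tail_split R (w_ i j) (w i) (q j) (c j) (c i) _ _ chi t qj
  (c_ge0 j) (c_ge0 i) hw_ hwi nchi (nk j) (nk i).
have {}E := E _ (fun y => trunc_tailE hn y (a_gt0 i)).
have {}E : pot (w_ i j) (q j) (trunc_tail n (a j)) t +
    (q j)%:E * pot (w_ i j) (q j) chi t + (c i)%:E * pot (w_ i j) (q j) chi t =
    chi t + (c j)%:E * pot (w_ i j) (q j) chi t +
    pot (w_ i j) (q j) (trunc_tail n (a i)) t.
  apply: E => y; rewrite -(trunc_tailE hn)//.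
  by rewrite -(restr_density_split n (a_ni ij)).
(* Pointwise, the tail cut at [a i] plus [c i * chi (y - t / 2)] never exceeds [Th + c i]: before
   [t / 2] the tail is at most [c i], afterwards at most [Th]. *)
have U : pot (w_ i j) (q j) (trunc_tail n (a i)) t +
    (c i)%:E * pot (w_ i j) (q j) chi (t / 2)%R <= ((Th + c i) * (q i)^-1)%:E.
  have ci0 := c_ge0 i; have thc0 : (0 <= Th + c i)%R by exact: addr_ge0.
  have nsh : nnm (fun y => chi (y - t / 2)%R : \bar R) by exact: (nnm_shift (t / 2)%R nchi).
  have cie : 0 <= (c i)%:E by rewrite lee_fin.
  have thce : 0 <= (Th + c i)%:E by rewrite lee_fin.
  have ncsh := nnmZ cie nsh; have nsum := nnmD (nk i) ncsh.
  have n1 : nnm (cst 1 : R -> \bar R) by exact: nnm_cst.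
  have nct := nnmZ thce n1.
  have -> : pot (w_ i j) (q j) chi (t / 2)%R =
      pot (w_ i j) (q j) (fun y => chi (y - t / 2)%R) t.
    by rewrite pot_shift; congr pot; field.
  rewrite -(potZ t qj ci0 hw_ nsh) -(potD t qj hw_ (nk i) ncsh).
  rewrite EFinM -(pot_band_one t ij) -(potZ t qj thc0 hw_ n1).
  apply: (le_pot qj hw_ nsum nct).
  move=> y _; rewrite /= mule1 EFinD (chiE (y - _)) subr_ge0.
  have [ty|yt] := leP (t / 2)%R y.
    rewrite mule1 leeD// /trunc_tail chiE (le_trans (ltW t20) ty) mul1e.
    rewrite fineK ?(density_tail_fin hn)//; apply: (density_tail_ni hn).
    by rewrite le_max ty.
  rewrite mule0 adde0 (le_trans (trunc_tail_le_chi i y))//.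
  rewrite (@le_trans _ _ (c i)%:E)//; last by rewrite leeDr// lee_fin.
  by rewrite chiE -EFinM lee_fin ler_piMr ?c_ge0// lern1 leq_b1.
have L1 := pot_band_chi_lower ij t0; have L2 := pot_band_chi_lower ij t20.
move: E U; rewrite -(fineK (Vk i)) -(fineK (Vk j)) -(fineK (Vc t)) -(fineK (Vc (t / 2)%R)).
move: L1 L2; rewrite -/f -/(D t) -/(D (t / 2)%R).
move: (fine (pot _ _ (trunc_tail n (a j)) t)) => kj.
move: (fine (pot _ _ (trunc_tail n (a i)) t)) => ki.
move: (fine (pot _ _ chi t)) (fine (pot _ _ chi (t / 2)%R)) => v1 v2 L1 L2.
rewrite chiE (ltW t0) -!EFinM -!EFinD lee_fin => -[E] U; rewrite lee_fin.
have kjE : kj = (1 - q i * v1 + ki)%R by move: E => /=; lra.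
have c0 := c_ge0 i.
have cq : (c i <= (1 + `|eta|) * q i)%R.
  have e1 : (- eta <= `|eta|)%R by rewrite lerNl; exact: lerNnormlW.
  have e2 : (`|eta| <= `|eta| * q i)%R by rewrite ler_peMr.
  by rewrite mulrDl mul1r; move: e1 e2 => /=; lra.
have U2 : (ki <= Th / q i + c i / q i * (1 - q i * v2))%R.
  rewrite (_ : _ + _ = (Th + c i) / q i - c i * v2)%R; last by field; rewrite gt_eqF.
  by move: U => /=; lra.
have cq1 : (c i / q i <= 1 + `|eta|)%R by rewrite ler_pdivrMr.
have U3 : (c i / q i * (1 - q i * v2) <= (1 + `|eta|) * (f / D (t / 2) / q i))%R.
  apply: (@le_trans _ _ (c i / q i * (f / D (t / 2) / q i))%R).
    by rewrite ler_wpM2l// divr_ge0// ltW.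
  by rewrite ler_wpM2r// divr_ge0 ?divr_ge0 ?(ltW (D0 _ _))// ltW.
rewrite kjE !mulrDl -mulrA.
by move: L1 U2 U3 => /=; lra.
Qed.

(** Tonelli: the integral of the tail over [[0, a l[] counts each jump [r] for a time [min r (a l)].
    The bound does not involve [j]. *)
Lemma near_tail_mass j l :
  \int[mu]_s near_tail n (a j) (a l) s <= \int[mu]_r (n r * Num.min r (a l))%:E.
Proof.
have [mn n0 nz _] := hn.
pose G (z : R * R) : \bar R :=
  (\1_(`[0%R, a l[%classic : set R) z.1)%:E * (n z.2 * (z.1 < z.2)%R%:R)%:E.
have mG : measurable_fun setT G.
  apply: emeasurable_funM.
    by apply/measurable_EFinP; apply: (measurableT_comp (measurable_indic _)).
  apply/measurable_EFinP; apply: measurable_funM.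
    exact: (measurableT_comp mn measurable_snd).
  rewrite (_ : (fun _ => _) = (fun b : bool => b%:R : R) \o
    (fun z : R * R => (z.1 < z.2)%R))//.
  apply: measurableT_comp => //.
  by apply: measurable_fun_ltr; [exact: measurable_fst|exact: measurable_snd].
have G0 z : 0 <= G z by rewrite mule_ge0// lee_fin// mulr_ge0.
have T1 s : \int[mu]_r G (s, r) = (\1_(`[0%R, a l[%classic : set R) s)%:E * Tn s.
  rewrite /G /density_tail -ge0_integralZl//.
  - apply: eq_integral => r _; rewrite /restr_density; congr (_ * (_ * _)%:E).
    by rewrite indicE mem_setE in_itv/= andbT.
  - by apply (nnm_restr_density hn (measurable_itv _)).1.
  - by move=> r _; apply (nnm_restr_density hn (measurable_itv _)).2.
have T2 r : \int[mu]_s G (s, r) = (n r * Num.min r (a l))%:E.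
  have [r0|r0] := leP r 0%R.
    rewrite nz// mul0r; apply: integral0_eq => s _.
    by rewrite /G nz// mul0r mule0.
  have m0 : (0 < Num.min r (a l))%R by rewrite lt_min r0 a_gt0.
  have -> : \int[mu]_s G (s, r) = \int[mu]_s ((n r)%:E *
      (\1_(`[0%R, Num.min r (a l)[%classic : set R) s)%:E).
    apply: eq_integral => s _; rewrite /G /= !indicE !mem_setE !in_itv/= -!EFinM lt_min.
    congr EFin; rewrite mulrCA; congr (_ * _)%R; rewrite -natrM mulnb.
    by congr (nat_of_bool _)%:R; rewrite -andbA (andbC (s < r)%R).
  rewrite ge0_integralZl//; last 2 first.
  - by apply/measurable_EFinP; exact: measurable_indic.
  - by rewrite lee_fin.
  by rewrite integral_indic//= setIT lebesgue_measure_itv/= lte_fin m0 sube0 EFinM.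
have -> : \int[mu]_r (n r * Num.min r (a l))%:E = \int[mu]_r \int[mu]_s G (s, r).
  by apply: eq_integral => r _; rewrite T2.
rewrite -(fubini_tonelli (m1 := mu) (m2 := mu) G)//.
have -> : \int[mu]_s \int[mu]_r G (s, r) =
    \int[mu]_s ((\1_(`[0%R, a l[%classic : set R) s)%:E * Tn s).
  by apply: eq_integral => s _; rewrite T1.
apply: ge0_le_integral => //.
- by move=> s _; apply (nnm_near_tail hn _ _).2.
- exact: (nnm_near_tail hn _ _).1.
- apply: emeasurable_funM; last exact: (nnm_density_tail hn).1.
  by apply/measurable_EFinP; exact: measurable_indic.
move=> s _; rewrite /near_tail lee_wpmul2l ?lee_fin//.
by apply: (density_tail_ni hn); rewrite le_max lexx.
Qed.

Lemma cvg_small_jumps : (forall j, a j <= 1)%R ->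
  \int[mu]_r (n r * Num.min r (a l))%:E @[l --> \oo] --> 0.
Proof.
move=> a1; have [mn n0 nz nl] := hn.
have g0 r l : (0 <= n r * Num.min r (a l))%R.
  have [r0|r0] := leP r 0%R; first by rewrite nz// mul0r.
  by rewrite mulr_ge0// le_min !ltW.
have mg l : measurable_fun setT (fun r => (n r * Num.min r (a l))%:E).
  apply/measurable_EFinP; apply: measurable_funM => //.
  exact: measurable_minr.
have h := @dominated_convergence _ _ _ mu setT measurableT
  (fun l r => (n r * Num.min r (a l))%:E) (cst 0)
  (fun r => (n r * Num.min r 1)%:E) mg (measurable_cst _).
have h1 : {ae mu, forall r, [set: R] r ->
    (n r * Num.min r (a l))%:E @[l --> \oo] --> (0 : \bar R)}.
  apply: aeW => r _; have [r0|r0] := leP r 0%R.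
    by apply: cvg_near_cst; apply: nearW => l; rewrite nz// mul0r.
  apply: cvg_EFin; first exact: nearW.
  apply: (@squeeze_cvgr _ _ _ _ (cst 0%R) (fun l => n r * a l)%R); last 2 first.
  - exact: cvg_cst.
  - by rewrite -(mulr0 (n r)); apply: cvgM => //; exact: cvg_cst.
  by apply: nearW => l; rewrite g0/= ler_wpM2l// ge_min lexx orbT.
have h2 : mu.-integrable setT (fun r => (n r * Num.min r 1)%:E).
  apply/integrableP; split; first exact: (measurable_nmin hn).
  by under eq_integral do rewrite gee0_abs ?lee_fin ?(min_ge0 hn)//.
have h3 : {ae mu, forall r l, [set: R] r ->
    `|(n r * Num.min r (a l))%:E| <= (n r * Num.min r 1)%:E}.
  apply: aeW => r l _; rewrite gee0_abs ?lee_fin ?g0// ler_wpM2l//.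
  by rewrite le_min ge_min lexx/= ge_min a1 orbT.
have [_ _] := h h1 h2 h3.
by rewrite integral0.
Qed.

Lemma pot_trunc_tail j t :
  pot (w j) (q j) (trunc_tail n (a j)) t + (q j)%:E * F j t = chi t + (c j)%:E * F j t.
Proof.
exact: (pot_tail t (q_gt0 j) (c_ge0 j) (weight_restr_density hn (measurable_itv _))
  nnm_chi (nnm_trunc_tail hn _) (fun y => trunc_tailE hn y (a_gt0 j))).
Qed.

Lemma pot_trunc_tail_fin j t : pot (w j) (q j) (trunc_tail n (a j)) t \is a fin_num.
Proof.
have := pot_trunc_tail j t; rewrite -(fineK (approx_pot_fin j t)) chiE -!EFinM -!EFinD.
have : 0 <= pot (w j) (q j) (trunc_tail n (a j)) t.
  apply: pot_ge0; [exact: q_gt0|exact: weight_restr_density|exact: nnm_trunc_tail].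
by case: (pot _ _ _ _).
Qed.

(** The Caputo identity before the limit: [pot (w j) (q j)] plays the role of convolution with the
    measure of distribution function [F j]. *)
Lemma pot_trunc_tailE j t : pot (w j) (q j) (trunc_tail n (a j)) t =
  ((0 <= t)%R%:R - eta * fine (F j t))%:E.
Proof.
have := pot_trunc_tail j t.
rewrite -(fineK (approx_pot_fin j t)) -(fineK (pot_trunc_tail_fin j t)) chiE.
rewrite -!EFinM -!EFinD => -[] h; congr EFin => /=.
by move: h => /=; lra.
Qed.

Lemma pot_trunc_tail_le j t : pot (w j) (q j) (trunc_tail n (a j)) t <=
  ((1 + `|eta| / kap) * expR (X * t))%:E.
Proof.
rewrite pot_trunc_tailE lee_fin mulrDl lerD//.
  by have := @chi_le_expf R X t (ltW X_gt0); rewrite chiE lee_fin.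
have F0 : (0 <= fine (F j t))%R by rewrite fine_ge0// (nnm_approx_pot j).2.
apply: (@le_trans _ _ (`|eta| * fine (F j t))%R).
  by rewrite -mulNr ler_wpM2r// -normrN ler_norm.
by rewrite -mulrA ler_wpM2l// -lee_fin fineK ?approx_pot_fin// approx_pot_le.
Qed.

(** No mass escapes to the origin, uniformly in [j]. One third of [e] pays for the paths with band
    jumps only. If a larger jump occurs, the bounded part of its density meets a near tail of small
    integral, and the remaining part has small mass and meets a potential bounded through
    [pot_trunc_tail_le]. *)
Lemma pot_near_tail_small t (e : R) : (forall j, a j <= 1)%R -> (0 < t)%R -> (0 < e)%R ->
  exists l0, forall l j, (l0 <= l)%N -> (l <= j)%N ->
  pot (w j) (q j) (near_tail n (a j) (a l)) t <= e%:E.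
Proof.
move=> a1 t0 e0; have [B B0 hB] := pot_band_tail_le t0.
pose C1 := ((1 + `|eta| / kap) * expR (X * t))%R.
pose C2 := (kap^-1 * expR (X * t))%R.
have C10 : (0 < C1)%R.
  by rewrite mulr_gt0 ?expR_gt0// ltr_pwDl// divr_ge0// ltW.
have C20 : (0 < C2)%R by rewrite mulr_gt0 ?expR_gt0 ?invr_gt0.
have [i _ /(_ i (leqnn i)) /= qiB] : \forall i \near \oo, (3 * B / e + 1 <= q i)%R.
  by have /cvgryPge := cvg_q; apply.
have qi1 : (1 <= q i)%R.
  by rewrite (le_trans _ qiB)// lerDr divr_ge0 ?mulr_ge0// ltW.
have qi := q_gt0 i.
have [K [r [K0 hr re wKr]]] := density_split_large i (e := e / (3 * C1))%R
  (divr_gt0 e0 (mulr_gt0 (ltr0n _ 3) C10)).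
have d0 : (0 < e / (3 * C2 * (K + 1)))%R.
  by rewrite divr_gt0// mulr_gt0 ?ltr_wpDl// mulr_gt0.
have [l1 _ hl1] : \forall l \near \oo,
    \int[mu]_r (n r * Num.min r (a l))%:E < (e / (3 * C2 * (K + 1)))%:E.
  exact: cvge0_lt (cvg_small_jumps a1) d0.
exists (maxn i l1) => l j; rewrite geq_max => /andP[il ll1] lj.
have ij : (i <= j)%N by exact: leq_trans lj.
have qj := q_gt0 j.
have hw_ : weight (w_ i j) by exact: weight_restr_density.
have hwi : weight (w i) by exact: weight_restr_density.
have hwj : weight (w j) by exact: weight_restr_density.
have [nwi _ _] := hwi; have [nr fr rz] := hr.
set h := near_tail n (a j) (a l).
have nh : nnm h by exact: nnm_near_tail.
have nk : nnm (trunc_tail n (a j)) by exact: nnm_trunc_tail.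
have hk y : h y <= trunc_tail n (a j) y.
  rewrite (trunc_tail_split n y (a_ni lj))// leeDl//.
  exact: (nnm_far_tail hn _).2.
have hX y : h y <= (c j * expR (X * y))%:E.
  exact: le_trans (hk y) (trunc_tail_le_expf j y).
have nchi : nnm (chi : R -> \bar R) by exact: nnm_chi.
rewrite (pot_decomp t ij nh (c_ge0 j) hX).
rewrite (_ : e = e / 3 + (e / 3 + e / 3))%R; last by field.
rewrite EFinD leeD//.
  apply: (@le_trans _ _ (pot (w_ i j) (q j) (trunc_tail n (a j)) t)).
    exact: le_pot.
  apply: (le_trans (hB i j ij qi1)); rewrite lee_fin ler_pdivrMr//.
  have : (3 * B / e <= q i)%R by rewrite (le_trans _ qiB)// lerDl.
  by rewrite ler_pdivrMr//; lra.
rewrite convol_tail_pots//.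
pose g1 y := convol (fun s => K%:E * chi s) h y; pose g2 y := convol r h y.
have nKchi : nnm (fun s => K%:E * chi s : \bar R) by apply: nnmZ.
have n1 : nnm g1 by exact: nnm_convol.
have n2 : nnm g2 by exact: nnm_convol.
have nU g : nnm g -> nnm (pot (w j) (q j) g) by move=> ?; exact: nnm_pot.
rewrite (@le_trans _ _ (pot (w_ i j) (q j) (pot (w j) (q j) (fun y => g1 y + g2 y)) t))//.
  apply: le_pot => //; [by apply: nU; exact: nnm_convol|by apply: nU; exact: nnmD|].
  move=> y _; apply: le_pot => //; [exact: nnm_convol|exact: nnmD|].
  move=> z _; rewrite -convolDl//; apply: le_convoll => //.
  exact: nnmD.
rewrite (_ : pot (w j) (q j) (fun y => g1 y + g2 y) =
    fun y => pot (w j) (q j) g1 y + pot (w j) (q j) g2 y); last first.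
  by apply/funext => y; rewrite potD.
rewrite potD//; [|exact: nU|exact: nU].
rewrite EFinD leeD//.
- set d := (e / (3 * C2 * (K + 1)))%R in d0 hl1.
  have Kd0 : (0 <= K * d)%R by rewrite mulr_ge0// ltW.
  have Kde : 0 <= (K * d)%:E by rewrite lee_fin.
  have g1d y : g1 y <= (K * d)%:E * chi y.
    have [y0|y0] := ltP y 0%R.
      rewrite /g1 convol.unlock integral0_eq ?mule_ge0 ?nchi.2//.
      move=> s _; rewrite chiE; have [s0|s0] := leP 0%R s; last by rewrite mule0 mul0e.
      rewrite /h /near_tail indicE memNset ?mul0e ?mule0//= in_itv/=.
      by move=> /andP[ys _]; move: s0 y0 ys; lra.
    rewrite chiE y0 mule1 EFinM /g1.
    rewrite (@le_trans _ _ (K%:E * \int[mu]_s h (y - s)%R))//.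
      rewrite -ge0_integralZl//; last 2 first.
      - by apply (nnm_refl y nh).1.
      - by move=> s _; exact: nh.2.
      rewrite convol.unlock; apply: ge0_le_integral => //.
      - by move=> s _; rewrite mule_ge0 ?nh.2 ?nKchi.2.
      - by apply (convol_nnm y nKchi nh).1.
      - by apply: measurable_funeM; apply (nnm_refl y nh).1.
      move=> s _; rewrite lee_wpmul2r ?nh.2// chiE -EFinM lee_fin.
      by rewrite ler_piMr// lern1 leq_b1.
    rewrite lee_wpmul2l// integral_refl// (le_trans (near_tail_mass j l))//.
    by apply/ltW/hl1.
  rewrite (@le_trans _ _ ((K * d)%:E *
      pot (w_ i j) (q j) (F j) t))//.
    rewrite -(potZ t qj Kd0 hw_ (nnm_approx_pot j)).
    apply: le_pot => //; [exact: nU|exact: (nnmZ Kde (nnm_approx_pot j))|].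
    move=> y _; rewrite -(potZ y qj Kd0 hwj nchi).
    exact: (le_pot qj hwj n1 (nnmZ Kde nchi)).
  have V1 := le_pot_band (C := kap^-1) (t := t) ij (nnm_approx_pot j).
  rewrite (@le_trans _ _ ((K * d) * (kap^-1 / q i * expR (X * t)))%:E)//.
    rewrite [leRHS]EFinM; apply: lee_wpmul2l => //.
    by apply: V1; [rewrite invr_ge0 ltW|move=> y _; exact: approx_pot_le].
  rewrite lee_fin.
  have -> : (kap^-1 / q i * expR (X * t) = C2 / q i)%R by rewrite /C2 mulrAC.
  have h1 : (C2 / q i <= C2)%R by rewrite ler_pdivrMr// ler_peMr// ltW.
  apply: (@le_trans _ _ (K * d * C2)%R); first by rewrite ler_wpM2l.
  have E : (d * C2 * (K + 1) = e / 3)%R.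
    by rewrite /d; field; rewrite !gt_eqF//= ltr_wpDl.
  rewrite -E (_ : K * d * C2 = d * C2 * K)%R; last by ring.
  by rewrite ler_wpM2l ?lerDl//; apply: mulr_ge0; exact: ltW.
- have -> : pot (w_ i j) (q j) (pot (w j) (q j) g2) t =
      convol r (pot (w_ i j) (q j) (pot (w j) (q j) h)) t.
    rewrite [in RHS]convol_pot//; last exact: nU.
    by congr pot; apply/funext => y; rewrite convol_pot.
  have r0 : 0 <= \int[mu]_s (r s * expf (- X) s).
    by apply: integral_ge0 => s _; rewrite mule_ge0 ?nr.2// lee_fin expR_ge0.
  have rX : \int[mu]_s (r s * expf (- X) s) <= (e / (3 * C1))%:E.
    rewrite (le_trans _ re)//; apply: ge0_le_integral => //.
    - by move=> s _; rewrite mule_ge0 ?nr.2// lee_fin expR_ge0.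
    - by apply (nnmM nr (nnm_expf _)).1.
    - exact: nr.1.
    move=> s _; have [s0|s0] := ltP s 0%R; first by rewrite rz// mul0e.
    rewrite -[leRHS]mule1 lee_wpmul2l ?nr.2// lee_fin -expR0 ler_expR mulNr oppr_le0.
    by rewrite mulr_ge0// ltW.
  have rfin : \int[mu]_s (r s * expf (- X) s) \is a fin_num.
    by rewrite ge0_fin_numE// (le_lt_trans rX)// ltry.
  have nVU : nnm (pot (w_ i j) (q j) (pot (w j) (q j) h)).
    by apply: nnm_pot => //; exact: nU.
  have [D1 D1E] : exists D1, D1 = (1 + `|eta| / kap)%R by eexists.
  have D10 : (0 <= D1)%R by rewrite D1E addr_ge0// divr_ge0// ltW.
  have b1 y : pot (w_ i j) (q j) (pot (w j) (q j) h) y <= (D1 * expR (X * y))%:E.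
    apply: (@le_trans _ _ (D1 / q i * expR (X * y))%:E).
      apply: le_pot_band => //; first exact: nU.
      move=> z _; rewrite D1E; apply: le_trans (pot_trunc_tail_le j z).
      by apply: le_pot.
    by rewrite lee_fin ler_wpM2r ?expR_ge0// ler_pdivrMr// ler_peMr.
  have := le_convol_expf t hr nVU D10 (esym (fineK rfin)) b1.
  move=> /le_trans; apply; rewrite lee_fin.
  have rX' : (fine (\int[mu]_s (r s * expf (- X) s)) <= e / (3 * C1))%R.
    by rewrite -lee_fin fineK.
  have E : (e / (3 * C1) * C1 = e / 3)%R by field; rewrite gt_eqF.
  rewrite -mulrA (_ : D1 * expR (X * t) = C1)%R; last by rewrite /C1 -D1E.
  by rewrite -E ler_wpM2r// ltW.
Qed.

Lemma convol_approx_fin l j t : convol (w l) (F j) t \is a fin_num.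
Proof.
have hw : weight (w l) by exact: weight_restr_density.
have nF := nnm_approx_pot j; have [nw _ _] := hw.
rewrite ge0_fin_numE; last exact: (nnm_convol nw nF).2.
apply: le_lt_trans (ltry _).
apply: (le_convol_expf (C := kap^-1) t hw nF _ (laplace_tailE l (ltW X_gt0))).
  by rewrite invr_ge0 ltW.
by move=> y; exact: approx_pot_le.
Qed.

Lemma cvg_convol_approx l t : convol (w l) (F j) t @[j --> \oo] -->
  convol (w l) (fun s => (lim_pot s)%:E) t.
Proof.
have hw : weight (w l) by exact: weight_restr_density.
have [nw fw _] := hw; rewrite convol.unlock.
have nF j := convol_nnm t nw (nnm_approx_pot j).
have h := @dominated_convergence _ _ _ mu setT measurableT
  (fun j s => w l s * F j (t - s)%R) (fun s => w l s * (lim_pot (t - s))%:E)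
  (fun s => w l s * F 0%N (t - s)%R) (fun j => (nF j).1)
  (convol_nnm t nw nnm_lim_pot).1.
have h1 : {ae mu, forall s, [set: R] s -> w l s * F j (t - s)%R @[j --> \oo] -->
    w l s * (lim_pot (t - s))%:E}.
  by apply: aeW => s _; apply: cvgeZl => //; exact: lim_pot_cvg.
have h2 : mu.-integrable setT (fun s => w l s * F 0%N (t - s)%R).
  apply/integrableP; split; first exact: (nF 0%N).1.
  under eq_integral do rewrite gee0_abs ?(nF 0%N).2//.
  by have := convol_approx_fin l 0%N t; rewrite convol.unlock ltey_eq => ->.
have h3 : {ae mu, forall s j, [set: R] s ->
    `|w l s * F j (t - s)%R| <= w l s * F 0%N (t - s)%R}.
  apply: aeW => s j _; rewrite gee0_abs ?(nF j).2// lee_wpmul2l ?nw.2//.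
  exact: approx_pot_ni.
by have [_ _] := h h1 h2 h3.
Qed.

Lemma convol_lim_pot_fin l t : convol (w l) (fun s => (lim_pot s)%:E) t \is a fin_num.
Proof.
have hw : weight (w l) by exact: weight_restr_density.
have [nw _ wz] := hw.
rewrite ge0_fin_numE; last exact: (nnm_convol nw nnm_lim_pot).2.
apply: (@le_lt_trans _ _ (convol (w l) (F 0%N) t)).
  have nF := nnm_approx_pot 0%N; have nL := nnm_lim_pot.
  by apply: le_convol => // y _; exact: lim_pot_le_approx.
by rewrite ltey_eq convol_approx_fin.
Qed.

(** What the tail identity leaves for the near part once the far part is computed: by [far_tailE],
    the potential of the far tail is [c l] times a shift of [F j] minus its convolution with
    [w l]. *)
Lemma near_tail_balance l j t : (l <= j)%N -> (0 < t)%R ->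
  pot (w j) (q j) (near_tail n (a j) (a l)) t =
  (1 - eta * fine (F j t) -
   (c l * fine (F j (t - a l)) - fine (convol (w l) (F j) t)))%:E.
Proof.
move=> lj t0; have qj := q_gt0 j.
have hwj : weight (w j) by exact: weight_restr_density.
have hwl : weight (w l) by exact: weight_restr_density.
have nh : nnm (near_tail n (a j) (a l)) by exact: nnm_near_tail.
have ng : nnm (far_tail n (a l)) by exact: nnm_far_tail.
have nchi : nnm (chi : R -> \bar R) by exact: nnm_chi.
have [nwl fwl _] := hwl.
have := pot_trunc_tailE j t; rewrite (ltW t0).
rewrite (_ : trunc_tail n (a j) =
    fun y => near_tail n (a j) (a l) y + far_tail n (a l) y); last first.
  by apply/funext => y; rewrite (trunc_tail_split n y (a_ni lj)).
rewrite potD// => E1.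
have E2 : pot (w j) (q j) (far_tail n (a l)) t + convol (w l) (F j) t =
    (c l)%:E * F j (t - a l)%R.
  rewrite convol_pot// -potD//; last exact: nnm_convol.
  rewrite /approx_pot -pot_shift -potZ ?c_ge0//; last exact: nnm_shift.
  by congr pot; apply/funext => y; rewrite (far_tailE hn).
have h0 := pot_ge0 t qj hwj nh; have g0 := pot_ge0 t qj hwj ng.
move: E1 E2 h0 g0; rewrite -(fineK (approx_pot_fin j (t - a l)%R)).
rewrite -(fineK (convol_approx_fin l j t)).
move: (pot (w j) (q j) (near_tail n (a j) (a l)) t) => [x| |]//;
  move: (pot (w j) (q j) (far_tail n (a l)) t) => [z| |]//.
rewrite -!EFinM -!EFinD => -[E1] [E2] _ _; congr EFin.
by move: E1 E2 => /=; lra.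
Qed.

(** For fixed [l] the right side of [near_tail_balance] converges as [j] grows, and it lies in
    [[0, e]] by nonnegativity and smallness of the near part. *)
Lemma lim_pot_balance t (e : R) : (forall j, a j <= 1)%R -> (0 < t)%R -> (0 < e)%R ->
  exists l0, forall l, (l0 <= l)%N ->
  (`|1 - eta * lim_pot t - (c l * lim_pot (t - a l) -
     fine (convol (w l) (fun s => (lim_pot s)%:E) t))| <= e)%R.
Proof.
move=> a1 t0 e0; have [l0 hl0] := pot_near_tail_small a1 t0 e0.
exists l0 => l l0l.
set z := (X in `|X|%R).
have cv : (1 - eta * fine (F j t) -
    (c l * fine (F j (t - a l)) - fine (convol (w l) (F j) t)))%R @[j --> \oo] --> z.
  apply: cvgB.
    apply: cvgB; first exact: cvg_cst.
    by apply: cvgM; [exact: cvg_cst|exact: lim_pot_cvg_fine].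
  apply: cvgB.
    by apply: cvgM; [exact: cvg_cst|exact: lim_pot_cvg_fine].
  apply: fine_cvg; rewrite fineK ?convol_lim_pot_fin//.
  exact: cvg_convol_approx.
rewrite -(cvg_lim (@Rhausdorff R) cv) ler_norml; apply/andP; split.
  apply: limr_ge; first by apply: cvgP; exact: cv.
  exists l => // j /= lj; apply: (@le_trans _ _ 0%R); first by rewrite oppr_le0 ltW.
  rewrite -lee_fin -near_tail_balance//.
  by apply: pot_ge0; [exact: q_gt0|exact: weight_restr_density|exact: nnm_near_tail].
apply: limr_le; first by apply: cvgP; exact: cv.
by exists l => // j /= lj; rewrite -lee_fin -near_tail_balance//; exact: hl0.
Qed.

(** * Density of the limit potential and its Caputo derivative *)

Lemma lim_pot_continuous : continuous lim_pot.
Proof. exact: abs_continuous_continuous lim_pot_ac lim_pot_le0. Qed.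

Lemma lim_pot_right_continuous : right_continuous lim_pot.
Proof. by move=> x; apply: cvg_at_right_filter; exact: lim_pot_continuous. Qed.

(** Radon-Nikodym for the Stieltjes measure of [lim_pot]; cutting at [b] makes that measure
    finite. *)
Lemma lim_pot_density (b : R) : (0 < b)%R -> exists u : R -> R,
  [/\ measurable_fun [set: R] u, forall s, (0 <= u s)%R,
    forall s, (s <= 0)%R -> u s = 0%R, mu.-integrable setT (EFin \o u) &
    forall y, (y < b)%R -> \int[mu]_s ((u s)%:E * (\1_(`]-oo, y]%classic : set R) s)%:E) =
      (lim_pot y)%:E].
Proof.
move=> b0.
pose Fc : cumulative R R := HB.pack lim_pot
  (isCumulative.Build R _ R lim_pot lim_pot_nd lim_pot_right_continuous).
pose m := lebesgue_stieltjes_measure Fc.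
have mE x y : (x <= y)%R -> m `]x, y]%classic = (lim_pot y - lim_pot x)%:E.
  exact: (lebesgue_stieltjes_measure_itvoc Fc).
pose D : set (measurableTypeR R) := `]0%R, b[%classic.
have mD : measurable D by exact: measurable_itv.
have finD : m D < +oo.
  apply: (@le_lt_trans _ _ (m `]0%R, b]%classic)); last by rewrite mE ?ltry// ltW.
  apply: le_measure; rewrite ?inE//.
  by apply: subset_itvl; rewrite bnd_simp.
have nullD A : measurable A -> A `<=` D -> mu A = 0 -> m A = 0.
  apply: (abs_continuous_null b0 _ (@lim_pot_ac b)) => x y _ xy _.
  by transitivity ((lim_pot y - lim_pot x)%:E); [exact: mE|rewrite ger0_norm// subr_ge0 lim_pot_nd].
have [u [mu_ u0 uD iu uE]] := density_on mD finD nullD.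
exists u; split => //.
  by move=> s s0; apply: uD; rewrite /D/= in_itv/= => /andP[]; rewrite ltNge s0.
move=> y yb.
rewrite -(uE _ (nnm_indic (measurable_itv _))).
have [y0|y0] := leP y 0%R.
  rewrite lim_pot_le0// integral0_eq// => s; rewrite /D/= in_itv/= => /andP[s0 _].
  rewrite indicE memNset//= in_itv/= => sy.
  by move: (lt_le_trans s0 sy); rewrite ltNge y0.
rewrite integral_indic//=.
have -> : `]-oo, y]%classic `&` D = `]0%R, y]%classic.
  apply/seteqP; split => s; rewrite /D/= !in_itv/=; first by move=> [-> /andP[->]].
  by move=> /andP[s0 sy]; rewrite sy s0/=; split => //; exact: le_lt_trans yb.
rewrite [LHS](lebesgue_stieltjes_measure_itvoc Fc (ltW y0)).
by rewrite [X in (_ - X)%:E](lim_pot_le0 (lexx 0%R)) subr0.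
Qed.

(** [u] convolved with [chi] is [lim_pot], and the far tail is [c l] times a shifted [chi] minus
    [w l] convolved with [chi]. The result is the quantity controlled by [lim_pot_balance]. *)
Lemma convol_density_far_tail (u : R -> R) (t : R) l :
  measurable_fun [set: R] u -> (forall s, (0 <= u s)%R) ->
  (forall y, (y <= t)%R -> \int[mu]_s ((u s)%:E * (\1_(`]-oo, y]%classic : set R) s)%:E) =
      (lim_pot y)%:E) ->
  convol (EFin \o u) (far_tail n (a l)) t =
  (c l * lim_pot (t - a l) - fine (convol (w l) (fun s => (lim_pot s)%:E) t))%:E.
Proof.
move=> mu_ u0 uF.
have nu : nnm (EFin \o u).
  by split => [|s]; [exact/measurable_EFinP|rewrite lee_fin].
have [nw _ wz] := weight_restr_density hn (measurable_itv `]a l, +oo[).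
have nchi : nnm (chi : R -> \bar R) by exact: nnm_chi.
have nf : nnm (far_tail n (a l)) by exact: nnm_far_tail.
have uchi y : (y <= t)%R -> convol (EFin \o u) chi y = (lim_pot y)%:E.
  move=> yt; rewrite convol.unlock -uF//; apply: eq_integral => s _.
  by rewrite chiE subr_ge0 indicE mem_setE in_itv.
have E : convol (EFin \o u) (far_tail n (a l)) t +
    convol (w l) (fun s => (lim_pot s)%:E) t = (c l * lim_pot (t - a l))%:E.
  have -> : convol (w l) (fun s => (lim_pot s)%:E) t =
      convol (w l) (convol (EFin \o u) chi) t.
    rewrite convol.unlock; apply: eq_integral => s _.
    have [s0|s0] := ltP s 0%R; first by rewrite wz// !mul0e.
    have := uchi (t - s)%R; rewrite gerBl// => /(_ s0).
    by rewrite convol.unlock => <-.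
  rewrite convolCA// -convolDr//; last exact: nnm_convol.
  rewrite (_ : (fun x => far_tail n (a l) x + convol (w l) chi x) =
      fun x => (c l)%:E * chi (x - a l)%R); last first.
    by apply/funext => x; rewrite (far_tailE hn).
  rewrite convolZr ?lee_fin ?c_ge0//; last exact: nnm_shift.
  by rewrite convol_shift uchi ?EFinM// gerBl ltW.
have h0 := (nnm_convol nu nf).2 t.
move: E h0; rewrite -(fineK (convol_lim_pot_fin l t)).
case: (convol (EFin \o u) _ t) => [x| |]//.
by rewrite -EFinD => -[] <- _; congr EFin; ring.
Qed.

(** With [u] the density of [lim_pot], the convolution of [u] with the far tails has two limits: its
    monotone limit is the convolution with the whole tail on []0, t[], and [lim_pot_balance] gives
    [W t]. Since [W' = - eta * u] almost everywhere, the equation follows. *)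
Theorem caputo_lim_pot (nu W : R -> R) t : (forall j, a j <= 1)%R -> (0 < t)%R ->
  (forall s, (0 < s)%R -> Tn s = (nu s)%:E) ->
  (forall y, (0 <= y)%R -> W y = 1 - eta * lim_pot y)%R ->
  caputo_djrbashian nu W t = (- eta * W t)%:E.
Proof.
move=> a1 t0 nuE WE.
(* Any bound beyond [t] serves: the density describes [lim_pot] strictly below the bound, and the
   value at [t] itself is needed. *)
have [u [mu_ u0 uz iu uF]] := lim_pot_density (ltr_pwDr ltr01 (ltW t0)).
have nu_ : nnm (EFin \o u).
  by split => [|s]; [exact/measurable_EFinP|rewrite lee_fin].
have ut1 y : (y < t + 1)%R -> \int[mu]_s ((u s)%:E * (\1_(`]-oo, y]%classic : set R) s)%:E) =
      (lim_pot y)%:E by exact: uF.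
have uFt y : (y <= t)%R -> \int[mu]_s ((u s)%:E * (\1_(`]-oo, y]%classic : set R) s)%:E) =
      (lim_pot y)%:E.
  by move=> yt; apply: ut1; rewrite (le_lt_trans yt)// ltrDl.
pose k s := Tn s * (\1_(`]0%R, t[%classic : set R) s)%:E.
have nk : nnm k.
  by apply: nnmM; [exact: nnm_density_tail|exact: (nnm_indic (measurable_itv _))].
have limk : convol (EFin \o u) k t = (W t)%:E.
  have cvk : convol (EFin \o u) (far_tail n (a l)) t @[l --> \oo] -->
      convol (EFin \o u) k t.
    rewrite convol.unlock.
    pose g l s := (EFin \o u) s * far_tail n (a l) (t - s)%R.
    rewrite (_ : \int[mu]_s _ = \int[mu]_s (limn (g^~ s))); last first.
      apply: eq_integral => s _; apply/esym/cvg_lim => //.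
      have [s0|s0] := leP s 0%R.
        apply: cvg_near_cst; apply: nearW => l.
        by rewrite /g /= uz// !mul0e.
      have [st|ts] := ltP s t; last first.
        apply: cvg_near_cst; apply: nearW => l; congr (_ * _).
        rewrite /far_tail /k chiE subr_ge0 leNgt (_ : (t - s < a l)%R) ?mul0e; last first.
          by rewrite (le_lt_trans _ (a_gt0 l))// subr_le0.
        by rewrite indicE memNset ?mule0//= in_itv/= subr_gt0 ltNge ts.
      apply: cvg_near_cst; near=> l; congr (_ * _).
      rewrite /far_tail /k chiE subr_ge0 indicE mem_set/=; last first.
        by rewrite in_itv/= subr_gt0 st gtrBl.
      rewrite mule1 (_ : (a l <= t - s)%R) ?mul1e// ltW//.
      by near: l; apply: (cvgr_lt _ a_0); rewrite subr_gt0.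
    apply: (@cvg_monotone_convergence _ _ _ mu setT measurableT g) => //.
    - by move=> l; apply (convol_nnm t nu_ (nnm_far_tail hn (a l))).1.
    - by move=> l s _; apply (convol_nnm t nu_ (nnm_far_tail hn (a l))).2.
    - move=> s _ i j ij; apply: lee_wpmul2l; first exact: nu_.2.
      rewrite /far_tail lee_wpmul2r ?(density_tail_ge0 hn)// !chiE lee_fin ler_nat.
      rewrite !subr_ge0; have := a_ni ij; case: (leP (a i) (t - s)%R) => // h1 h2.
      by rewrite (le_trans h2 h1).
  have cvW : convol (EFin \o u) (far_tail n (a l)) t @[l --> \oo] --> (W t)%:E.
    rewrite (_ : (fun l => _) = fun l => (c l * lim_pot (t - a l) -
      fine (convol (w l) (fun s => (lim_pot s)%:E) t))%:E); last first.
      by apply/funext => l; rewrite convol_density_far_tail.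
    apply: cvg_EFin; first exact: nearW.
    apply/cvgrPdist_le => e e0; have [l0 hl0] := lim_pot_balance a1 t0 e0.
    by exists l0 => // l /= l0l; rewrite WE ?(ltW t0)//; exact: hl0.
  exact: (cvg_unique _ cvk cvW).
(* Lebesgue differentiation; off [Nb] the primitive of [u] is derivable with derivative [u]. *)
have [Nb [mNb Nb0 subNb]] : {ae mu, forall x : R, derivable
    (fun x => (\int[mu]_(s in `]-oo, x]) u s)%R) x 1 /\
    derive1 (fun x => (\int[mu]_(s in `]-oo, x]) u s)%R) x = u x}.
  apply: FTC1Ny.
    move=> y; apply: (integrableS measurableT) => //.
  have := integrable_locally measurableT iu; rewrite patch_setT.
  exact.
have GF y : (y < t + 1)%R -> (\int[mu]_(s in `]-oo, y]) u s)%R = lim_pot y.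
  move=> yt; rewrite /Rintegral integral_mkcond.
  have -> : \int[mu]_s ((EFin \o u) \_ `]-oo, y]) s = (lim_pot y)%:E => //.
  rewrite -ut1//; apply: eq_integral => s _; rewrite patchE indicE.
  by case: ifPn => _; rewrite ?mule1 ?mule0.
have dW x : (0 < x)%R -> (x < t)%R -> ~ Nb x -> derive1 W x = (- eta * u x)%R.
  move=> x0 xt nNx.
  have [dG dGE] : derivable (fun x => (\int[mu]_(s in `]-oo, x]) u s)%R) x 1 /\
    derive1 (fun x => (\int[mu]_(s in `]-oo, x]) u s)%R) x = u x.
    by apply: contrapT => h; apply: nNx; apply: subNb.
  set G := (fun x => (\int[mu]_(s in `]-oo, x]) u s)%R) in dG dGE.
  rewrite derive1E (@near_eq_derive _ _ _ W (cst 1%R - eta \*: G)%R); last first.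
    near=> y; rewrite WE.
      rewrite /= -GF//; near: y; apply: lt_nbhsl.
      by rewrite (lt_trans xt)// ltrDl.
    by apply: ltW; near: y; exact: lt_nbhsr.
  rewrite deriveB//; last exact: derivableZ.
  rewrite derive_cst deriveZ// sub0r -derive1E dGE.
  by rewrite -mulNr.
(* The exceptional set in the integration variable [s], still null because reflection preserves
   Lebesgue measure. On it [derive1] may be a default value. *)
pose N : set (measurableTypeR R) := [set s | Nb (t - s)%R].
have mN : measurable N.
  rewrite /N -[X in measurable X]setTI.
  have mphi : measurable_fun [set: R] (fun s : R => (t - s)%R) by exact: measurable_funB.
  exact: (mphi measurableT _ mNb).
have N0 : mu N = 0.
  have -> : mu N = \int[mu]_s (\1_Nb (t - s)%R)%:E.
    transitivity (\int[mu]_s (\1_N s)%:E); first by rewrite integral_indic// setIT.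
    by apply: eq_integral => s _; rewrite /N !indicE.
  rewrite (integral_refl t (nnm_indic mNb)) integral_indic// setIT.
  exact: Nb0.
rewrite /caputo_djrbashian.
rewrite (@eq_integral_off_null _ (measurableTypeR R) R mu _ N _
  (fun s => (- eta)%:E * ((u (t - s)%R)%:E * k s)) mN N0).
  rewrite integral_mkcond.
  transitivity (\int[mu]_s ((- eta)%:E * ((u (t - s)%R)%:E * k s))).
    apply: eq_integral => s _; rewrite patchE; case: ifPn => // /negP sn.
    rewrite /k indicE memNset ?mule0// => sD; apply: sn; exact/mem_set.
  have nuk : nnm (fun s => (u (t - s))%:E * k s).
    by apply: nnmM => //; exact: (nnm_refl t nu_).
  have I : \int[mu]_s ((u (t - s))%:E * k s) = (W t)%:E.
    rewrite -limk convolC// convol.unlock; apply: eq_integral => s _.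
    by rewrite muleC.
  rewrite integralZl//; first by rewrite I -EFinM.
  apply/integrableP; split; first exact: nuk.1.
  under eq_integral do rewrite gee0_abs ?nuk.2//.
  by rewrite I ltry.
move=> s /=; rewrite in_itv/= => /andP[s0 st] nNs.
rewrite derive1_shift_sub dW ?subr_gt0 ?gtrBl//.
rewrite /k nuE// indicE mem_set/= ?in_itv/= ?s0// mule1 -!EFinM.
by rewrite mulrA.
Unshelve. all: by end_near. Qed.

End ApproximatePotential.

(** * Laplace transforms of monotone functions *)

Section LaplaceUniqueness.
Context {R : realType}.
Local Open Scope ereal_scope.
Local Notation mu := (@lebesgue_measure R).
Local Notation D := (`[0%R, +oo[%classic : set R).
Implicit Types (f g : R -> R) (t T : R).

Let mD : measurable (D : set (measurableTypeR R)).
Proof. exact: measurable_itv. Qed.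

Let integrable_mul1 f (b : R -> R) : mu.-integrable D (EFin \o f) ->
  measurable_fun [set: R] b -> (forall t, (0 <= t)%R -> (`|b t| <= 1)%R) ->
  mu.-integrable D (EFin \o (fun t => f t * b t)%R).
Proof.
move=> fi mb b1; apply: (le_integrable mD _ _ fi).
  apply/measurable_EFinP; apply: measurable_funM; last exact: measurable_funTS.
  by apply/measurable_EFinP; exact: measurable_int fi.
move=> t; rewrite /= in_itv/= andbT => t0.
by rewrite lee_fin normrM ler_piMr// b1.
Qed.

(* With [K] of order [expR (N * T)], these polynomials in [expR (- t)] converge to
   the indicator of [t > T]. *)
Let stepf (N K : nat) t : R := ((1 - expR (- t) ^+ N) ^+ K)%R.

Let measurable_decay (k : nat) : measurable_fun [set: R] (fun t => expR (- t) ^+ k)%R.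
Proof.
apply: measurable_funX; apply: measurableT_comp; first exact: measurable_expR.
exact: measurable_funN.
Qed.

Let measurable_stepf N K : measurable_fun [set: R] (stepf N K).
Proof. by apply: measurable_funX; apply: measurable_funB => //; exact: measurable_decay. Qed.

Let decay01 (k : nat) t : (0 <= t)%R -> (0 <= expR (- t) ^+ k <= 1)%R.
Proof.
move=> t0; rewrite exprn_ge0 ?expR_ge0//= exprn_ile1 ?expR_ge0//.
by rewrite expR_le1 oppr_le0.
Qed.

Let stepf01 N K t : (0 <= t)%R -> (0 <= stepf N K t <= 1)%R.
Proof.
move=> /(decay01 N)/andP[h0 h1]; have h : (0 <= 1 - expR (- t) ^+ N)%R by rewrite subr_ge0.
by rewrite exprn_ge0//= exprn_ile1// lerBlDr lerDl.
Qed.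

(** [stepf N K.+1] is [stepf N K] minus its product with [exp (- t) ^ N], so the induction shifts
    the exponent; hence the statement for every [k]. *)
Let integral_stepf f g N K : mu.-integrable D (EFin \o f) ->
  mu.-integrable D (EFin \o g) ->
  (forall k : nat, \int[mu]_(t in D) (f t * expR (- t) ^+ k)%:E =
    \int[mu]_(t in D) (g t * expR (- t) ^+ k)%:E) ->
  forall k, \int[mu]_(t in D) (f t * (expR (- t) ^+ k * stepf N K t))%:E =
    \int[mu]_(t in D) (g t * (expR (- t) ^+ k * stepf N K t))%:E.
Proof.
move=> fi gi fg; elim: K => [|K IH] k.
  rewrite /stepf; under eq_integral do rewrite expr0 mulr1.
  by under [RHS]eq_integral do rewrite expr0 mulr1.
have E h : mu.-integrable D (EFin \o h) ->
    \int[mu]_(t in D) (h t * (expR (- t) ^+ k * stepf N K.+1 t))%:E =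
    \int[mu]_(t in D) (h t * (expR (- t) ^+ k * stepf N K t))%:E -
    \int[mu]_(t in D) (h t * (expR (- t) ^+ (k + N) * stepf N K t))%:E.
  have b1 m t : (0 <= t)%R -> (`|expR (- t) ^+ m * stepf N K t| <= 1)%R.
    move=> t0; have /andP[h0 h1] := decay01 m t0; have /andP[s0 s1] := stepf01 N K t0.
    by rewrite ger0_norm ?mulr_ge0// mulr_ile1.
  have mb m : measurable_fun [set: R] (fun t => expR (- t) ^+ m * stepf N K t)%R.
    exact: measurable_funM.
  move=> hi; rewrite -integralB_EFin//; last 2 first.
  - exact: (integrable_mul1 hi (mb k) (b1 k)).
  - exact: (integrable_mul1 hi (mb (k + N)%N) (b1 (k + N)%N)).
  apply: eq_integral => t _; rewrite -EFinB; congr EFin.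
  by rewrite /stepf exprS exprD; ring.
by rewrite !E// !IH.
Qed.

Let bernoulli (x : R) K : (0 <= x <= 1)%R -> (1 - K%:R * x <= (1 - x) ^+ K)%R.
Proof.
move=> /andP[x0 x1]; elim: K => [|K IH]; first by rewrite mul0r subr0 expr0.
rewrite exprS (@le_trans _ _ ((1 - x) * (1 - K%:R * x))%R)//.
  rewrite -subr_ge0 -natr1.
  have -> : ((1 - x) * (1 - K%:R * x) - (1 - (K%:R + 1) * x) = K%:R * x ^+ 2)%R by ring.
  by rewrite mulr_ge0// sqr_ge0.
by rewrite ler_wpM2l// subr_ge0.
Qed.

Let K T (N : nat) := (Num.truncn (expR (N%:R * T))).+1.

Let decay_cvg0 (x : R) : (0 < x)%R -> (fun N : nat => expR (- (N%:R * x)))%R @ \oo --> (0 : R)%R.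
Proof.
move=> x0; rewrite (_ : (fun _ => _) = fun N => (expR (- x) ^+ N)%R); last first.
  by apply/funext => N; rewrite -expRM_natl mulrN.
by apply: cvg_expr; rewrite ger0_norm ?expR_ge0// expR_lt1 oppr_lt0.
Qed.

(** Here [K] exceeds [exp (N T)] by at most 1. Beyond [T], Bernoulli gives [1 - K exp (- N t)],
    which tends to 1. Before [T], [1 - y <= exp (- y)] gives the bound [exp (- exp (N (T - t)))],
    hence [exp (- N (T - t))]. *)
Let stepf_cvg T t : (0 < T)%R -> (0 <= t)%R -> t != T ->
  (fun N => stepf N (K T N) t) @ \oo --> (\1_(`]T, +oo[%classic : set R) t : R).
Proof.
move=> T0 t0 tT; rewrite indicE mem_setE in_itv/= andbT.
have E N : (expR (- t) ^+ N = expR (- (N%:R * t)))%R by rewrite -expRM_natl mulrN.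
have [Tt|] := ltP T t.
  apply: (@squeeze_cvgr _ _ _ _ (fun N => 1 - (expR (- (N%:R * (t - T))) +
      expR (- (N%:R * t))))%R (cst 1%R)).
  - apply: nearW => N; have /andP[_ ->] := stepf01 N (K T N) t0; rewrite andbT.
    apply: le_trans (bernoulli _ (decay01 N t0)); rewrite lerD2l lerN2 E.
    rewrite (_ : - (N%:R * (t - T)) = N%:R * T + - (N%:R * t))%R; last by ring.
    rewrite expRD -{3}[expR (- (N%:R * t))]mul1r -mulrDl ler_wpM2r ?expR_ge0//.
    by rewrite /K -natr1 lerD2r truncn_le expR_ge0.
  - rewrite -[X in _ --> X]subr0; apply: cvgB; first exact: cvg_cst.
    rewrite -[X in _ --> X]addr0; apply: cvgD; apply: decay_cvg0.
      by rewrite subr_gt0.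
    exact: lt_trans T0 Tt.
  - exact: cvg_cst.
rewrite le_eqVlt (negPf tT)/= => tT'.
apply: (@squeeze_cvgr _ _ _ _ (cst 0%R) (fun N => expR (- (N%:R * (T - t))))%R).
- apply: nearW => N; have /andP[-> _] /= := stepf01 N (K T N) t0.
  have /andP[y0 y1] := decay01 N t0.
  rewrite (@le_trans _ _ (expR (- expR (- t) ^+ N) ^+ K T N)%R)//.
    by rewrite lerXn2r ?nnegrE ?expR_ge0 ?subr_ge0// expR_ge1Dx.
  rewrite -expRM_natl ler_expR mulrN lerN2.
  rewrite (@le_trans _ _ (expR (N%:R * (T - t)))%R)//.
    by rewrite (le_trans _ (expR_ge1Dx _))// lerDr.
  rewrite E mulrBr expRD ler_wpM2r ?expR_ge0// ltW//.
  exact: truncnS_gt.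
- exact: cvg_cst.
- by apply: decay_cvg0; rewrite subr_gt0.
Qed.

Lemma laplace_unique_tail f g T : (0 < T)%R -> mu.-integrable D (EFin \o f) ->
  mu.-integrable D (EFin \o g) ->
  (forall k : nat, \int[mu]_(t in D) (f t * expR (- t) ^+ k)%:E =
    \int[mu]_(t in D) (g t * expR (- t) ^+ k)%:E) ->
  \int[mu]_(t in `]T, +oo[) (f t)%:E = \int[mu]_(t in `]T, +oo[) (g t)%:E.
Proof.
move=> T0 fi gi fg.
have cvgI h : mu.-integrable D (EFin \o h) ->
    \int[mu]_(t in D) (h t * (expR (- t) ^+ 0 * stepf N (K T N) t))%:E @[N --> \oo] -->
    \int[mu]_(t in `]T, +oo[) (h t)%:E.
  move=> hi.
  have -> : \int[mu]_(t in `]T, +oo[) (h t)%:E =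
      \int[mu]_(t in D) (h t * \1_(`]T, +oo[%classic : set R) t)%:E.
    rewrite integral_mkcond [RHS]integral_mkcond; apply: eq_integral => t _.
    rewrite !patchE !mem_setE !in_itv/= !andbT indicE mem_setE in_itv/= andbT.
    by case: ltP => Tt; [rewrite ltW ?mulr1// (lt_trans T0)|rewrite mulr0 if_same].
  have mb N : measurable_fun [set: R] (fun t => expR (- t) ^+ 0 * stepf N (K T N) t)%R.
    exact: measurable_funM.
  have b1 N t : (0 <= t)%R -> (`|expR (- t) ^+ 0 * stepf N (K T N) t| <= 1)%R.
    by move=> t0; rewrite expr0 mul1r; have /andP[? ?] := stepf01 N (K T N) t0; rewrite ger0_norm.
  have mh : measurable_fun D h by apply/measurable_EFinP; exact: measurable_int hi.
  have [] := @dominated_convergence _ _ _ mu D mD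
    (fun N t => (h t * (expR (- t) ^+ 0 * stepf N (K T N) t))%:E)
    (fun t => (h t * \1_(`]T, +oo[%classic : set R) t)%:E) (fun t => `|(h t)%:E|).
  - by move=> N; apply/measurable_EFinP; apply: measurable_funM; [exact: mh|exact: (measurable_funTS (mb N))].
  - apply/measurable_EFinP; apply: measurable_funM; first exact: mh.
    by apply: measurable_indic; exact: measurable_itv.
  (* At [t = T] no limit is claimed; a single point is null. *)
  - exists [set T]; split; [exact: measurable_set1|exact: lebesgue_measure_set1|].
    move=> t /= /not_implyP[]; rewrite in_itv/= andbT => t0; apply: contra_notP => /eqP tT.
    apply: cvg_EFin; first exact: nearW.
    apply: cvgM; first exact: cvg_cst.
    rewrite (_ : (fun N => _) = fun N => stepf N (K T N) t); first exact: stepf_cvg.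
    by apply/funext => N; rewrite expr0 mul1r.
  - exact: integrable_abse.
  - apply: aeW => t N; rewrite /= in_itv/= andbT => t0.
    by rewrite lee_fin normrM ler_piMr// b1.
  - by [].
have cg := cvgI g gi; apply: (cvg_unique _ (cvgI f fi)) => //.
rewrite (_ : (fun N => _) = fun N =>
  \int[mu]_(t in D) (g t * (expR (- t) ^+ 0 * stepf N (K T N) t))%:E)//.
by apply/funext => N; exact: integral_stepf.
Qed.

(** Transforms at [X + k] are the integrals of [exp (- X t) F t] against powers of [exp (- t)], so
    [laplace_unique_tail] equates the integrals over all intervals. Two monotone functions with
    equal integrals interlace, and continuity of one of them closes the gap. *)
Lemma laplace_unique (F G : R -> R) (X : R) :
  (forall s t, (s <= t)%R -> (F s <= F t)%R) -> (forall t, (0 <= F t)%R) ->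
  (forall s t, (s <= t)%R -> (G s <= G t)%R) -> (forall t, (0 <= G t)%R) ->
  (forall t, (0 < t)%R -> {for t, continuous G}) ->
  (forall x, (X <= x)%R -> \int[mu]_(t in D) (expR (- (x * t)) * F t)%:E < +oo) ->
  (forall x, (X <= x)%R -> \int[mu]_(t in D) (expR (- (x * t)) * F t)%:E =
    \int[mu]_(t in D) (expR (- (x * t)) * G t)%:E) ->
  forall t, (0 < t)%R -> F t = G t.
Proof.
move=> Fnd F0 Gnd G0 cG Ffin FG t0 t0_gt0.
have me (x : R) : measurable_fun [set: R] (fun t => expR (- (x * t)))%R.
  apply: measurableT_comp; first exact: measurable_expR.
  by apply: measurable_funN; exact: measurable_funM.
have mF : measurable_fun [set: R] F.
  by apply: nondecreasing_measurable => // x y; exact: Fnd.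
have mG : measurable_fun [set: R] G.
  by apply: nondecreasing_measurable => // x y; exact: Gnd.
pose f t := (expR (- (X * t)) * F t)%R; pose g t := (expR (- (X * t)) * G t)%R.
have f0 t : (0 <= f t)%R by rewrite mulr_ge0// expR_ge0.
have g0 t : (0 <= g t)%R by rewrite mulr_ge0// expR_ge0.
have mf : measurable_fun [set: R] f by exact: measurable_funM.
have mg : measurable_fun [set: R] g by exact: measurable_funM.
have fi : mu.-integrable D (EFin \o f).
  apply/integrableP; split; first by apply/measurable_EFinP; exact: measurable_funTS.
  under eq_integral do rewrite /= ger0_norm//.
  exact: Ffin.
have gi : mu.-integrable D (EFin \o g).
  apply/integrableP; split; first by apply/measurable_EFinP; exact: measurable_funTS.
  under eq_integral do rewrite /= ger0_norm//.
  by rewrite -FG//; exact: Ffin.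
have fg (k : nat) : \int[mu]_(t in D) (f t * expR (- t) ^+ k)%:E =
    \int[mu]_(t in D) (g t * expR (- t) ^+ k)%:E.
  have E t : (expR (- (X * t)) * expR (- t) ^+ k = expR (- ((X + k%:R) * t)))%R.
    by rewrite -expRM_natl -expRD; congr expR; ring.
  under eq_integral do rewrite /f mulrAC E.
  under [RHS]eq_integral do rewrite /g mulrAC E.
  by apply: FG; rewrite lerDl.
have tails T : (0 < T)%R -> \int[mu]_(t in `]T, +oo[) (f t)%:E = \int[mu]_(t in `]T, +oo[) (g t)%:E.
  by move=> T0; exact: laplace_unique_tail.
have sub T : (0 < T)%R -> `]T, +oo[%classic `<=` D.
  by move=> T0 x /=; rewrite !in_itv/= !andbT => Tx; rewrite ltW// (lt_trans T0).
have bands s t : (0 < s)%R -> (s < t)%R ->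
    \int[mu]_(x in `]s, t]) (f x)%:E = \int[mu]_(x in `]s, t]) (g x)%:E.
  move=> s0 st; have t_0 := lt_trans s0 st.
  have E (h : R -> R) : (forall x, (0 <= h x)%R) -> measurable_fun [set: R] h ->
      mu.-integrable D (EFin \o h) ->
      \int[mu]_(x in `]s, t]) (h x)%:E =
      \int[mu]_(x in `]s, +oo[) (h x)%:E - \int[mu]_(x in `]t, +oo[) (h x)%:E.
    move=> h0 mh hi.
    have -> : \int[mu]_(x in `]s, +oo[) (h x)%:E =
        \int[mu]_(x in `]s, t]) (h x)%:E + \int[mu]_(x in `]t, +oo[) (h x)%:E.
      rewrite -ge0_integral_setU//=.
      - congr integral; rewrite -itv_bndbnd_setU// bnd_simp//; exact: ltW.
      - apply/measurable_EFinP; exact: measurable_funTS.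
      - by move=> x _; rewrite lee_fin.
      - apply/disj_setPRL => x /=; rewrite !in_itv/= andbT => tx /andP[_ xt].
        by move: (lt_le_trans tx xt); rewrite ltxx.
    rewrite addeK// ge0_fin_numE; last by apply: integral_ge0 => x _; rewrite lee_fin.
    have /integrableP[_] := integrableS mD (measurable_itv _) (sub t t_0) hi.
    by under eq_integral do rewrite /= ger0_norm//.
  by rewrite !E// !tails.
have band_pos s t : (s < t)%R -> exists2 c : R, (0 < c)%R &
    \int[mu]_(x in `]s, t]) (expR (- (X * x)))%:E = c%:E.
  move=> st; pose B := (`|X| * (`|s| + `|t|))%R.
  have hB x : (s < x <= t)%R -> (`|X * x| <= B)%R.
    move=> /andP[sx xt]; rewrite normrM ler_wpM2l// ler_norml.
    have h1 : (- (`|s| + `|t|) <= s)%R.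
      by rewrite lerNl (le_trans (ler_norm _))// normrN lerDl.
    have h2 : (t <= `|s| + `|t|)%R by rewrite (le_trans (ler_norm _))// lerDr.
    by rewrite (le_trans h1 (ltW sx)) (le_trans xt h2).
  have me' : measurable_fun `]s, t]%classic (fun x => (expR (- (X * x)))%:E).
    by apply/measurable_EFinP; exact: measurable_funTS.
  have lo : (expR (- B) * (t - s))%:E <= \int[mu]_(x in `]s, t]) (expR (- (X * x)))%:E.
    have <- : \int[mu]_(x in `]s, t]) (cst (expR (- B))%:E x) = (expR (- B) * (t - s))%:E.
      by rewrite integral_cst//= lebesgue_measure_itv/= lte_fin st -EFinD EFinM.
    apply: ge0_le_integral => //=; try by move=> x _; rewrite lee_fin expR_ge0.
    move=> x; rewrite in_itv/= => h; rewrite lee_fin ler_expR lerN2.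
      by rewrite (le_trans (ler_norm _))// hB.
  have up : \int[mu]_(x in `]s, t]) (expR (- (X * x)))%:E <= (expR B * (t - s))%:E.
    have <- : \int[mu]_(x in `]s, t]) (cst (expR B)%:E x) = (expR B * (t - s))%:E.
      by rewrite integral_cst//= lebesgue_measure_itv/= lte_fin st -EFinD EFinM.
    apply: ge0_le_integral => //=; try by move=> x _; rewrite lee_fin expR_ge0.
    move=> x; rewrite in_itv/= => h; rewrite lee_fin ler_expR.
      by rewrite (le_trans (ler_norm _))// normrN hB.
  have ifin : \int[mu]_(x in `]s, t]) (expR (- (X * x)))%:E \is a fin_num.
    rewrite ge0_fin_numE; first exact: le_lt_trans up (ltry _).
    by apply: integral_ge0 => x _; rewrite lee_fin expR_ge0.
  move: lo up; rewrite -(fineK ifin) !lee_fin => lo _.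
  exists (fine (\int[mu]_(x in `]s, t]) (expR (- (X * x)))%:E)) => //.
  by rewrite (lt_le_trans _ lo)// mulr_gt0 ?expR_gt0// subr_gt0.
(* Equal integrals over [s, t] force the monotone functions to interlace. *)
have interlace (p r : R -> R) s t : (s < t)%R ->
    (forall x y, (x <= y)%R -> (p x <= p y)%R) -> (forall x, (0 <= p x)%R) ->
    (forall x y, (x <= y)%R -> (r x <= r y)%R) -> (forall x, (0 <= r x)%R) ->
    measurable_fun [set: R] p -> measurable_fun [set: R] r ->
    \int[mu]_(x in `]s, t]) (expR (- (X * x)) * p x)%:E =
    \int[mu]_(x in `]s, t]) (expR (- (X * x)) * r x)%:E -> (p s <= r t)%R.
  move=> st pnd p0 rnd r0 mp mr pr.
  have [c c0 cE] := band_pos s t st.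
  have mE : measurable_fun `]s, t]%classic (fun x => (expR (- (X * x)))%:E).
    by apply/measurable_EFinP; exact: measurable_funTS.
  have lo : (p s * c)%:E <= \int[mu]_(x in `]s, t]) (expR (- (X * x)) * p x)%:E.
    rewrite EFinM -cE -ge0_integralZl ?lee_fin//.
    apply: ge0_le_integral => //=.
    - by move=> x _; rewrite -EFinM lee_fin mulr_ge0// expR_ge0.
    - by apply: emeasurable_funM.
    - by apply/measurable_EFinP; apply: measurable_funTS; exact: (measurable_funM (me X) mp).
    - move=> x; rewrite in_itv/= => /andP[sx _]; rewrite -EFinM lee_fin mulrC.
      by rewrite ler_wpM2l ?expR_ge0// pnd// ltW.
  have up : \int[mu]_(x in `]s, t]) (expR (- (X * x)) * r x)%:E <= (r t * c)%:E.
    rewrite EFinM -cE -ge0_integralZl ?lee_fin//.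
    apply: ge0_le_integral => //=.
    - by move=> x _; rewrite lee_fin mulr_ge0// expR_ge0.
    - by apply/measurable_EFinP; apply: measurable_funTS; exact: (measurable_funM (me X) mr).
    - by apply: emeasurable_funM.
    - move=> x; rewrite in_itv/= => /andP[_ xt]; rewrite -EFinM lee_fin [leRHS]mulrC.
      by rewrite ler_wpM2l ?expR_ge0// rnd.
  by move: (le_trans lo (eq_ind_r (fun z => z <= _) up pr)); rewrite lee_fin ler_pM2r.
have /cvgrPdist_le cG0 := cG t0 t0_gt0.
apply/eqP; rewrite eq_le; apply/andP; split.
- apply/ler_addgt0Pr => e e0; have [d /= d0 hd] := cG0 e e0.
  have d2 : (0 < d / 2)%R by rewrite divr_gt0.
  have td : (t0 < t0 + d / 2)%R by rewrite ltrDl.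
  have FG2 : (F t0 <= G (t0 + d / 2))%R.
    by apply: interlace => //; exact: bands.
  have : (`|G t0 - G (t0 + d / 2)| <= e)%R.
    apply: hd => /=; rewrite opprD addrA subrr add0r normrN gtr0_norm//.
    by rewrite ltr_pdivrMr// ltr_pMr// ltr1n.
  by rewrite distrC ler_norml => /andP[_]; rewrite lerBlDl => /(le_trans FG2).
- apply/ler_addgt0Pr => e e0; have [d /= d0 hd] := cG0 e e0.
  (* The second bound keeps [t0 - r] positive, as [bands] requires. *)
  pose r := Num.min (d / 2)%R (t0 / 2)%R; have r0 : (0 < r)%R by rewrite lt_min !divr_gt0.
  have rd : (r < d)%R.
    apply: (@le_lt_trans _ _ (d / 2)%R); first by rewrite ge_min lexx.
    by rewrite ltr_pdivrMr// ltr_pMr// ltr1n.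
  have rt : (0 < t0 - r)%R.
    rewrite subr_gt0; apply: (@le_lt_trans _ _ (t0 / 2)%R); first by rewrite ge_min lexx orbT.
    by rewrite ltr_pdivrMr// ltr_pMr// ltr1n.
  have td : (t0 - r < t0)%R by rewrite ltrBlDr ltrDl.
  have GF2 : (G (t0 - r) <= F t0)%R.
    by apply: interlace => //; apply/esym/bands.
  have : (`|G t0 - G (t0 - r)| <= e)%R.
    by apply: hd => /=; rewrite opprB addrCA subrr addr0 gtr0_norm.
  rewrite ler_norml => /andP[_]; rewrite lerBlDr => /le_trans; apply.
  by rewrite addrC lerD2r.
Qed.

End LaplaceUniqueness.

(** * The inverse subordinator *)

Section InverseSubordinator.
Context {R : realType} {d : measure_display} {T : measurableType d}.
Context (P : probability T R).
Local Open Scope ereal_scope.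
Local Notation mu := (@lebesgue_measure R).
Local Notation D := (`[0%R, +oo[%classic : set R).

Lemma integral_expRN_tail (x h : R) : (0 < x)%R ->
  \int[mu]_(t in `]h, +oo[) (expR (- (x * t)))%:E = (x^-1 * expR (- (x * h)))%:E.
Proof.
move=> x0; have := convol_expf_chi (- h) x0; rewrite convol.unlock => E.
have mexp : measurable_fun [set: R] (fun t => (expR (- (x * t)))%:E).
  apply/measurable_EFinP; apply: measurableT_comp; first exact: measurable_expR.
  by apply: measurable_funN; exact: measurable_funM.
rewrite integral_itv_obnd_cbnd; last exact: measurable_funTS.
rewrite integral_mkcond -(@integral_refl _ 0%R); last first.
  split; first by apply/(measurable_restrict _ (measurable_itv _) measurableT); exact: measurable_funTS.
  by move=> t; apply: erestrict_ge0 => s _; rewrite lee_fin expR_ge0.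
transitivity ((x^-1)%:E * expf x (- h)%R); last by rewrite /expf -EFinM mulrN.
rewrite -E; apply: eq_integral => s _.
rewrite patchE mem_setE in_itv/= andbT sub0r /expf chiE subr_ge0 lerNr.
by case: ifPn; rewrite ?mule1 ?mule0// mulrN opprK.
Qed.

Variables (H : R -> {RV P >-> R}) (f : R -> R) (eta X : R) (G : R -> R).
Hypothesis Hsub : is_subordinator P (fun t => H t : T -> R).
Hypothesis Hexp : has_laplace_exponent P (fun t => H t : T -> R) f.
Hypothesis X0 : (0 < X)%R.
Hypothesis fX0 : (0 < f X)%R.
Hypothesis ef0 : forall x, (X <= x)%R -> (0 < eta + f x)%R.
Hypothesis G_nd : forall s t, (s <= t)%R -> (G s <= G t)%R.
Hypothesis G_le0 : forall t, (t <= 0)%R -> G t = 0%R.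
Hypothesis G_cont : continuous G.
Hypothesis G_laplace : forall x, (X <= x)%R ->
  \int[mu]_(t in D) (expR (- (x * t)) * G t)%:E = (x^-1 * (eta + f x)^-1)%:E.

Local Notation Y := (inverse_subordinator (fun t => H t : T -> R)).

Let G_ge0 t : (0 <= G t)%R.
Proof.
have [t0|/ltW t0] := leP t 0%R; first by rewrite G_le0.
by rewrite -(G_le0 (lexx 0%R)) G_nd.
Qed.

Let H_ge0 u w : (0 <= u)%R -> (0 <= H u w)%R.
Proof.
move=> u0; have <- : H 0%R w = 0%R by exact: (subordinator0 Hsub).
exact: (subordinator_nondecreasing Hsub).
Qed.

Let H_nd w s t : (0 <= s)%R -> (s <= t)%R -> (H s w <= H t w)%R.
Proof. exact: (subordinator_nondecreasing Hsub). Qed.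

Let measurable_H_lt u s : measurable [set w | (H u w < s)%R].
Proof.
rewrite (_ : [set w | _] = H u @^-1` `]-oo, s[%classic).
  exact: (measurable_funPTI (H u) (measurable_itv _)).
by apply/seteqP; split => w /=; rewrite in_itv.
Qed.

Let H_lt_right u s w : (0 <= u)%R -> (H u w < s)%R ->
  exists2 e : R, (0 < e)%R & (H (u + e) w < s)%R.
Proof.
move=> u0 hu; have := subordinator_right_continuous Hsub (w := w) u0.
move=> /(cvgr_lt _)/(_ _ hu)[e /= e0 he].
exists (e / 2)%R; first by rewrite divr_gt0.
apply: he => /=; last by rewrite ltrDl divr_gt0.
rewrite opprD addrA subrr add0r normrN gtr0_norm ?divr_gt0//.
by rewrite ltr_pdivrMr// ltr_pMr// ltr1n.
Qed.

(** With the strict inequality the event survives a small increase of [u], by right continuity of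
    the paths; this is what [p_right] needs. *)
Let p u s := P [set w | (H u w < s)%R].

Let p_ge0 u s : 0 <= p u s. Proof. exact: measure_ge0. Qed.

Let p_nd u s t : (s <= t)%R -> p u s <= p u t.
Proof.
move=> st; apply: le_measure; rewrite ?inE//; try exact: measurable_H_lt.
by move=> w /= h; exact: lt_le_trans st.
Qed.

Let p_ni u v s : (0 <= u)%R -> (u <= v)%R -> p v s <= p u s.
Proof.
move=> u0 uv; apply: le_measure; rewrite ?inE//; try exact: measurable_H_lt.
by move=> w /= h; apply: le_lt_trans h; exact: H_nd.
Qed.

Let p_right u s c : (0 <= u)%R -> c < p u s ->
  exists2 q : rat, (u < ratr q)%R & c < p (ratr q) s.
Proof.
move=> u0 cp; apply: contrapT => nq.
have le_c (k : nat) : p (u + k.+1%:R^-1)%R s <= c.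
  rewrite leNgt; apply/negP => ck; apply: nq.
  have uk : (u < u + k.+1%:R^-1)%R by rewrite ltrDl.
  have [q] := rat_in_itvoo uk.
  rewrite in_itv/= => /andP[uq qk]; exists q => //.
  by apply: (lt_le_trans ck); apply: p_ni; [exact: le_trans (ltW uq)|exact: ltW].
have UE : [set w | (H u w < s)%R] = \bigcup_k [set w | (H (u + k.+1%:R^-1) w < s)%R].
  apply/seteqP; split => w /=.
    move=> /(H_lt_right u0)[e e0 he]; have [k _ hk] := near_infty_natSinv_lt (PosNum e0).
    exists k => //=; apply: le_lt_trans he; apply: H_nd; first by rewrite addr_ge0.
    by rewrite lerD2l ltW//; apply: hk => /=.
  by move=> [k _ /=]; apply: le_lt_trans; apply: H_nd => //; rewrite lerDl.
have cvgp : p (u + k.+1%:R^-1)%R s @[k --> \oo] --> p u s.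
  rewrite /p UE; apply: nondecreasing_cvg_mu.
  - by move=> k; exact: measurable_H_lt.
  - by apply: bigcup_measurable => k _; exact: measurable_H_lt.
  - move=> i j ij; apply/subsetPset => w /=; apply: le_lt_trans; apply: H_nd.
      by rewrite addr_ge0.
    by rewrite lerD2l lef_pV2 ?posrE// ler_nat ltnS.
move: cp; rewrite ltNge => /negP; apply.
rewrite -(cvg_lim (@ereal_hausdorff R) cvgp); apply: lime_le; first exact: cvgP cvgp.
exact: nearW.
Qed.

Local Notation D2 := (D `*` [set: R]).

(* [p] is monotone in both variables and right-continuous in the first one, so
   its superlevel sets are countable unions of rectangles. *)
Let measurable_p : measurable_fun (D2 : set (R * R)) (fun z : R * R => p z.1 z.2).
Proof.
apply: (measurability _ (ErealGenOInfty.measurableE R)).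
move=> _ [_ [x ->] <-].
rewrite (_ : _ `&` _ = \bigcup_(q : rat) (`[0%R, ratr q[%classic `*`
  [set s | x%:E < p (ratr q) s])).
  apply: bigcupT_measurable_rat => q; apply: measurableX; first exact: measurable_itv.
  apply: is_interval_measurable => s t /= hs ht r /andP[sr rt].
  exact: lt_le_trans hs (p_nd _ sr).
apply/seteqP; split => -[u s] /=.
  move=> [[]]; rewrite !in_itv/= !andbT => u0 _ /(p_right u0)[q uq xq].
  by exists q => //=; rewrite in_itv/= u0 uq.
move=> [q _ [/=]]; rewrite !in_itv/= !andbT => /andP[u0 uq] xq; split => //.
by apply: lt_le_trans xq _; apply: p_ni => //; exact: ltW.
Qed.

Let measurable_pu u : measurable_fun [set: R] (p u).
Proof.
apply: (measurability _ (ErealGenOInfty.measurableE R)).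
move=> _ [_ [x ->] <-]; rewrite setTI; apply: is_interval_measurable => s t /=.
rewrite !in_itv/= !andbT => hs ht r /andP[sr rt]; rewrite in_itv/= andbT.
exact: lt_le_trans hs (p_nd _ sr).
Qed.

Let pD := (fun z : R * R => p z.1 z.2) \_ D2.

Let measurable_pD : measurable_fun [set: R * R] pD.
Proof.
have mD2 : measurable (D2 : set (R * R)) by apply: measurableX => //; exact: measurable_itv.
by apply/(measurable_restrict _ mD2 measurableT); rewrite setTI; exact: measurable_p.
Qed.

Let pDE u t : pD (u, t) = (\1_D u)%:E * p u t.
Proof.
rewrite /pD patchE indicE; case: ifPn => /=.
  by move/set_mem => -[/= uD _]; rewrite mem_set// mul1e.
move=> /negP h; rewrite memNset ?mul0e// => uD; apply: h; exact/mem_set.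
Qed.

Let measurable_p_slice t : measurable_fun D (fun u => p u t).
Proof.
apply: (eq_measurable_fun (fun u => pD (u, t))); last first.
  by apply: measurable_funTS; exact: measurable_fun_pair1 measurable_pD.
by move=> u uD; rewrite pDE indicE uD mul1e.
Qed.

Let measurable_expRN (x : R) : measurable_fun [set: R] (fun t => expR (- (x * t)))%R.
Proof.
apply: measurableT_comp; first exact: measurable_expR.
by apply: measurable_funN; exact: measurable_funM.
Qed.

(** Tonelli: the integral of [exp (- x t)] over [t > H u w] is [exp (- x * H u w) / x], whose
    expectation is the Laplace exponent hypothesis. *)
Let laplace_p u x : (0 <= u)%R -> (0 < x)%R ->
  \int[mu]_t ((expR (- (x * t)) * \1_D t)%:E * p u t) =
  (x^-1 * expR (- (u * f x)))%:E.
Proof.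
move=> u0 x0; pose c (t : R) : R := (expR (- (x * t)) * \1_D t)%R.
have c0 t : (0 <= c t)%R by rewrite mulr_ge0// expR_ge0.
have mc : measurable_fun [set: R] c.
  by apply: measurable_funM => //; apply: measurable_indic; exact: measurable_itv.
pose A : set (R * T) := [set z | (H u z.2 < z.1)%R].
have mA : measurable A.
  have m2 : measurable_fun [set: R * T] (fun z => (H u z.2 < z.1)%R).
    apply: measurable_fun_ltr; last exact: measurable_fst.
    by apply: measurableT_comp; [exact: measurable_funP|exact: measurable_snd].
  have m1 : measurable [set true] by [].
  have := m2 measurableT _ m1; rewrite setTI.
  by congr measurable; apply/seteqP; split => z /=.
pose k (z : R * T) : \bar R := (c z.1 * \1_A z)%:E.
have mk : measurable_fun [set: R * T] k.
  apply/measurable_EFinP; apply: measurable_funM; last exact: measurable_indic.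
  by apply: measurableT_comp => //; exact: measurable_fst.
have k0 z : 0 <= k z by rewrite lee_fin mulr_ge0.
transitivity (\int[mu]_t \int[P]_w k (t, w)).
  apply: eq_integral => t _.
  transitivity (\int[P]_w ((c t)%:E * (\1_[set w | (H u w < t)%R] w)%:E)); last first.
    by apply: eq_integral => w _; rewrite /k -EFinM !indicE.
  rewrite ge0_integralZl//; last 2 first.
  - by apply/measurable_EFinP; apply: measurable_indic; exact: measurable_H_lt.
  - by rewrite lee_fin.
  by rewrite integral_indic// setIT.
transitivity (\int[P]_w \int[mu]_t k (t, w)).
  exact: (@fubini_tonelli _ _ _ _ _ mu P k mk k0).
transitivity (\int[P]_w ((x^-1)%:E * (expR (- (x * H u w)))%:E)).
  apply: eq_integral => w _; rewrite -EFinM -integral_expRN_tail// [RHS]integral_mkcond.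
  apply: eq_integral => t _; rewrite /k /c patchE !indicE.
  have -> : ((t, w) \in A) = (H u w < t)%R by apply/idP/idP => [/set_mem|h]//; exact/mem_set.
  rewrite !mem_setE !in_itv/= !andbT.
  case: ifPn => ht; last by rewrite mulr0.
  by rewrite (le_trans (H_ge0 w u0) (ltW ht)) !mulr1.
rewrite ge0_integralZl//; last 2 first.
- apply/measurable_EFinP; apply: measurableT_comp; first exact: measurable_expR.
  by apply: measurable_funN; apply: measurable_funM => //; exact: measurable_funP.
- by rewrite lee_fin invr_ge0 ltW.
by have := Hexp u0 x0; rewrite unlock => ->.
Qed.

Let Fm t := \int[mu]_(u in D) ((expR (- (eta * u)))%:E * p u t).

Let laplace_Fm x : (X <= x)%R ->
  \int[mu]_(t in D) ((expR (- (x * t)))%:E * Fm t) = (x^-1 * (eta + f x)^-1)%:E.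
Proof.
move=> Xx; have x0 := lt_le_trans X0 Xx.
pose K (z : R * R) := (expR (- (eta * z.1)) * (expR (- (x * z.2)) * \1_D z.2))%:E * pD z.
have mK : measurable_fun [set: R * R] K.
  apply: emeasurable_funM => //; apply/measurable_EFinP; apply: measurable_funM.
    by apply: measurableT_comp (measurable_expRN eta) measurable_fst.
  apply: measurable_funM; first exact: measurableT_comp (measurable_expRN x) measurable_snd.
  apply: (measurableT_comp _ measurable_snd); apply: measurable_indic; exact: measurable_itv.
have K0 z : 0 <= K z.
  rewrite mule_ge0 ?lee_fin ?mulr_ge0 ?expR_ge0//.
  by apply: erestrict_ge0 => y _; exact: p_ge0.
transitivity (\int[mu]_t \int[mu]_u K (u, t)).
  rewrite integral_mkcond; apply: eq_integral => t _.
  transitivity ((expR (- (x * t)) * \1_D t)%:E * Fm t).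
    by rewrite patchE indicE; case: ifPn => _; rewrite ?mulr1// mulr0 mul0e.
  rewrite /Fm integral_mkcond -ge0_integralZl//.
  - apply: eq_integral => u _; rewrite /K/= pDE patchE !indicE.
    case: ifPn => _; last by rewrite mul0e [RHS]mule0; exact: mule0.
    by rewrite mul1e muleA -EFinM mulrC.
  - apply/(measurable_restrict _ (measurable_itv _) measurableT); rewrite setTI.
    apply: emeasurable_funM; first by apply/measurable_EFinP; exact: (measurable_funTS (measurable_expRN _)).
    exact: measurable_p_slice.
  - by move=> u _; apply: erestrict_ge0 => v _; rewrite mule_ge0 ?lee_fin ?expR_ge0.
transitivity (\int[mu]_u \int[mu]_t K (u, t)).
  by apply/esym; exact: (@fubini_tonelli _ _ _ _ _ mu mu K mK K0).
transitivity (\int[mu]_(u in D) ((x^-1)%:E * (expR (- ((eta + f x) * u)))%:E)).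
  rewrite [RHS]integral_mkcond; apply: eq_integral => u _; rewrite patchE.
  case: ifPn => uD; last first.
    by apply: integral0_eq => t _; rewrite /K pDE !indicE (negPf uD) mul0e mule0.
  have u0 : (0 <= u)%R by move: uD; rewrite mem_setE in_itv/= andbT.
  transitivity (\int[mu]_t ((expR (- (eta * u)))%:E * ((expR (- (x * t)) * \1_D t)%:E * p u t))).
    by apply: eq_integral => t _; rewrite /K/= pDE !indicE uD mul1e EFinM muleA.
  have mi : measurable_fun [set: R] (fun t => (expR (- (x * t)) * \1_D t)%:E * p u t).
    apply: emeasurable_funM; last exact: measurable_pu.
    apply/measurable_EFinP; apply: measurable_funM; first exact: measurable_expRN.
    by apply: measurable_indic; exact: measurable_itv.
  have i0 t : 0 <= (expR (- (x * t)) * \1_D t)%:E * p u t.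
    by rewrite mule_ge0// lee_fin mulr_ge0// expR_ge0.
  rewrite ge0_integralZl//.
  rewrite laplace_p// -!EFinM mulrCA -expRD; congr (_ * expR _)%:E; ring.
rewrite ge0_integralZl//; last 2 first.
- by apply/measurable_EFinP; exact: (measurable_funTS (measurable_expRN _)).
- by rewrite lee_fin invr_ge0 ltW.
rewrite -integral_itv_obnd_cbnd; last first.
  by apply/measurable_EFinP; exact: (measurable_funTS (measurable_expRN _)).
by rewrite integral_expRN_tail ?ef0// mulr0 oppr0 expR0 mulr1 -EFinM.
Qed.

(** Markov's inequality for [exp (- X * H u)]. The decay [exp (- u * f X)] is what absorbs the
    growth of [exp (- eta * u)] for negative [eta]. *)
Let p_markov u t : (0 <= u)%R -> p u t <= (expR (X * t) * expR (- (u * f X)))%:E.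
Proof.
move=> u0; rewrite /p -[X in P X]setIT -integral_indic//.
have E := Hexp u0 X0; rewrite unlock in E; rewrite EFinM -E -ge0_integralZl//.
- apply: ge0_le_integral => //.
  + by apply/measurable_EFinP; apply: measurable_indic; exact: measurable_H_lt.
  + apply/measurable_EFinP; apply: measurable_funM => //.
    apply: measurableT_comp; first exact: measurable_expR.
    by apply: measurable_funN; apply: measurable_funM => //; exact: measurable_funP.
  + move=> w _; rewrite -EFinM lee_fin indicE -expRD.
    have [/set_mem/= h|_] := boolP (w \in _); last exact: expR_ge0.
    by rewrite -expR0 ler_expR -mulrN -mulrDr mulr_ge0 ?(ltW X0)// subr_ge0 ltW.
- apply/measurable_EFinP; apply: measurableT_comp; first exact: measurable_expR.
  by apply: measurable_funN; apply: measurable_funM => //; exact: measurable_funP.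
Qed.

Let Fm_fin t : Fm t \is a fin_num.
Proof.
rewrite ge0_fin_numE; last first.
  by apply: integral_ge0 => u _; rewrite mule_ge0 ?lee_fin ?expR_ge0.
apply: (@le_lt_trans _ _ (\int[mu]_(u in D)
  ((expR (X * t))%:E * (expR (- ((eta + f X) * u)))%:E))).
  apply: ge0_le_integral => //.
  - by move=> u _; rewrite mule_ge0 ?lee_fin ?expR_ge0.
  - apply: emeasurable_funM; [by apply/measurable_EFinP; exact: (measurable_funTS (measurable_expRN _))|exact: measurable_p_slice].
  - apply: emeasurable_funM => //; apply/measurable_EFinP; exact: (measurable_funTS (measurable_expRN _)).
  - move=> u; rewrite /= in_itv/= andbT => u0.
    apply: (@le_trans _ _ ((expR (- (eta * u)))%:E * (expR (X * t) * expR (- (u * f X)))%:E)).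
      by rewrite lee_wpmul2l ?lee_fin ?expR_ge0// p_markov.
    rewrite -!EFinM lee_fin mulrCA -expRD; rewrite le_eqVlt; apply/orP; left.
    by apply/eqP; congr (_ * expR _)%R; ring.
rewrite ge0_integralZl//; last first.
  by apply/measurable_EFinP; exact: (measurable_funTS (measurable_expRN _)).
rewrite -integral_itv_obnd_cbnd; last by apply/measurable_EFinP; exact: (measurable_funTS (measurable_expRN _)).
by rewrite integral_expRN_tail ?ef0// -EFinM ltry.
Qed.

Let Fm_nd s t : (s <= t)%R -> Fm s <= Fm t.
Proof.
move=> st; apply: ge0_le_integral => //.
- by move=> u _; rewrite mule_ge0 ?lee_fin ?expR_ge0.
- apply: emeasurable_funM; [by apply/measurable_EFinP; exact: (measurable_funTS (measurable_expRN _))|exact: measurable_p_slice].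
- apply: emeasurable_funM; [by apply/measurable_EFinP; exact: (measurable_funTS (measurable_expRN _))|exact: measurable_p_slice].
- by move=> u _; rewrite lee_wpmul2l ?lee_fin ?expR_ge0// p_nd.
Qed.

Let FmE t : (0 < t)%R -> Fm t = (G t)%:E.
Proof.
move=> t0; rewrite -(fineK (Fm_fin t)); congr EFin.
have E x : \int[mu]_(t in D) (expR (- (x * t)) * fine (Fm t))%:E =
    \int[mu]_(t in D) ((expR (- (x * t)))%:E * Fm t).
  by apply: eq_integral => s _; rewrite EFinM (fineK (Fm_fin s)).
apply: (@laplace_unique _ (fun t => fine (Fm t)) G X) => //.
- by move=> s r sr; apply: (fine_le (Fm_fin s) (Fm_fin r)); exact: Fm_nd.
- by move=> s; rewrite fine_ge0// integral_ge0// => u _; rewrite mule_ge0 ?lee_fin ?expR_ge0.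
- by move=> s _; exact: G_cont.
- by move=> x Xx; rewrite E laplace_Fm// ltry.
- by move=> x Xx; rewrite E laplace_Fm// G_laplace.
Qed.

(** * The passage time as a random variable *)

Let A t w := [set s | (0 <= s)%R /\ (t < H s w)%R].

Let Y_has_inf t w : A t w !=set0 -> has_inf (A t w).
Proof. by move=> A0; split => //; exists 0%R => s [] . Qed.

Lemma inverse_subordinator_ge0 t w : (0 <= Y t w)%R.
Proof.
rewrite /inverse_subordinator -/(A t w).
have [->|/set0P A0] := eqVneq (A t w) set0; first by rewrite inf0.
by apply: lb_le_inf => // s [].
Qed.

(** Together with [Y_gt] this places the event [u < Y t] between [H u < t], up to the null event
    that level [t] is never exceeded, and [H u <= t]. *)
Let lt_Y u t w : (0 <= u)%R -> (u < Y t w)%R -> (H u w <= t)%R.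
Proof.
move=> u0 uY; rewrite leNgt; apply/negP => tH.
have Au : A t w u by split.
move: uY; rewrite ltNge => /negP; apply.
by apply: ge_inf => //; have [] := @Y_has_inf t w; [exists u|].
Qed.

Let Y_gt u t w : (0 <= u)%R -> A t w !=set0 -> (H u w < t)%R -> (u < Y t w)%R.
Proof.
move=> u0 A0 /(H_lt_right u0)[e e0 he].
apply: (@lt_le_trans _ _ (u + e)%R); first by rewrite ltrDl.
apply: lb_le_inf => // s [s0 ts]; rewrite leNgt; apply/negP => su.
have := H_nd w s0 (ltW su); rewrite leNgt => /negP; apply.
exact: lt_trans he ts.
Qed.

Let measurable_empty t : measurable [set w | ~ (A t w !=set0)].
Proof.
rewrite (_ : [set w | _] = \bigcap_(k : nat) [set w | (H k%:R w <= t)%R]).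
  apply: bigcapT_measurable => k.
  rewrite (_ : [set w | _] = H k%:R @^-1` `]-oo, t]%classic).
    exact: (measurable_funPTI (H k%:R) (measurable_itv _)).
  by apply/seteqP; split => w /=; rewrite in_itv.
apply/seteqP; split => w /= h.
  by move=> k _ /=; rewrite leNgt; apply/negP => tk; apply: h; exists k%:R; split.
move=> [s [s0 ts]]; move: ts; rewrite ltNge => /negP; apply.
apply: le_trans (h (Num.truncn s).+1 I); apply: H_nd => //.
by rewrite ltW// truncnS_gt.
Qed.

(** Staying below [t + 1] at time [k] has probability at most a constant times [exp (- k * f X)],
    which tends to 0 because [f X > 0]. *)
Let empty_null t : P [set w | ~ (A t w !=set0)] = 0.
Proof.
apply/eqP; rewrite eq_le measure_ge0 andbT.
have cv : (expR (X * (t + 1)) * expR (- f X) ^+ k)%:E @[k --> \oo] --> (0 : \bar R).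
  rewrite -[X in _ --> X](mule0 (expR (X * (t + 1)))%:E); under eq_fun do rewrite EFinM.
  apply: cvgeZl => //; apply: cvg_EFin; first exact: nearW.
  by apply: cvg_expr; rewrite ger0_norm ?expR_ge0// expR_lt1 oppr_lt0.
rewrite -(cvg_lim (@ereal_hausdorff R) cv); apply: lime_ge; first exact: cvgP cv.
apply: nearW => k; rewrite -expRM_natl mulrN.
apply: le_trans (p_markov (t + 1)%R (ler0n R k)).
apply: le_measure; rewrite ?inE//; try exact: measurable_H_lt.
move=> w /= h; rewrite ltNge; apply/negP => tk; apply: h; exists k%:R; split => //.
by apply: lt_le_trans tk; rewrite ltrDl.
Qed.

Lemma measurable_inverse_subordinator t : measurable_fun [set: T] (Y t).
Proof.
apply: (measurability _ (RGenInftyO.measurableE R)).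
move=> _ [_ [y ->] <-]; rewrite setTI.
have [y0|y0] := leP y 0%R.
  rewrite (_ : _ @^-1` _ = set0)//; apply/seteqP; split => w //=.
  by rewrite in_itv/= ltNge (le_trans y0 (inverse_subordinator_ge0 t w)).
(* By monotonicity a passage before [y] is seen at a rational time. Paths that never exceed [t]
   belong to the set as well, since the infimum of the empty set is 0. *)
have -> : Y t @^-1` `]-oo, y[%classic = [set w | ~ (A t w !=set0)] `|`
  \bigcup_(q : rat) (if (0 <= (ratr q : R) < y)%R then [set w | (t < H (ratr q) w)%R] else set0);
  last first.
  apply: measurableU => //; apply: bigcupT_measurable_rat => q; case: ifPn => // _.
  rewrite (_ : [set w | _] = H (ratr q) @^-1` `]t, +oo[%classic).
    exact: (measurable_funPTI (H (ratr q)) (measurable_itv _)).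
  by apply/seteqP; split => w /=; rewrite in_itv/= andbT.
apply/seteqP; split => w /=; rewrite in_itv/=.
  move=> Yy; have [A0|] := pselect (A t w !=set0); last by left.
  have [s [s0 ts] sy] := inf_lt A0 Yy.
  right; have [q] := rat_in_itvoo sy; rewrite in_itv/= => /andP[sq qy].
  exists q => //=; rewrite (le_trans s0 (ltW sq)) qy /=.
  by apply: lt_le_trans ts _; apply: H_nd => //; exact: ltW.
move=> [nA|[q _]].
  have -> : Y t w = 0%R; last by [].
  rewrite /inverse_subordinator -/(A t w) (_ : A t w = set0) ?inf0//.
  by apply: contrapT => /eqP/set0P.
case: ifPn => // /andP[q0 qy] tq; apply: le_lt_trans qy.
have Aq : A t w (ratr q) by split.
by apply: ge_inf => //; have [] := @Y_has_inf t w; [exists (ratr q)|].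
Qed.

(** Writing [1 - exp (- eta y)] as [eta * b y] gives a nonnegative integrand whatever the sign of
    [eta], so Tonelli applies before any integrability is known; [eta = 0] is covered too. *)
Let b y := \int[mu]_(u in `[0%R, y[) (expR (- (eta * u)))%:E.

Let bE y : (0 <= y)%R -> (1 - expR (- (eta * y)))%:E = eta%:E * b y.
Proof.
rewrite le_eqVlt => /predU1P[<-|y0].
  by rewrite /b set_itvco0 integral_set0 mulr0 oppr0 expR0 subrr mule0.
have mexp A0 : measurable_fun A0 (fun t : R => (expR (- (eta * t)))%:E).
  by apply/measurable_EFinP; exact: (measurable_funTS (measurable_expRN _)).
rewrite /b integral_itv_bndo_bndc//.
have cexp : continuous (fun u : R => expR (- (eta * u))).
  move=> u; apply: continuous_comp; last exact: continuous_expR.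
  by apply: cvgN; apply: cvgM; [exact: cvg_cst|exact: cvg_id].
have dF (u : R) : is_derive u 1%R (fun u : R => - expR (- (eta * u)))%R (eta * expR (- (eta * u)))%R.
  have -> : (fun u : R => - expR (- (eta * u)))%R = (fun u => - (expR \o (fun u => - (eta * u))) u)%R by [].
  by apply: is_derive_eq; rewrite /GRing.scale/=; ring.
rewrite -integralZl//; last first.
  apply: continuous_compact_integrable; first exact: segment_compact.
  by apply: continuous_subspaceT.
under eq_integral do rewrite -EFinM.
rewrite (@continuous_FTC2 _ (fun u => eta * expR (- (eta * u)))%R
  (fun u => - expR (- (eta * u)))%R)//.
- by rewrite mulr0 oppr0 expR0 -EFinB opprK addrC.
- apply: continuous_subspaceT => u; apply: cvgM; [exact: cvg_cst|exact: cexp].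
- have cF : continuous (fun u : R => - expR (- (eta * u)))%R by move=> u; apply: cvgN; exact: cexp.
  split; first by move=> u _; have [] := dF u.
  + exact: (cvg_at_right_filter (cF 0%R)).
  + exact: (cvg_at_left_filter (cF y)).
- by move=> u _; rewrite derive1E; exact: derive_val.
Qed.

Let b_ge0 y : 0 <= b y.
Proof. by apply: integral_ge0 => u _; rewrite lee_fin expR_ge0. Qed.

Let pY t u := P [set w | (u < Y t w)%R].

Let tonelli_bY t : \int[P]_w b (Y t w) =
  \int[mu]_(u in D) ((expR (- (eta * u)))%:E * pY t u) /\
  measurable_fun [set: T] (fun w => b (Y t w)) /\ measurable_fun D (pY t).
Proof.
pose B : set (T * R) := [set z | (z.2 < Y t z.1)%R].
have mB : measurable B.
  have m2 : measurable_fun [set: T * R] (fun z => (z.2 < Y t z.1)%R).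
    apply: measurable_fun_ltr; first exact: measurable_snd.
    exact: (measurableT_comp (measurable_inverse_subordinator t) measurable_fst).
  have m1 : measurable [set true] by [].
  have := m2 measurableT _ m1; rewrite setTI.
  by congr measurable; apply/seteqP; split => z /=.
pose K (z : T * R) := (\1_B z * (expR (- (eta * z.2)) * \1_D z.2))%:E.
have mK : measurable_fun [set: T * R] K.
  apply/measurable_EFinP; apply: measurable_funM; first exact: measurable_indic.
  apply: measurable_funM; first exact: measurableT_comp (measurable_expRN eta) measurable_snd.
  apply: (measurableT_comp _ measurable_snd); apply: measurable_indic; exact: measurable_itv.
have K0 z : 0 <= K z by rewrite lee_fin !mulr_ge0// expR_ge0.
have bK w : b (Y t w) = \int[mu]_u K (w, u).
  rewrite /b integral_mkcond; apply: eq_integral => u _.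
  rewrite patchE /K !indicE.
  have -> : ((w, u) \in B) = (u < Y t w)%R by apply/idP/idP => [/set_mem|h]//; exact/mem_set.
  rewrite !mem_setE !in_itv/= andbT.
  by case: (0 <= u)%R; case: (u < Y t w)%R; rewrite ?mul1r ?mulr1 ?mulr0 ?mul0r.
have mY u : measurable [set w | (u < Y t w)%R].
  rewrite (_ : [set w | _] = Y t @^-1` `]u, +oo[%classic).
    by rewrite -[X in measurable X]setTI; apply: measurable_inverse_subordinator => //; exact: measurable_itv.
  by apply/seteqP; split => w /=; rewrite in_itv/= andbT.
have pK u : \int[P]_w K (w, u) = (expR (- (eta * u)) * \1_D u)%:E * pY t u.
  transitivity (\int[P]_w ((expR (- (eta * u)) * \1_D u)%:E * (\1_[set w | (u < Y t w)%R] w)%:E)).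
    by apply: eq_integral => w _; rewrite -EFinM mulrC /K !indicE.
  rewrite ge0_integralZl//; last first.
    by apply/measurable_EFinP; exact: measurable_indic.
  by rewrite integral_indic// setIT.
split; last split.
- transitivity (\int[P]_w \int[mu]_u K (w, u)); first exact: eq_integral.
  transitivity (\int[mu]_u \int[P]_w K (w, u)).
    exact: (@fubini_tonelli _ _ _ _ _ P mu K mK K0).
  rewrite [RHS]integral_mkcond; apply: eq_integral => u _.
  by rewrite pK patchE indicE; case: ifPn => _; rewrite ?mulr1// mulr0 mul0e.
- by rewrite (_ : (fun w => _) = fubini_F mu K); [exact: measurable_fun_fubini_tonelli_F|apply/funext => w; rewrite bK].
- pose pT u := P [set w | (u < Y t w)%R].
  apply: measurable_funTS; apply: (measurability _ (ErealGenOInfty.measurableE R)).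
  move=> _ [_ [x ->] <-]; rewrite setTI; apply: is_interval_measurable => r s /=.
  rewrite !in_itv/= !andbT => hr hs v /andP[rv vs]; rewrite in_itv/= andbT.
  apply: lt_le_trans hs _; apply: le_measure; rewrite ?inE// => w /=.
  exact: le_lt_trans.
Qed.

(** The lower bound compares [u < Y t] with [H u < t]. The upper bound only has [H u <= t], which is
    enlarged to [H u < t'] for [t' > t] and closed by continuity of [G]. *)
Let bY t : (0 <= t)%R -> \int[P]_w b (Y t w) = (G t)%:E.
Proof.
move=> t0; have [E [mb mpY]] := tonelli_bY t.
have mY u : measurable [set w | (u < Y t w)%R].
  rewrite (_ : [set w | _] = Y t @^-1` `]u, +oo[%classic).
    by rewrite -[X in measurable X]setTI; apply: measurable_inverse_subordinator => //; exact: measurable_itv.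
  by apply/seteqP; split => w /=; rewrite in_itv/= andbT.
have me A0 : measurable_fun A0 (fun u => (expR (- (eta * u)))%:E).
  by apply/measurable_EFinP; exact: (measurable_funTS (measurable_expRN _)).
apply/eqP; rewrite eq_le; apply/andP; split.
  have up t' : (t < t')%R -> \int[P]_w b (Y t w) <= (G t')%:E.
    move=> tt'; rewrite -FmE ?(le_lt_trans t0)// E.
    apply: ge0_le_integral => //.
    - by move=> u _; rewrite mule_ge0 ?lee_fin ?expR_ge0//; exact: measure_ge0.
    - exact: (emeasurable_funM (me D) mpY).
    - exact: (emeasurable_funM (me D) (measurable_p_slice t')).
    - move=> u; rewrite /= in_itv/= andbT => u0; rewrite lee_wpmul2l ?lee_fin ?expR_ge0//.
      apply: le_measure; rewrite ?inE//; try exact: measurable_H_lt.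
      by move=> w /= /(lt_Y u0) h; exact: le_lt_trans tt'.
  apply/lee_addgt0Pr => e e0.
  have cG : G @ t --> G t by exact: G_cont.
  have [del /= del0 hdel] := (@cvgrPdist_le _ _ _ _ _ _ _).1 cG e e0.
  have tt' : (t < t + del / 2)%R by rewrite ltrDl divr_gt0.
  apply: (le_trans (up _ tt')); rewrite -EFinD lee_fin.
  have : (`|G t - G (t + del / 2)| <= e)%R.
    apply: hdel => /=; rewrite opprD addrA subrr add0r normrN gtr0_norm ?divr_gt0//.
    by rewrite ltr_pdivrMr// ltr_pMr// ltr1n.
  by rewrite distrC ler_norml => /andP[_]; rewrite lerBlDl.
have /predU1P[t00|tgt0] : (0 == t)%R || (0 < t)%R by rewrite -le_eqVlt.
  by rewrite -t00 G_le0//; exact: integral_ge0.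
rewrite -FmE// E; apply: ge0_le_integral => //.
- by move=> u _; rewrite mule_ge0 ?lee_fin ?expR_ge0.
- exact: (emeasurable_funM (me D) (measurable_p_slice t)).
- exact: (emeasurable_funM (me D) mpY).
- move=> u; rewrite /= in_itv/= andbT => u0; rewrite lee_wpmul2l ?lee_fin ?expR_ge0//.
  apply: (@le_trans _ _ (P ([set w | (u < Y t w)%R] `|` [set w | ~ (A t w !=set0)]))).
    apply: le_measure; rewrite ?inE//; try exact: measurable_H_lt; try exact: measurableU.
    move=> w /= h; have [A0|nA] := pselect (A t w !=set0); last by right.
    by left; exact: Y_gt.
  have hU : P ([set w | (u < Y t w)%R] `|` [set w | ~ (A t w !=set0)]) <=
      P [set w | (u < Y t w)%R] + P [set w | ~ (A t w !=set0)].
    by apply: measureU2; [exact: mY|exact: measurable_empty].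
  apply: (le_trans hU).
  by rewrite (_ : P [set w | ~ (A t w !=set0)] = 0) ?adde0//; exact: empty_null.
Qed.

Lemma laplace_inverse_subordinator t : (0 <= t)%R ->
  'E_P[fun w => expR (- (eta * Y t w))] = (1 - eta * G t)%:E.
Proof.
move=> t0; have [_ [mb _]] := tonelli_bY t.
rewrite unlock.
have ib : P.-integrable [set: T] (fun w => b (Y t w)).
  apply/integrableP; split => //.
  under eq_integral do rewrite gee0_abs//.
  by rewrite bY// ltry.
transitivity (\int[P]_w (1 - eta%:E * b (Y t w))).
  apply: eq_integral => w _; rewrite -bE ?inverse_subordinator_ge0//.
  by rewrite -EFinB; congr EFin; ring.
rewrite integralB//; last 2 first.
- exact: (finite_measure_integrable_cst P 1).
- exact: integrableZl.
have I1 : \int[P]_(w in [set: T]) (1 : \bar R) = 1.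
  by rewrite integral_cst// mul1e; exact: probability_setT.
by rewrite I1 integralZl// bY// -EFinM -EFinB.
Qed.

End InverseSubordinator.

(** * Poisson process at an independent time *)

Section PoissonMixture.
Context {R : realType} {d : measure_display} {T : measurableType d}.
Context (P : probability T R).
Local Open Scope ereal_scope.

Lemma poisson_series (theta r : R) : (0 < r)%R ->
  \sum_(0 <= j <oo) (expR (theta * j%:R) * poisson_pmf r j)%:E =
  (expR (r * (expR theta - 1)))%:E.
Proof.
move=> r0; apply/cvg_lim => //.
rewrite (_ : (fun n => _) = EFin \o (fun n => series (exp_coeff (r * expR theta)) n *
    expR (- r))%R); last first.
  apply/funext => n; rewrite /= sumEFin /series/= mulr_suml; congr EFin.
  apply: eq_bigr => j _; rewrite /poisson_pmf r0 exp_coeffE mulrC exprMn expRM_natr.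
  by ring.
apply: cvg_EFin; first exact: nearW.
rewrite mulrBr mulr1 expRD; apply: cvgM; last exact: cvg_cst.
exact: (is_cvg_series_exp_coeff (r * expR theta)).
Qed.

Lemma integral_fibers (Z : T -> nat) (f : T -> \bar R) :
  (forall k, measurable [set w | Z w = k]) -> measurable_fun [set: T] f ->
  (forall w, 0 <= f w) ->
  \int[P]_w f w = \sum_(0 <= k <oo) \int[P]_(w in [set w | Z w = k]) f w.
Proof.
move=> mZ mf f0.
have UE : [set: T] = \bigcup_k [set w | Z w = k].
  by apply/seteqP; split => // w _; exists (Z w).
rewrite {1}UE ge0_integral_bigcup//; first by rewrite -UE.
by move=> i j _ _ [w [/= <- <-]].
Qed.

Lemma measurable_fun_fibers (Z : T -> nat) (g : nat -> T -> R) :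
  (forall k, measurable [set w | Z w = k]) ->
  (forall k, measurable_fun [set: T] (g k)) ->
  measurable_fun [set: T] (fun w => g (Z w) w).
Proof.
move=> mZ mg _ B mB; rewrite setTI.
rewrite (_ : _ @^-1` _ = \bigcup_k ([set w | Z w = k] `&` (g k @^-1` B))); last first.
  apply/seteqP; split => w /=; first by move=> h; exists (Z w).
  by move=> [k _ [/= <-]].
apply: bigcupT_measurable => k; apply: measurableI => //.
by rewrite -[X in measurable X]setTI; exact: mg.
Qed.

Variables (lambda : R) (N : R -> {RV P >-> nat}) (Y : T -> R).
Hypothesis lambda_gt0 : (0 < lambda)%R.
Hypothesis N_poisson : is_poisson_process P lambda (fun t => N t : T -> nat).
Hypothesis Y_ge0 : forall w, (0 <= Y w)%R.
Hypothesis measurable_Y : measurable_fun [set: T] Y.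
Hypothesis N_indep : forall (r : R) (B : set nat) (C : set R), (0 <= r)%R ->
  measurable C -> P (N r @^-1` B `&` Y @^-1` C) = P (N r @^-1` B) * P (Y @^-1` C).
Variable theta : R.
Let eta := (lambda * (1 - expR theta))%R.
Hypothesis integrable_Y : P.-integrable [set: T] (fun w => (expR (- (eta * Y w)))%:E).

Let measurable_N r (B : set nat) : measurable (N r @^-1` B).
Proof. exact: (measurable_funPTI (N r)). Qed.

Let measurable_expN r : measurable_fun [set: T] (fun w => expR (theta * (N r w)%:R))%R.
Proof.
by move=> _ B mB; rewrite setTI; apply: (measurable_N r [set k | B (expR (theta * k%:R))]).
Qed.

Let poisson_law r j : (0 < r)%R ->
  P (N r @^-1` [set j]) = (poisson_pmf (lambda * r) j)%:E.
Proof.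
move=> r0; have := poisson_process_increment N_poisson j (lexx 0%R) r0.
rewrite subr0 => <-; congr (P _); apply/seteqP.
have N0 w : N 0%R w = 0%N by exact: (poisson_process0 N_poisson w).
by split => w /=; rewrite N0 subn0.
Qed.

(** Independence of [N r] and [Y]: on the event [Y] in [C k] the variable [N r] keeps its Poisson
    law, with moment generating function [exp (lambda r (exp theta - 1)) = exp (- eta r)]. *)
Let integral_level (Z : T -> nat) (C : nat -> set R) k r : (0 < r)%R ->
  measurable (C k) -> [set w | Z w = k] = Y @^-1` C k ->
  \int[P]_(w in [set w | Z w = k]) (expR (theta * (N r w)%:R))%:E =
  \int[P]_(w in [set w | Z w = k]) (expR (- (eta * r)))%:E.
Proof.
move=> r0 mC ZC; set A := [set w | Z w = k].
have mA : measurable A by rewrite /A ZC -[X in measurable X]setTI; exact: measurable_Y.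
have mf : measurable_fun [set: T] (fun w => (expR (theta * (N r w)%:R) * \1_A w)%:E).
  by apply/measurable_EFinP; apply: measurable_funM; [exact: measurable_expN|exact: measurable_indic].
transitivity (\int[P]_w (expR (theta * (N r w)%:R) * \1_A w)%:E).
  rewrite integral_mkcond; apply: eq_integral => w _; rewrite patchE indicE.
  by case: ifPn; rewrite ?mulr1 ?mulr0.
rewrite (integral_fibers (Z := N r) _ mf); last 2 first.
- by move=> j; exact: (measurable_N r [set j]).
- by move=> w; rewrite lee_fin mulr_ge0// expR_ge0.
rewrite integral_cst//.
transitivity (P A * \sum_(0 <= j <oo) (expR (theta * j%:R) * poisson_pmf (lambda * r) j)%:E); last first.
  rewrite poisson_series ?mulr_gt0// muleC; congr (_%:E * _); congr expR; rewrite /eta; ring.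
have Pfin : P A \is a fin_num by exact: fin_num_measure.
rewrite -(fineK Pfin) -nneseriesZl; last first.
  by move=> j _; rewrite lee_fin mulr_ge0// ?expR_ge0// poisson_pmf_ge0.
apply: eq_eseriesr => j _; rewrite (fineK Pfin).
transitivity (\int[P]_(w in [set w | N r w = j]) ((expR (theta * j%:R))%:E * (\1_A w)%:E)).
  by apply: eq_integral => w; rewrite inE /= => <-; rewrite EFinM.
have mN : measurable [set w | N r w = j] by exact: (measurable_N r [set j]).
rewrite ge0_integralZl//; last first.
  by apply/measurable_EFinP; exact: measurable_indic.
rewrite integral_indic// setIC /A ZC.
rewrite [X in _ * X](N_indep [set j] (ltW r0) mC) (poisson_law j r0) EFinM.
by rewrite [RHS]muleCA (muleC (P _)).
Qed.

(** The identity for a random time with countably many values. The value [r k] need not lie in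
    [C k], so the lemma serves both the grid and the dominating time [cap]. *)
Let integral_grid (Z : T -> nat) (C : nat -> set R) (r : nat -> R) :
  (forall k, 0 < r k)%R -> (forall k, measurable (C k)) ->
  (forall k, [set w | Z w = k] = Y @^-1` C k) ->
  \int[P]_w (expR (theta * (N (r (Z w)) w)%:R))%:E =
  \int[P]_w (expR (- (eta * r (Z w))))%:E /\
  measurable_fun [set: T] (fun w => expR (theta * (N (r (Z w)) w)%:R)) /\
  measurable_fun [set: T] (fun w => expR (- (eta * r (Z w)))).
Proof.
move=> r0 mC ZC.
have mZ k : measurable [set w | Z w = k].
  by rewrite ZC -[X in measurable X]setTI; exact: measurable_Y.
have m1 : measurable_fun [set: T] (fun w => expR (theta * (N (r (Z w)) w)%:R)).
  exact: (measurable_fun_fibers (g := fun k w => expR (theta * (N (r k) w)%:R)) mZ).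
have m2 : measurable_fun [set: T] (fun w => expR (- (eta * r (Z w)))).
  exact: (measurable_fun_fibers (g := fun k w => expR (- (eta * r k))) mZ).
split; last by split.
rewrite (integral_fibers mZ); [|exact/measurable_EFinP|by move=> w; rewrite lee_fin expR_ge0].
rewrite [RHS](integral_fibers mZ); [|exact/measurable_EFinP|by move=> w; rewrite lee_fin expR_ge0].
apply: eq_eseriesr => k _.
transitivity (\int[P]_(w in [set w | Z w = k]) (expR (theta * (N (r k) w)%:R))%:E).
  by apply: eq_integral => w; rewrite inE /= => ->.
rewrite (integral_level (r0 k) (mC k) (ZC k)).
by apply: eq_integral => w; rewrite inE /= => ->.
Qed.

Let C (m k : nat) : set R := [set y | Num.truncn (m.+1%:R * y) = k].

Let measurable_C m k : measurable (C m k).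
Proof.
have mt : measurable_fun [set: R] (fun y : R => (Num.truncn (m.+1%:R * y))%:R : R).
  apply: nondecreasing_measurable => // x y xy.
  by rewrite ler_nat le_truncn// ler_wpM2l.
have := mt measurableT [set k%:R] (measurable_set1 _); rewrite setTI.
congr measurable; apply/seteqP; split => y /=; rewrite /C/=; last by move=> ->.
by move/eqP; rewrite eqr_nat => /eqP.
Qed.

(** Approximation from strictly above: [N] is right-continuous, and the positive times keep the
    Poisson rates positive. *)
Let grid m w : R := (Num.truncn (m.+1%:R * Y w)).+1%:R / m.+1%:R.

Let grid_bounds m w : (Y w < grid m w <= Y w + m.+1%:R^-1)%R.
Proof.
have h : (0 <= m.+1%:R * Y w)%R by rewrite mulr_ge0.
have /andP[h1 h2] := truncn_itv h.
rewrite /grid ltr_pdivlMr// mulrC h2/= ler_pdivrMr// mulrDl mulVf// -natr1 lerD2r.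
by rewrite [X in (_ <= X)%R]mulrC.
Qed.

Let grid_cvg w : grid m w @[m --> \oo] --> Y w.
Proof.
apply/cvgrPdist_le => e e0; near=> m.
have /andP[h1 h2] := grid_bounds m w.
rewrite distrC ger0_norm ?subr_ge0 ?(ltW h1)// lerBlDl (le_trans h2)// lerD2l ltW//.
by near: m; exact: (near_infty_natSinv_lt (PosNum e0)).
Unshelve. all: by end_near. Qed.

Let grid_N_cvg w : \forall m \near \oo, N (grid m w) w = N (Y w) w.
Proof.
have [e /= e0 he] := poisson_process_right_continuous N_poisson w (Y_ge0 w).
near=> m; have /andP[h1 h2] := grid_bounds m w.
apply: he => //=; rewrite distrC ger0_norm ?subr_ge0 ?(ltW h1)// ltrBlDl.
apply: (le_lt_trans h2); rewrite ltrD2l.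
by near: m; exact: (near_infty_natSinv_lt (PosNum e0)).
Unshelve. all: by end_near. Qed.

Let Ngrid_mgf m : \int[P]_w (expR (theta * (N (grid m w) w)%:R))%:E =
  \int[P]_w (expR (- (eta * grid m w)))%:E /\
  measurable_fun [set: T] (fun w => expR (theta * (N (grid m w) w)%:R)) /\
  measurable_fun [set: T] (fun w => expR (- (eta * grid m w))).
Proof.
apply: (integral_grid (Z := fun w => Num.truncn (m.+1%:R * Y w)) (C := C m)
  (r := fun k => (k.+1%:R / m.+1%:R)%R)) => //.
Qed.

(** A time beyond every [grid m], used for domination. The factor [1%:R] makes its level sets those
    of the grid with [m = 0]. *)
Let cap w : R := (Num.truncn (1%:R * Y w)).+2%:R.

Let cap_bounds w : (Y w + 1 <= cap w <= Y w + 2)%R.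
Proof.
have h : (0 <= 1%:R * Y w)%R by rewrite mulr_ge0.
have /andP[] := truncn_itv h; rewrite mul1r /cap mul1r => h1 h2.
rewrite -natr1 lerD2r (ltW h2)/= -natr1 -addrA.
by rewrite lerD// -natr1.
Qed.

Let exp_near (x : R) w : (Y w <= x <= Y w + 2)%R ->
  (expR (- (eta * x)) <= expR (`|eta| * 2) * expR (- (eta * Y w)))%R.
Proof.
move=> /andP[x1 x2]; rewrite -expRD ler_expR -lerBlDr.
have -> : (- (eta * x) - - (eta * Y w) = - eta * (x - Y w))%R by ring.
rewrite (le_trans (ler_norm _))// normrM normrN ler_wpM2l// ger0_norm ?subr_ge0//.
by rewrite lerBlDl.
Qed.

Let cap_integrable : P.-integrable [set: T] (fun w => (expR (theta * (N (cap w) w)%:R))%:E).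
Proof.
have [E [m1 m2]] : \int[P]_w (expR (theta * (N (cap w) w)%:R))%:E =
  \int[P]_w (expR (- (eta * cap w)))%:E /\
  measurable_fun [set: T] (fun w => expR (theta * (N (cap w) w)%:R)) /\
  measurable_fun [set: T] (fun w => expR (- (eta * cap w))).
  apply: (integral_grid (Z := fun w => Num.truncn (1%:R * Y w)) (C := C 0%N)
    (r := fun k => k.+2%:R%R)) => //.
apply/integrableP; split; first exact/measurable_EFinP.
under eq_integral do rewrite /= ger0_norm ?expR_ge0//.
rewrite E; apply: (@le_lt_trans _ _ (\int[P]_w ((expR (`|eta| * 2))%:E * (expR (- (eta * Y w)))%:E))).
  apply: ge0_le_integral => //.
  - exact/measurable_EFinP.
  - apply: emeasurable_funM => //; exact: measurable_int integrable_Y.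
  - move=> w _; rewrite -EFinM lee_fin; apply: exp_near.
    have /andP[h1 ->] := cap_bounds w; rewrite andbT (le_trans _ h1)// lerDl//.
rewrite integralZl//.
have fin : \int[P]_w (expR (- (eta * Y w)))%:E < +oo.
  have /integrableP[_] := integrable_Y.
  rewrite (eq_integral (fun w => (expR (- (eta * Y w)))%:E))// => w _.
  by rewrite gee0_abs// lee_fin expR_ge0.
rewrite -(@fineK _ (\int[P]_w _)) ?ge0_fin_numE//; first by rewrite -EFinM ltry.
by apply: integral_ge0 => w _; rewrite lee_fin expR_ge0.
Qed.

(** Dominated convergence on both sides along the grid. In the dominating function, the summand [1]
    handles [theta <= 0] and the exponential at [cap] handles [theta > 0]. *)
Lemma poisson_mixture_mgf : \int[P]_w (expR (theta * (N (Y w) w)%:R))%:E =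
  \int[P]_w (expR (- (eta * Y w)))%:E.
Proof.
have mexpY : measurable_fun [set: T] (fun w => expR (theta * (N (Y w) w)%:R)).
  apply: (measurable_fun_cvg (h := fun m w => expR (theta * (N (grid m w) w)%:R))).
    by move=> m; have [_ []] := Ngrid_mgf m.
  move=> w _; apply: cvg_near_cst; near=> m; congr expR; congr (_ * _%:R)%R.
  by near: m; exact: grid_N_cvg.
have N_nd w s t : (0 <= s)%R -> (s <= t)%R -> (N s w <= N t w)%N.
  exact: (poisson_process_nondecreasing N_poisson).
have lim1 : \int[P]_w (expR (theta * (N (grid m w) w)%:R))%:E @[m --> \oo] -->
    \int[P]_w (expR (theta * (N (Y w) w)%:R))%:E.
  apply: (dominated_cvg measurableT (g := fun w => 1 + (expR (theta * (N (cap w) w)%:R))%:E)) => //.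
  - by move=> m; apply/measurable_EFinP; have [_ []] := Ngrid_mgf m.
  - move=> w _; apply: cvg_near_cst; near=> m; congr (expR (_ * _%:R))%:E.
    by near: m; exact: grid_N_cvg.
  - exact: (integrableD measurableT (finite_measure_integrable_cst P 1 measurableT) cap_integrable).
  - move=> m w _; have /andP[h1 h2] := grid_bounds m w; have /andP[h3 _] := cap_bounds w.
    rewrite -EFinD lee_fin ger0_norm ?expR_ge0//.
    have [th|th] := leP theta 0%R.
      by rewrite ler_wpDr ?expR_ge0// expR_le1 mulr_le0_ge0.
    rewrite ler_wpDl// ler_expR ler_pM2l// ler_nat; apply: N_nd.
      by rewrite ltW// (le_lt_trans _ h1).
    apply: le_trans h3; apply: (le_trans h2); rewrite lerD2l invf_le1// ler1n//.
have lim2 : \int[P]_w (expR (- (eta * grid m w)))%:E @[m --> \oo] -->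
    \int[P]_w (expR (- (eta * Y w)))%:E.
  apply: (dominated_cvg measurableT (g := fun w => (expR (`|eta| * 2))%:E * (expR (- (eta * Y w)))%:E)) => //.
  - by move=> m; apply/measurable_EFinP; have [_ []] := Ngrid_mgf m.
  - move=> w _; apply: cvg_EFin; first exact: nearW.
    apply: continuous_cvg; first exact: continuous_expR.
    by apply: cvgN; apply: cvgM; [exact: cvg_cst|exact: grid_cvg].
  - exact: integrableZl.
  - move=> m w _; rewrite -EFinM lee_fin ger0_norm ?expR_ge0//; apply: exp_near.
    have /andP[h1 h2] := grid_bounds m w; rewrite (ltW h1)/= (le_trans h2)// lerD2l.
    by rewrite (@le_trans _ _ 1%R) ?ler1n// invf_le1// ler1n.
apply: (cvg_unique _ lim1) => //.
rewrite (_ : (fun m => _) = fun m => \int[P]_w (expR (- (eta * grid m w)))%:E)//.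
by apply/funext => m; have [] := Ngrid_mgf m.
Unshelve. all: by end_near. Qed.

End PoissonMixture.

(** * The density of the Levy measure *)

Section LevyDensityOf.
Context {R : realType}.
Local Open Scope ereal_scope.
Local Notation mu := (@lebesgue_measure R).
Local Notation D0 := (`]0%R, +oo[%classic : set R).

Variable nubar : {measure set R -> \bar R}.
Hypothesis nubar_levy : \int[nubar]_(s in D0) (Num.min s 1)%R%:E < +oo.
Hypothesis tail_ac : abs_continuous_on D0 (levy_tail nubar).

Let nubar_tail_fin x : (0 < x)%R -> nubar `]x, +oo[%classic = (levy_tail nubar x)%:E.
Proof.
move=> x0; rewrite /levy_tail fineK// ge0_fin_numE//.
have m0 : (0 < Num.min x 1)%R by rewrite lt_min x0 ltr01.
have sub : `]x, +oo[%classic `<=` D0.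
  by move=> s /=; rewrite !in_itv/= !andbT; exact: lt_trans.
have : (Num.min x 1)%:E * nubar `]x, +oo[%classic < +oo.
  rewrite -integral_cst; last exact: measurable_itv.
  apply: le_lt_trans nubar_levy.
  have mmin A : measurable_fun A (fun s : R => (Num.min s 1)%:E).
    by apply/measurable_EFinP; apply: measurable_funTS; apply: measurable_minr.
  have min0 (s : R) : (0 < s)%R -> 0 <= (Num.min s 1)%:E.
    by move=> s0; rewrite lee_fin le_min (ltW s0) ler01.
  apply: (@le_trans _ _ (\int[nubar]_(s in `]x, +oo[) (Num.min s 1)%:E)).
    apply: ge0_le_integral => //=.
    - by move=> s _; rewrite lee_fin ltW.
    - move=> s; rewrite in_itv/= andbT => xs; rewrite lee_fin le_min.
      by rewrite !ge_min lexx (ltW xs) orbT.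
  apply: ge0_subset_integral => //=.
  by move=> s; rewrite in_itv/= andbT; exact: min0.
case: (nubar _) (measure_ge0 nubar `]x, +oo[%classic) => [r _ _| |//]; first by rewrite ltry.
by rewrite gt0_muley ?lte_fin.
Qed.

Let nubar_itvoc x y : (0 < x)%R -> (x <= y)%R ->
  nubar `]x, y]%classic = `|levy_tail nubar y - levy_tail nubar x|%:E.
Proof.
move=> x0 xy; have y0 := lt_le_trans x0 xy.
have E : nubar `]x, +oo[%classic = nubar `]x, y]%classic + nubar `]y, +oo[%classic.
  rewrite -measureU//.
  - by congr (nubar _); rewrite -itv_bndbnd_setU// bnd_simp.
  - apply/disj_set2P; apply/disj_setPRL => s /=; rewrite !in_itv/= andbT => ys /andP[_ sy].
    by move: (lt_le_trans ys sy); rewrite ltxx.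
have -> : nubar `]x, y]%classic = nubar `]x, +oo[%classic - nubar `]y, +oo[%classic.
  by rewrite E addeK// nubar_tail_fin.
have : nubar `]y, +oo[%classic <= nubar `]x, +oo[%classic by rewrite E leeDr.
rewrite !nubar_tail_fin// lee_fin -EFinB => yx.
by rewrite distrC ger0_norm// subr_ge0.
Qed.

(** The tail is absolutely continuous on compact subintervals of []0, +oo[] only, and the mass near
    0 may be infinite. Radon-Nikodym is therefore applied on disjoint bounded pieces and the
    densities are added. *)
Lemma levy_measure_density : exists n : R -> R,
  [/\ measurable_fun [set: R] n, forall s, (0 <= n s)%R,
      forall s, (s <= 0)%R -> n s = 0%R &
      forall g : R -> \bar R, nnm g ->
        \int[nubar]_(s in D0) g s = \int[mu]_s ((n s)%:E * g s)].
Proof.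
(* The shift by 2 makes the first interval nonempty; [](k+1)^-1, k+1[] would be empty at [k = 0]. *)
pose D (k : nat) : set (measurableTypeR R) := `](k.+2%:R^-1)%R, (k.+2%:R)%R[%classic.
have mD k : measurable (D k) by exact: measurable_itv.
have UD : \bigcup_k D k = D0.
  apply/seteqP; split => s /=.
    by move=> [k _]; rewrite /D/= !in_itv/= andbT => /andP[+ _]; apply: lt_trans; rewrite invr_gt0.
  rewrite in_itv/= andbT => s0; pose k := maxn (Num.truncn s) (Num.truncn s^-1).
  exists k => //; rewrite /D/= in_itv/=; apply/andP; split.
    rewrite invf_plt ?posrE// (lt_le_trans (truncnS_gt _))// ler_nat.
    by rewrite ltnS leqW// leq_maxr.
  by rewrite (lt_le_trans (truncnS_gt _))// ler_nat ltnS leqW// leq_maxl.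
(* [R] and [measurableTypeR R] have the same measurable sets but are distinct
   measurable types; [nubar] is transported by the identity. *)
pose toB : R -> measurableTypeR R := fun x => x.
have mtoB : measurable_fun [set: R] toB by move=> _ B mB; rewrite setTI.
pose copy_of := (pushforward nubar toB : {measure set (measurableTypeR R) -> \bar R}).
pose m := copy_of mtoB.
have mE_int (A : set (measurableTypeR R)) (g : R -> \bar R) : measurable A -> nnm g ->
    \int[m]_(s in A) g s = \int[nubar]_(s in A) g s.
  move=> mA [mg g0]; rewrite /m /copy_of (ge0_integral_pushforward mtoB)//.
  exact: measurable_funTS.
pose E := seqDU D.
have mE k : measurable (E k) by exact: seqDU_measurable.
have ED k : E k `<=` D k by exact: subDsetl.
have finE k : nubar (E k) < +oo.
  apply: (@le_lt_trans _ _ (nubar `](k.+2%:R^-1)%R, +oo[%classic)).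
    apply: le_measure; rewrite ?inE//; first exact: mE.
    by move=> s /(ED k); rewrite /D/= !in_itv/= andbT => /andP[].
  by rewrite nubar_tail_fin ?ltry.
have nullE k (A : set (measurableTypeR R)) : measurable A -> A `<=` E k -> mu A = 0 -> nubar A = 0.
  move=> mA AE A0.
  have ab : (k.+2%:R^-1 < k.+2%:R :> R)%R.
    by rewrite (@lt_le_trans _ _ 1%R) ?invf_lt1 ?ler1n ?ltr1n.
  have h1 (x y : R) : (k.+2%:R^-1 <= x)%R -> (x <= y)%R -> (y <= k.+2%:R)%R ->
      nubar `]x, y]%classic = `|levy_tail nubar y - levy_tail nubar x|%:E.
    by move=> ax xy _; apply: nubar_itvoc => //; rewrite (lt_le_trans _ ax)// invr_gt0.
  have h2 : abs_continuous_itv (k.+2%:R^-1 : R) (k.+2%:R : R) (levy_tail nubar).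
    apply: tail_ac; first exact: ltW.
    by move=> s /=; rewrite !in_itv/= andbT => /andP[+ _]; apply: lt_le_trans; rewrite invr_gt0.
  exact (@abs_continuous_null R m (levy_tail nubar) _ _ ab h1 h2 A mA
    (subset_trans AE (ED k)) A0).
have /choice[u hu] k := @density_on R m (E k) (mE k) (finE k) (nullE k).
have u0 k s : (0 <= u k s)%R by have [_ h _ _ _] := hu k.
have mu_ k : measurable_fun [set: R] (u k) by have [h _ _ _ _] := hu k.
have uE k s : ~ E k s -> u k s = 0%R by have [_ _ h _ _] := hu k; exact: h.
(* The pieces [E k] are disjoint, so at most one term is nonzero at each point and the sum is
   finite. *)
pose n0 s := \sum_(0 <= k <oo) (u k s)%:E.
have n0E j s : E j s -> n0 s = (u j s)%:E.
  move=> Ejs; apply/cvg_lim => //; apply: cvg_near_cst; near=> j1.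
  rewrite big_mkord.
  have jm : (j < j1)%N by near: j1; exact: nbhs_infty_gt.
  rewrite (bigD1 (Ordinal jm))//= big1 ?adde0// => i ij; rewrite uE// => Eis.
  have ijE : (i : nat) = j by apply: (@trivIset_seqDU _ D) => //; exists s.
  by move/eqP: ij; apply; apply: val_inj.
have n00 s : (forall j, ~ E j s) -> n0 s = 0.
  by move=> h; rewrite /n0 eseries0// => k _ _; rewrite uE.
have n0fin s : n0 s \is a fin_num.
  have [[j Ejs]|h] := pselect (exists j, E j s); first by rewrite (n0E j).
  by rewrite n00// => j Ejs; apply: h; exists j.
have mn0 : measurable_fun [set: R] n0.
  apply: ge0_emeasurable_sum => [k s _ _|k _]; first by rewrite lee_fin.
  exact/measurable_EFinP.
have n0_ge0 s : 0 <= n0 s by apply: nneseries_ge0 => k _ _; rewrite lee_fin.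
exists (fine \o n0); split.
- by apply: measurableT_comp => //; exact: fine_measurable.
- by move=> s; rewrite fine_ge0.
- move=> s s0 /=; rewrite n00// => j /(ED j); rewrite /D/= in_itv/= => /andP[+ _].
  move=> js; have : (0 < s)%R by apply: lt_trans js; rewrite invr_gt0.
  by rewrite ltNge s0.
move=> g ng; have [mg g0] := ng.
transitivity (\sum_(0 <= k <oo) \int[nubar]_(s in E k) g s).
  rewrite -UD seqDU_bigcup_eq ge0_integral_bigcup//.
  exact: measurable_funTS.
transitivity (\sum_(0 <= k <oo) \int[mu]_s ((u k s)%:E * g s)).
  by apply: eq_eseriesr => k _; rewrite -mE_int//; have [_ _ _ _] := hu k; apply.
rewrite -integral_nneseries//; last 2 first.
- by move=> k; apply: emeasurable_funM; [apply/measurable_EFinP; exact: mu_|exact: mg].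
- by move=> k s _; rewrite mule_ge0// lee_fin.
apply: eq_integral => s _; rewrite /= fineK//.
have [[j Ejs]|h] := pselect (exists j, E j s); last first.
  have h' j : ~ E j s by move=> Ejs; apply: h; exists j.
  by rewrite n00// mul0e eseries0// => k _ _; rewrite uE// mul0e.
rewrite (n0E j)//; apply/cvg_lim => //; apply: cvg_near_cst; near=> j1.
rewrite big_mkord.
have jm : (j < j1)%N by near: j1; exact: nbhs_infty_gt.
rewrite (bigD1 (Ordinal jm))//= big1 ?adde0// => i ij; rewrite uE ?mul0e// => Eis.
have ijE : (i : nat) = j by apply: (@trivIset_seqDU _ D) => //; exists s.
by move/eqP: ij; apply; apply: val_inj.
Unshelve. all: by end_near. Qed.

Lemma levy_density_exists : nubar D0 = +oo -> exists n : R -> R,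
  [/\ levy_density n, \int[mu]_s (n s)%:E = +oo,
      forall s, (0 < s)%R -> density_tail n s = (levy_tail nubar s)%:E &
      forall x, (0 < x)%R ->
        \int[nubar]_(s in D0) (1 - expR (- (x * s)))%:E = (density_exponent n x)%:E].
Proof.
move=> nuoo; have [n [mn n0 nz nE]] := levy_measure_density.
have mD0 : measurable (D0 : set R) by exact: measurable_itv.
have D0E (h : R -> R) : measurable_fun [set: R] h -> (forall s, (0 < s)%R -> (0 <= h s)%R) ->
    \int[nubar]_(s in D0) (h s)%:E = \int[mu]_s (n s * h s)%:E.
  move=> mh h0.
  transitivity (\int[nubar]_(s in D0) (h s * \1_D0 s)%:E).
    by apply: eq_integral => s sD; rewrite indicE sD mulr1.
  rewrite nE; last first.
    split; first by apply/measurable_EFinP; apply: measurable_funM => //; exact: measurable_indic.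
    move=> s; rewrite lee_fin indicE mem_setE in_itv/= andbT.
    by case: ltP => [s0|_]; rewrite ?mulr1 ?mulr0// h0.
  apply: eq_integral => s _; rewrite -EFinM indicE mem_setE in_itv/= andbT.
  by case: ltP => [s0|s0]; rewrite ?mulr1// nz// !mul0r.
have hn : levy_density n.
  split => //; rewrite -(D0E (fun s : R => Num.min s 1%R))//.
    exact: measurable_minr.
  by move=> s s0; rewrite le_min (ltW s0) ler01.
exists n; split => //.
- transitivity (\int[nubar]_(s in D0) (1%R)%:E); last by rewrite integral_cst// mul1e.
  by rewrite (D0E (cst 1%R))//; apply: eq_integral => s _; rewrite /= mulr1.
- move=> s s0; rewrite -nubar_tail_fin// /density_tail /restr_density.
  rewrite -(D0E (\1_(`]s, +oo[%classic : set R)))//.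
  rewrite integral_indic//.
  congr (nubar _); apply/seteqP; split => r /=; rewrite !in_itv/= !andbT; first by case.
  by move=> sr; split => //; exact: lt_trans sr.
- move=> x x0; rewrite -density_exponentE ?(ltW x0)//.
  rewrite -(D0E (fun s => 1 - expR (- (x * s)))%R)//; first exact: measurable_1sub.
  by move=> s s0; rewrite one_sub_expRN_ge0// mulr_ge0// ltW.
Qed.

End LevyDensityOf.

(** * Choice of the truncation levels and of the point [X] *)

Section TruncationLevels.
Context {R : realType}.
Local Open Scope ereal_scope.
Local Notation mu := (@lebesgue_measure R).

(** Start the levels where the tail mass has reached [2 * A], and take [X = 1 / a 0]. A jump longer
    than [a 0] has [exp (- X s) <= 1 / 2], so every truncated exponent at [X] is at least half the
    mass beyond [a 0], that is at least [A]. *)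
Lemma truncation_levels (n : R -> R) (A : R) : levy_density n ->
  \int[mu]_s (n s)%:E = +oo -> exists (a : nat -> R) (X : R),
  [/\ forall j, (0 < a j)%R, nonincreasing_seq a, a @ \oo --> (0 : R)%R,
      forall j, (a j <= 1)%R & (0 < X)%R /\
      forall j, (A <= fine (density_tail n (a j)) -
        laplace_restr n `]a j, +oo[%classic X)%R].
Proof.
move=> hn noo; pose b (j : nat) : R := (j.+1%:R^-1)%R.
have b0 j : (0 < b j)%R by rewrite invr_gt0.
have bni : nonincreasing_seq b.
  by move=> i j ij; rewrite lef_pV2 ?posrE// ler_nat.
have bcv : b @ \oo --> (0 : R)%R by exact: cvg_harmonic.
have /cvgryPge/(_ (2 * A)%R)[j0 _ hj0] := cvg_tail_infty hn noo b0 bni bcv.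
pose a j := b (j + j0)%N; pose X := (a 0%N)^-1%R.
have a0 j : (0 < a j)%R by exact: b0.
have ani : nonincreasing_seq a by move=> i j ij; apply: bni; rewrite leq_add2r.
exists a, X; split => //.
- by rewrite /a; move: bcv; rewrite -(cvg_shiftn j0).
- by move=> j; rewrite /a /b invf_le1// ler1n.
split; first by rewrite invr_gt0.
move=> j; pose W i := restr_density n `]a i, +oo[%classic.
have nW i : nnm (W i) by apply: (nnm_restr_density hn); exact: measurable_itv.
have mexp : measurable_fun [set: R] (expf (- X)).
  apply/measurable_EFinP; apply: measurableT_comp; first exact: measurable_expR.
  exact: measurable_funM.
have [_ n0 _ _] := hn.
have le : \int[mu]_s (W j s * expf (- X) s) + \int[mu]_s ((2^-1)%:E * W 0%N s) <=
    density_tail n (a j).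
  rewrite -ge0_integralD//; last 4 first.
  - by move=> s _; rewrite mule_ge0 ?(nW j).2// lee_fin expR_ge0.
  - by apply: emeasurable_funM => //; exact: (nW j).1.
  - by move=> s _; rewrite mule_ge0 ?(nW 0%N).2// lee_fin.
  - by apply: emeasurable_funM => //; exact: (nW 0%N).1.
  apply: ge0_le_integral => //.
  - move=> s _; rewrite adde_ge0// mule_ge0 ?(nW _).2// lee_fin// expR_ge0.
  - apply: emeasurable_funD; apply: emeasurable_funM => //; exact: (nW _).1.
  - exact: (nW j).1.
  move=> s _; rewrite /W /restr_density /expf -!EFinM -EFinD lee_fin.
  rewrite !indicE !mem_setE !in_itv/= !andbT.
  have aj0 : (a j <= a 0%N)%R by exact: ani.
  have [sa|sa] := ltP (a 0%N) s.
    rewrite (le_lt_trans aj0 sa) !mulr1.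
    have : (expR (- X * s) <= 2^-1)%R.
      rewrite mulNr expRN lef_pV2 ?posrE ?expR_gt0//.
      apply: le_trans (expR_ge1Dx _).
      have : (1 <= X * s)%R by rewrite mulrC ler_pdivlMr ?mul1r ?(ltW sa).
      lra.
    by have := n0 s; nra.
  rewrite !mulr0 addr0; have [sj|sj] := ltP (a j) s; last by rewrite mulr0 mul0r.
  rewrite mulr1 ler_piMr// expR_le1 mulNr oppr_le0 mulr_ge0//.
    by rewrite invr_ge0 ltW.
  by rewrite ltW// (lt_trans (a0 j)).
rewrite ge0_integralZl// in le; last 2 first.
- exact: (nW 0%N).1.
- by move=> s _; exact: (nW 0%N).2.
have fj := density_tail_fin hn (a0 j); have f0 := density_tail_fin hn (a0 0%N).
have I0 : 0 <= \int[mu]_s (W j s * expf (- X) s).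
  by apply: integral_ge0 => s _; rewrite mule_ge0 ?(nW j).2// lee_fin expR_ge0.
have := hj0 j0 (leqnn j0); rewrite -[b j0]/(a 0%N) => h2.
move: le; rewrite -[X in _ + _ * X]/(density_tail n (a 0%N)) -(fineK fj) -(fineK f0).
rewrite /laplace_restr -/(W j).
case: (\int[mu]_s (W j s * _)) I0 => [r _| |]//.
by rewrite -EFinM -EFinD lee_fin /=; lra.
Qed.

End TruncationLevels.

Theorem lemma2 (R : realType) (d : measure_display) (T : measurableType d)
  (P : probability T R)
  (nubar : {measure set R -> \bar R}) (f : R -> R)
  (H : R -> {RV P >-> R}) (N : R -> {RV P >-> nat}) (lambda : R)
  (nubar_levy :
    (\int[nubar]_(s in `]0%R, +oo[) (Num.min s 1)%R%:E < +oo)%E)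
  (f_bernstein : forall x : R, 0 < x ->
    (f x)%:E = (\int[nubar]_(s in `]0%R, +oo[) (1 - expR (- (x * s)))%R%:E)%E)
  (nubar_infinite : nubar `]0, +oo[%classic = +oo%E)
  (tail_ac : abs_continuous_on `]0, +oo[%classic (levy_tail nubar))
  (H_subordinator : is_subordinator P (fun t => H t : T -> R))
  (H_exponent : has_laplace_exponent P (fun t => H t : T -> R) f)
  (lambda_gt0 : 0 < lambda)
  (N_poisson : is_poisson_process P lambda (fun t => N t : T -> nat))
  (N_indep_Y : independent_processes P (fun t => N t : T -> nat)
    (inverse_subordinator (fun t => H t : T -> R))) :
  let Y := inverse_subordinator (fun t => H t : T -> R) in
  let ltilde (t eta : R) : \bar R := ('E_P[fun w => expR (- (eta * Y t w))])%E in
  let M (theta t : R) : \bar R :=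
    mmt_gen_fun P (fun w => (N (Y t w) w)%:R) theta in
  forall theta : R,
  [/\ (forall t : R, 0 <= t ->
         M theta t = ltilde t (lambda * (1 - expR theta))),
      (forall t : R, 0 <= t -> M theta t \is a fin_num),
      abs_continuous_on `[0, +oo[%classic (fun t => fine (M theta t)),
      (forall t : R, 0 < t ->
         caputo_djrbashian (levy_tail nubar) (fun t' => fine (M theta t')) t =
         ((lambda * (expR theta - 1))%:E * M theta t)%E) &
      M theta 0 = 1%E].
Proof.
move=> Y ltilde M theta; pose eta := lambda * (1 - expR theta).
have [n [hn noo tailE fE]] := levy_density_exists nubar_levy tail_ac nubar_infinite.
have [a [X [a0 ani acv a1 [X0 hA]]]] := truncation_levels (`|eta| + 1) hn noo.
have hkap j : 1 <= eta + fine (density_tail n (a j)) -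
    laplace_restr n `]a j, +oo[%classic X.
  by have := hA j; have := ler_norm (- eta); rewrite normrN; lra.
(* The margin [|eta| + 1] also covers the parameter [0] with the same levels and [X]; from it comes
   [f X >= 1], used for the almost sure finiteness of [Y]. *)
have hkap0 j : 1 <= 0 + fine (density_tail n (a j)) -
    laplace_restr n `]a j, +oo[%classic X.
  by have := hA j; have := normr_ge0 eta; lra.
have fE' x : 0 < x -> f x = density_exponent n x.
  by move=> x0; apply: EFin_inj; rewrite f_bernstein// fE.
pose G := lim_pot n a eta.
have Gnd s t : s <= t -> G s <= G t by exact: (lim_pot_nd hn a0 ani X0 ltr01 hkap).
have G0 t : t <= 0 -> G t = 0 by exact: (lim_pot_le0 hn noo a0 ani acv X0 ltr01 hkap).
have Gac b : abs_continuous_itv 0 b G by exact: (lim_pot_ac hn noo a0 ani acv X0 ltr01 hkap).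
have Gcont : continuous G by exact: abs_continuous_continuous Gac G0.
have nG : nnm (fun t => (G t)%:E) by exact: (nnm_lim_pot hn a0 ani X0 ltr01 hkap).
have Xpos x : X <= x -> 0 < x by exact: lt_le_trans.
have Glap x : X <= x -> (\int[lebesgue_measure]_(t in `[0%R, +oo[)
    (expR (- (x * t)) * G t)%:E)%E = (x^-1 * (eta + f x)^-1)%:E.
  move=> Xx; rewrite (fE' x (Xpos x Xx)).
  rewrite -(laplace_lim_pot hn a0 ani acv X0 ltr01 hkap Xx).
  pose g t := (expf (- x) t * (G t)%:E)%E.
  have ng : nnm g.
    apply: nnmM => //; split; last by move=> t; rewrite lee_fin expR_ge0.
    apply/measurable_EFinP; apply: measurableT_comp; first exact: measurable_expR.
    exact: measurable_funM.
  transitivity (\int[lebesgue_measure]_t g t)%E.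
    rewrite integral_mkcond; apply: eq_integral => t _.
    rewrite patchE /g /expf mem_setE in_itv/= andbT -EFinM mulNr.
    (* [G] vanishes on the negative axis, so the transform over the half line is the integral over
       the whole line. *)
    by case: leP => // t0; rewrite G0 ?mulr0// ltW.
  rewrite -(integral_refl 0 ng); apply: eq_integral => s _.
  by rewrite /g /expf sub0r mulrNN.
have fX0 : 0 < f X.
  have := exponent_gt0 hn a0 ani acv X0 hkap0 (lexx X).
  by rewrite fE'// add0r; exact: lt_le_trans.
have ef0 x : X <= x -> 0 < eta + f x.
  move=> Xx; rewrite (fE' x (Xpos x Xx)).
  by apply: lt_le_trans ltr01 _; exact: (exponent_gt0 hn a0 ani acv X0 hkap Xx).
have ltE t : 0 <= t -> ltilde t eta = (1 - eta * G t)%:E.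
  exact: (laplace_inverse_subordinator H_subordinator H_exponent X0 fX0 ef0 Gnd G0 Gcont Glap).
have mY t : measurable_fun [set: T] (Y t).
  exact: measurable_inverse_subordinator.
have Y0 t w : 0 <= Y t w by exact: inverse_subordinator_ge0.
have ME t : 0 <= t -> M theta t = ltilde t eta.
  move=> t0; rewrite /M /mmt_gen_fun /ltilde unlock.
  rewrite -(@poisson_mixture_mgf _ _ _ P lambda N (Y t) lambda_gt0 N_poisson (Y0 t) (mY t)).
  - by apply: eq_integral => w _; rewrite /= mulrC.
  - move=> r B C r0 mC; apply: N_indep_Y; apply: sub_sigma_algebra.
      exists r; first by rewrite /= in_itv/= r0.
      by exists B => //; rewrite setTI.
    exists t; first by rewrite /= in_itv/= t0.
    by exists C => //; rewrite setTI.
  - apply/integrableP; split.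
      apply/measurable_EFinP; apply: measurableT_comp; first exact: measurable_expR.
      by apply: measurable_funN; apply: measurable_funM.
    have := ltE t t0; rewrite /ltilde unlock => E.
    under eq_integral do rewrite /= ger0_norm ?expR_ge0//.
    by rewrite E ltry.
have fME t : 0 <= t -> M theta t = (1 - eta * G t)%:E by move=> t0; rewrite ME// ltE.
split.
- exact: ME.
- by move=> t t0; rewrite fME.
- move=> u v uv sub e e0.
  have u0 : 0 <= u.
    by have := sub u; rewrite /= !in_itv/= lexx uv !andbT => /(_ isT).
  (* The added 1 avoids a division by zero when [theta = 0]. *)
  have eta1 : 0 < `|eta| + 1 by rewrite ltr_wpDl.
  have [del del0 hdel] := Gac v (e / (`|eta| + 1)) (divr_gt0 e0 eta1).
  exists del => // m x y xy txy dxy.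
  have xy0 i : (i < m)%N -> [/\ 0 <= x i, x i <= y i & y i <= v].
    by move=> /xy[h1 h2 h3]; split => //; exact: le_trans h1.
  have := hdel m x y xy0 txy dxy; rewrite ltr_pdivlMr//; apply: le_lt_trans.
  rewrite mulr_suml; apply: ler_sum => i _; have [h1 h2 _] := xy0 i (ltn_ord i).
  rewrite !fME ?(le_trans h1)//=.
  have -> : 1 - eta * G (y i) - (1 - eta * G (x i)) = - (eta * (G (y i) - G (x i))) by ring.
  by rewrite normrN normrM mulrC ler_wpM2l// lerDl.
- move=> t t0; rewrite fME ?(ltW t0)// -EFinM.
  have WE y : 0 <= y -> fine (M theta y) = 1 - eta * lim_pot n a eta y.
    by move=> y0; rewrite fME.
  rewrite (caputo_lim_pot hn noo a0 ani acv X0 ltr01 hkap a1 t0 tailE WE) WE ?(ltW t0)//.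
  by rewrite (_ : lambda * (expR theta - 1) = - eta)// /eta; ring.
- by rewrite fME// G0// mulr0 subr0.
Qed.
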